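(* Let $(T_1,T_2)$ be a pair of commuting contractions on a Hilbert space $\mathcal H$ such that $T=T_1T_2$ is completely nonunitary, and let $((G_{\sharp1},G_{\sharp2}),(W_{\sharp1},W_{\sharp2}),\Theta_T)$ be its characteristic triple. Then the Sz.-Nagy--Foias model space $$\mathcal H_{NF}=\big(H^2(\mathcal D_{T^*})\oplus\overline{\Delta_TL^2(\mathcal D_T)}\big)\ominus\{\Theta_Tf\oplus\Delta_Tf: f\in H^2(\mathcal D_T)\}$$ is coinvariant under (i.e., invariant under the adjoint of) each of the three operators $$M_{G_{\sharp1}^*+zG_{\sharp2}}\oplus W_{\sharp1},\quad M_{G_{\sharp2}^*+zG_{\sharp1}}\oplus W_{\sharp2},\quad M_z\oplus M_\zeta|_{\overline{\Delta_TL^2(\mathcal D_T)}}$$ on $H^2(\mathcal D_{T^*})\oplus\overline{\Delta_TL^2(\mathcal D_T)}$, and the triple $(T_1,T_2,T_1T_2)$ is unitarily equivalent (via one unitary $\mathcal H\to\mathcal H_{NF}$) to the triple of compressions $$P_{\mathcal H_{NF}}\big(M_{G_{\sharp1}^*+zG_{\sharp2}}\oplus W_{\sharp1},\; M_{G_{\sharp2}^*+zG_{\sharp1}}\oplus W_{\sharp2},\; M_z\oplus M_\zeta|_{\overline{\Delta_TL^2(\mathcal D_T)}}\big)\big|_{\mathcal H_{NF}}.$$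
   Context: Conventions. For a contraction $A$, $D_A=(I-A^*A)^{1/2}$ and $\mathcal D_A=\overline{\operatorname{Ran}}\,D_A$. A contraction is completely nonunitary (c.n.u.) if it has no nonzero reducing subspace on which it is unitary. $H^2(\mathcal E)\subset L^2(\mathcal E)$ are the $\mathcal E$-valued Hardy space of the unit disk $\mathbb D$ and the $L^2$-space on the unit circle $\mathbb T$; $M_\varphi$ is multiplication by $\varphi$; $M_z$ (on $H^2$) and $M_\zeta$ (on $L^2$) are multiplication by the coordinate function. Characteristic triple of a commuting pair of contractions $(T_1,T_2)$ on $\mathcal H$ with $T=T_1T_2$ c.n.u.: (a) $\Theta_T(z)=[-T+zD_{T^*}(I-zT^* )^{-1}D_T]|_{\mathcal D_T}:\mathcal D_T\to\mathcal D_{T^*}$ for $z\in\mathbb D$ (Sz.-Nagy--Foias characteristic function), and $\Delta_T(\zeta)=(I-\Theta_T(\zeta)^*\Theta_T(\zeta))^{1/2}$ for a.e. $\zeta\in\mathbb T$. (b) Let $(V_1,V_2)$ be an Andô isometric dilation of $(T_1,T_2)$: commuting isometries on a Hilbert space $\mathcal K\supset\mathcal H$ with $V_k^*|_{\mathcal H}=T_k^*$. Put $V=V_1V_2$, $\mathcal L_*=\overline{(I-VT^* )\mathcal H}$, $\mathcal L_{k*}=\overline{(I-V_kT_k^* )\mathcal H}$, and let $\iota_*:\mathcal L_*\to\mathcal D_{T^*}$ be the unitary with $\iota_*(I-VT^* )h=D_{T^*}h$. Let $\Lambda_{c*}:\mathcal L_*\to\mathcal L_{1*}\oplus\mathcal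 L_{2*}$ be the isometry $(I-VT^* )h\mapsto(I-V_1T_1^* )T_2^*h\oplus(I-V_2T_2^* )h$, and let $U_{c*0}$ be the unitary from $\overline{\operatorname{Ran}}\,\Lambda_{c*}$ onto $\operatorname{clos}\{(I-V_1T_1^* )h\oplus(I-V_2T_2^* )T_1^*h:h\in\mathcal H\}$ given by $(I-V_1T_1^* )T_2^*h\oplus(I-V_2T_2^* )h\mapsto(I-V_1T_1^* )h\oplus(I-V_2T_2^* )T_1^*h$. Let $\mathcal F_{c*}=\mathcal L_{1*}\oplus\mathcal L_{2*}$ if the domain and range of $U_{c*0}$ have orthogonal complements of equal dimension there, and $\mathcal F_{c*}=\mathcal L_{1*}\oplus\mathcal L_{2*}\oplus\ell^2$ ($\ell^2$ an infinite-dimensional Hilbert space) otherwise; let $U_{c*}$ be any unitary on $\mathcal F_{c*}$ extending $U_{c*0}$ and $P_{c*}$ the orthogonal projection of $\mathcal F_{c*}$ onto the summand $\mathcal L_{1*}$; $P_{c*}^\perp=I-P_{c*}$. (The tuple $(\mathcal F_{c*},\Lambda_{c*},P_{c*},U_{c*})$ is a coordinate-free Andô tuple for $(T_1^*,T_2^* )$.) Regarding $\Lambda_{c*}$ as a map into $\mathcal F_{c*}$, define contractions on $\mathcal D_{T^*}$ by $G_{\sharp1}=\iota_*\Lambda_{c*}^*P_{c*}^\perp U_{c*}\Lambda_{c*}\iota_*^*$ and $G_{\sharp2}=\iota_*\Lambda_{c*}^*U_{c*}^*P_{c*}\Lambda_{c*}\iota_*^*$ (they do not depend on the choices made). (c)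 Let $Q\ge0$, $Q^2=\operatorname{SOT-lim}_nT^nT^{*n}$. The formulas $X_k^*Qh=QT_k^*h$ ($k=1,2$) define commuting isometries $X_1^*,X_2^*$ on $\overline{\operatorname{Ran}}\,Q$; put $X^*=X_1^*X_2^*$. Let $W_D^*$ on $\mathcal R_D\supset\overline{\operatorname{Ran}}\,Q$ be the minimal unitary extension of the isometry $X^*$ (so $\mathcal R_D=\overline{\operatorname{span}}\{W_D^nx:n\ge0,x\in\overline{\operatorname{Ran}}\,Q\}$), and let $(W_{\partial1}^*,W_{\partial2}^* )$ be the commuting unitary extension of $(X_1^*,X_2^* )$ to $\mathcal R_D$ with $W_{\partial1}^*W_{\partial2}^*=W_D^*$. Let $\mathcal U$ on $\widetilde{\mathcal K}\supset\mathcal H$ be the minimal unitary dilation of $T$, $\mathcal L=\overline{(\mathcal U-T)\mathcal H}$, $\mathcal L_*^{\min}=\overline{(I-\mathcal UT^* )\mathcal H}$, $M(\mathcal L)=\bigoplus_{n\in\mathbb Z}\mathcal U^n\mathcal L$, $M(\mathcal L_*^{\min})=\bigoplus_{n\in\mathbb Z}\mathcal U^n\mathcal L_*^{\min}$, $\mathcal R=\widetilde{\mathcal K}\ominus M(\mathcal L_*^{\min})$. Let $\boldsymbol\iota:M(\mathcal L)\to L^2(\mathcal D_T)$ be the unitary with $\boldsymbol\iota\,\mathcal U^n(\mathcal U-T)h=\zeta^nD_Th$. Let $\omega_D:\mathcal R\to\mathcal R_D$ and $\omega_{NF}:\mathcal R\to\overline{\Delta_TL^2(\mathcal D_T)}$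 be the unitaries determined by $\omega_D\,\mathcal U^nP_{\mathcal R}h=W_D^nQh$ ($h\in\mathcal H,n\ge0$) and $\omega_{NF}P_{\mathcal R}\ell=\Delta_T\cdot\boldsymbol\iota\ell$ ($\ell\in M(\mathcal L)$). Put $u=\omega_{NF}\omega_D^*$ and $W_{\sharp k}=uW_{\partial k}u^*$, $k=1,2$; these are commuting unitaries on $\overline{\Delta_TL^2(\mathcal D_T)}$ with product $M_\zeta$. The characteristic triple of $(T_1,T_2)$ is $((G_{\sharp1},G_{\sharp2}),(W_{\sharp1},W_{\sharp2}),\Theta_T)$. *)

(* Defs.v *)
From HB Require Import structures.
From mathcomp Require Import all_boot all_order all_algebra.
From mathcomp Require Import complex.
From mathcomp Require Import all_classical all_reals all_analysis.
From mathcomp Require Import measurable_realfun.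
From mathcomp Require Import ring lra.

Set Implicit Arguments.
Unset Strict Implicit.
Unset Printing Implicit Defensive.

Import Order.TTheory GRing.Theory Num.Theory.
Import numFieldTopology.Exports numFieldNormedType.Exports.

Local Open Scope classical_set_scope.
Local Open Scope ring_scope.
Local Open Scope complex_scope.

(* Inner products are linear in the first argument, conjugate-linear in the
   second one. *)
HB.mixin Record Lmodule_isInner (R : realType) V of GRing.Lmodule R[i] V := {
  inner_form : {dot V for (@Num.Def.conjC R[i])}
}.

#[short(type="innerType")]
HB.structure Definition InnerProduct (R : realType) :=
  {V of Lmodule_isInner R V & GRing.Lmodule R[i] V}.

Definition inner (R : realType) (V : innerType R) (x y : V) : R[i] :=
  (@inner_form R V : {dot V for (@Num.Def.conjC R[i])}) x y.

Section Inner.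
Context {R : realType}.
Implicit Types V W : innerType R.

Definition hnorm V (x : V) : R := Num.sqrt (complex.Re (inner x x)).

Definition hcvg V (u : nat -> V) (x : V) : Prop :=
  hnorm (u n - x) @[n --> \oo] --> (0 : R).

Definition hcauchy V (u : nat -> V) : Prop :=
  forall e : R, 0 < e ->
    exists N, forall m n, (N <= m)%N -> (N <= n)%N -> hnorm (u m - u n) < e.

End Inner.

HB.mixin Record Inner_isComplete (R : realType) V of InnerProduct R V := {
  hilbert_complete : forall u : nat -> V, hcauchy u -> exists x, hcvg u x
}.

#[short(type="hilbertType")]
HB.structure Definition Hilbert (R : realType) :=
  {V of Inner_isComplete R V & InnerProduct R V}.

Section MakeDot.
Variables (R : realType) (V : lmodType R[i]) (op : V -> V -> R[i]).
Hypothesis op_linear : forall a x y z, op (a *: x + y) z = a * op x z + op y z.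
Hypothesis op_herm : forall x y, op x y = (op y x)^*.
Hypothesis op_pos : forall x, x != 0 -> 0 < op x x.

Let op_bilinear :
  bilinear_for ( *%R : R[i] -> R[i] -> R[i]) (@Num.Def.conjC R[i] \; *%R) op.
Proof.
split=> z a x y /=; first exact: op_linear.
by rewrite op_herm op_linear rmorphD rmorphM (op_herm z x) (op_herm z y).
Qed.

#[local] HB.instance Definition _ := bilinear_isBilinear.Build R[i] V V R[i]
  ( *%R : R[i] -> R[i] -> R[i]) (@Num.Def.conjC R[i] \; *%R) op op_bilinear.

Let op_hermitian (x y : V) : op x y = (-1) ^+ false * Num.Def.conjC (op y x).
Proof. by rewrite expr0 mul1r op_herm. Qed.

#[local] HB.instance Definition _ := isHermitianSesquilinear.Build R[i] V false
  (@Num.Def.conjC R[i]) op op_hermitian.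

#[local] HB.instance Definition _ := isDotProduct.Build R[i] V op op_pos.

Definition make_dot : {dot V for (@Num.Def.conjC R[i])} := op.

End MakeDot.

Section InnerTheory.
Context {R : realType}.
Implicit Types V : innerType R.

Lemma innerDl V (x y z : V) : inner (x + y) z = inner x z + inner y z.
Proof. by rewrite /inner linearDl. Qed.

Lemma innerDr V (x y z : V) : inner x (y + z) = inner x y + inner x z.
Proof. by rewrite /inner linearDr. Qed.

Lemma innerZl V a (x z : V) : inner (a *: x) z = a * inner x z.
Proof. by rewrite /inner linearZl_LR. Qed.

Lemma innerZr V a (x z : V) : inner x (a *: z) = a^* * inner x z.
Proof. by rewrite /inner linearZr_LR. Qed.

Lemma innerC V (x y : V) : inner x y = (inner y x)^*.
Proof. by rewrite /inner hermC expr0 mul1r. Qed.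

Lemma inner_ge0 V (x : V) : 0 <= inner x x.
Proof. exact: dnorm_ge0. Qed.

Lemma inner_eq0 V (x : V) : inner x x = 0 -> x = 0.
Proof. by move=> /eqP; rewrite dnorm_eq0 => /eqP. Qed.

Lemma innerNl V (x z : V) : inner (- x) z = - inner x z.
Proof. by rewrite -scaleN1r innerZl mulN1r. Qed.

Lemma innerNr V (x z : V) : inner x (- z) = - inner x z.
Proof. by rewrite innerC innerNl [in RHS]innerC rmorphN. Qed.

Lemma inner0l V (z : V) : inner 0 z = 0.
Proof. by rewrite -(scale0r (0 : V)) innerZl mul0r. Qed.

Definition reip V (x y : V) : R := complex.Re (inner x y).

Lemma ReD (a b : R[i]) : complex.Re (a + b) = complex.Re a + complex.Re b.
Proof. by case: a b => [? ?] [? ?]. Qed.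

Lemma ReN (a : R[i]) : complex.Re (- a) = - complex.Re a.
Proof. by case: a. Qed.

Lemma reipDl V (x y z : V) : reip (x + y) z = reip x z + reip y z.
Proof. by rewrite /reip innerDl ReD. Qed.

Lemma reipDr V (x y z : V) : reip x (y + z) = reip x y + reip x z.
Proof. by rewrite /reip innerDr ReD. Qed.

Lemma reipNl V (x z : V) : reip (- x) z = - reip x z.
Proof. by rewrite /reip innerNl ReN. Qed.

Lemma reipNr V (x z : V) : reip x (- z) = - reip x z.
Proof. by rewrite /reip innerNr ReN. Qed.

Lemma reipC V (x y : V) : reip x y = reip y x.
Proof. by rewrite /reip innerC; case: (inner y x). Qed.

Lemma reipZl V (a b : R) (x y : V) :
  reip ((a +i* b) *: x) y = a * reip x y - b * complex.Im (inner x y).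
Proof. by rewrite /reip innerZl; case: (inner x y). Qed.

Lemma Im_inner V (x y : V) : complex.Im (inner x y) = reip x ('i *: y).
Proof.
rewrite /reip innerZr; case: (inner x y) => a b /=.
by rewrite mul0r mulN1r opprK add0r.
Qed.

Lemma reip_ge0 V (x : V) : 0 <= reip x x.
Proof. by have := inner_ge0 x; rewrite /reip lecE => /andP[]. Qed.

Lemma inner_reip V (x : V) : inner x x = (reip x x)%:C.
Proof.
have := inner_ge0 x; rewrite /reip lecE => /andP[/eqP + _].
by case: (inner x x) => a b /= ->.
Qed.

Lemma hnorm_sqr V (x : V) : hnorm x ^+ 2 = reip x x.
Proof. by rewrite sqr_sqrtr // reip_ge0. Qed.

Lemma hnorm_ge0 V (x : V) : 0 <= hnorm x.
Proof. exact: sqrtr_ge0. Qed.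

Lemma reip_le V (x y : V) : `|reip x y| <= hnorm x ^+ 2 + hnorm y ^+ 2.
Proof.
rewrite !hnorm_sqr.
have := reip_ge0 (x + y); have := reip_ge0 (x - y).
rewrite !(reipDl, reipDr, reipNl, reipNr) (reipC y x) => h1 h2.
by have := reip_ge0 x; have := reip_ge0 y; rewrite ler_norml; lra.
Qed.

Lemma reip_CS V (x y : V) : reip x y ^+ 2 <= reip x x * reip y y.
Proof.
have H (a b : R) : 0 <= a ^+ 2 * reip x x + 2 * a * b * reip x y + b ^+ 2 * reip y y.
  have := reip_ge0 ((a +i* 0) *: x + (b +i* 0) *: y).
  rewrite !(reipDl, reipDr, reipZl) (reipC _ (_ *: y)) (reipC _ (_ *: x)).
  rewrite !(reipDl, reipDr, reipZl) !(reipC _ (_ *: y)) !(reipC _ (_ *: x)).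
  rewrite !reipZl (reipC y x) => h; apply: le_trans h _.
  by rewrite le_eqVlt; apply/orP; left; apply/eqP; ring.
have := H (reip y y) (- reip x y); have y0 := reip_ge0 y.
have := y0; rewrite le_eqVlt => /orP[/eqP y00 _|ygt0 h].
  rewrite -y00 mulr0; have [->|xy0] := eqVneq (reip x y) 0.
    by rewrite expr0n.
  have := H 1 (- (reip x x + 1) / (2 * reip x y)); rewrite -y00 mulr0 addr0.
  rewrite expr1n mul1r mulr1 -mulrA.
  have -> : 2 * (- (reip x x + 1) / (2 * reip x y) * reip x y) = - (reip x x + 1).
    by field.
  by lra.
have : 0 <= reip y y * (reip x x * reip y y - reip x y ^+ 2).
  by apply: le_trans h _; rewrite le_eqVlt; apply/orP; left; apply/eqP; ring.
by rewrite pmulr_rge0 // subr_ge0.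
Qed.

Lemma hnormD V (x y : V) : hnorm (x + y) <= hnorm x + hnorm y.
Proof.
rewrite -(@ler_pXn2r _ 2) // ?nnegrE ?addr_ge0 ?hnorm_ge0 //.
rewrite hnorm_sqr !(reipDl, reipDr) (reipC y x) sqrrD !hnorm_sqr.
suff : reip x y <= hnorm x * hnorm y by lra.
apply: le_trans (ler_norm _) _.
rewrite -(@ler_pXn2r _ 2) // ?nnegrE ?mulr_ge0 ?hnorm_ge0 //.
by rewrite real_normK ?num_real // exprMn !hnorm_sqr reip_CS.
Qed.

Lemma hnormN V (x : V) : hnorm (- x) = hnorm x.
Proof. by rewrite /hnorm innerNl innerNr opprK. Qed.

Lemma hnorm_dist V (x y : V) : `|hnorm x - hnorm y| <= hnorm (x - y).
Proof.
rewrite ler_norml; apply/andP; split.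
  have := hnormD x (y - x); rewrite addrC subrK => h.
  by have := hnormN (x - y); rewrite opprB => e; move: h; rewrite e; lra.
by have := hnormD y (x - y); rewrite addrC subrK; lra.
Qed.

Lemma hnormZ V (a : R[i]) (x : V) : hnorm (a *: x) = Num.sqrt (complex.Re (a * a^*)) * hnorm x.
Proof.
rewrite /hnorm innerZl innerZr mulrA inner_reip.
case: a => a b /=; rewrite -sqrtrM; last by nra.
by congr Num.sqrt; ring.
Qed.

Lemma hcvgD V (u v : nat -> V) x y :
  hcvg u x -> hcvg v y -> hcvg (fun n => u n + v n) (x + y).
Proof.
move=> ux vy; rewrite /hcvg.
apply: (@squeeze_cvgr _ _ _ _ (fun=> 0) (fun n => hnorm (u n - x) + hnorm (v n - y))).
- apply: nearW => n; rewrite hnorm_ge0 /= (_ : _ - _ = (u n - x) + (v n - y)).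
    exact: hnormD.
  by rewrite opprD addrACA.
- exact: cvg_cst.
- by rewrite -[0](addr0 0); exact: cvgD.
Qed.

Lemma hcvgZ V (a : R[i]) (u : nat -> V) x :
  hcvg u x -> hcvg (fun n => a *: u n) (a *: x).
Proof.
move=> ux; rewrite /hcvg.
under eq_fun do rewrite -scalerBr hnormZ.
by rewrite -[0](mulr0 (Num.sqrt (complex.Re (a * a^*)))); apply: cvgMr.
Qed.

Lemma hcvg_norm V (u : nat -> V) x :
  hcvg u x -> hnorm (u n) @[n --> \oo] --> hnorm x.
Proof.
move=> ux; apply/cvgrPdist_le => e e0.
have /cvgrPdist_le/(_ e e0) := ux; apply: filterS => n.
by rewrite sub0r normrN ger0_norm ?hnorm_ge0 // distrC; exact/le_trans/hnorm_dist.
Qed.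

End InnerTheory.

(* The circle is parametrized by t |-> exp (2 i pi t), t in [0, 1], which carries
   Lebesgue measure on [0, 1] to normalized arc length. *)
Definition circle (R : realType) :
    {measure set (measurableTypeR R) -> \bar R} :=
  mrestr (@lebesgue_measure R) (measurable_itv `[0%R, 1%R]).

Instance circle_ae_filter (R : realType) :
  Filter (nbhs (almost_everywhere (circle R))).
Proof. exact: (@ae_filter_ringOfSetsType _ (measurableTypeR R) R (circle R)). Qed.

Definition zeta (R : realType) (t : R) : R[i] :=
  cos (2 * pi * t) +i* sin (2 * pi * t).

Section Measurability.
Context {R : realType}.
Local Notation T := (measurableTypeR R).

Definition simple (S : Type) (s : T -> S) : Prop :=
  finite_set (range s) /\ forall y, measurable (s @^-1` [set y]).

Lemma simple2 (S1 S2 S3 : Type) (phi : S1 -> S2 -> S3) (s1 : T -> S1) (s2 : T -> S2) :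
  simple s1 -> simple s2 -> simple (fun t => phi (s1 t) (s2 t)).
Proof.
move=> [f1 m1] [f2 m2]; split.
  apply: (@sub_finite_set _ _
    ((fun p : S1 * S2 => phi p.1 p.2) @` (range s1 `*` range s2))).
    by move=> _ [t _ <-]; exists (s1 t, s2 t) => //; split; exists t.
  exact/finite_image/finite_setX.
move=> y.
rewrite (_ : _ @^-1` _ = \bigcup_(p in [set p : S1 * S2 |
    (range s1 `*` range s2) p /\ phi p.1 p.2 = y])
    ((s1 @^-1` [set p.1]) `&` (s2 @^-1` [set p.2]))).
  apply: fin_bigcup_measurable.
    by apply: sub_finite_set (finite_setX f1 f2) => p [].
  by move=> p _; exact: measurableI.
apply/seteqP; split => t /=.
  by move=> e; exists (s1 t, s2 t) => //; split => //; split; exists t.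
by move=> [[a b]] /= [_ <-] [-> ->].
Qed.

Lemma simple1 (S1 S2 : Type) (phi : S1 -> S2) (s : T -> S1) :
  simple s -> simple (fun t => phi (s t)).
Proof. by move=> ss; exact: (simple2 (fun x _ => phi x) ss ss). Qed.

Lemma simple_cst (S : Type) (y : S) : simple (fun=> y).
Proof.
split; first by apply: sub_finite_set (finite_set1 y) => _ [t _ <-].
move=> z; have [->|nyz] := pselect (y = z).
  by rewrite (_ : _ @^-1` _ = setT) //; apply/seteqP; split.
by rewrite (_ : _ @^-1` _ = set0) //; apply/seteqP; split.
Qed.

Lemma simple_measurable (s : T -> R) : simple s -> measurable_fun setT s.
Proof.
move=> [fs ms] _ B mB; rewrite setTI.
rewrite (_ : _ @^-1` _ = \bigcup_(y in range s `&` B) (s @^-1` [set y])).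
  by apply: fin_bigcup_measurable => //; apply: sub_finite_set fs => y [].
apply/seteqP; split => t /=; first by move=> Bst; exists (s t).
by move=> [y [_ By] /= ->].
Qed.

Variable E : innerType R.

(* Bochner measurability. *)
Definition strongly_measurable (f : R -> E) : Prop :=
  exists2 s : nat -> R -> E, forall n, simple (s n : T -> E) &
                             forall t, hcvg (s^~ t) (f t).

Definition square_integrable (f : R -> E) : Prop :=
  strongly_measurable f /\
  (\int[circle R]_t ((hnorm (f t)) ^+ 2)%:E < +oo)%E.

Lemma sm_cst (x : E) : strongly_measurable (fun=> x).
Proof.
exists (fun _ _ => x) => [n|t]; first exact: simple_cst.
have h0 : hnorm (0 : E) = 0.
  by rewrite /hnorm inner0l sqrtr0.
by rewrite /hcvg subrr h0; exact: cvg_cst.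
Qed.

Lemma smD (f g : R -> E) : strongly_measurable f -> strongly_measurable g ->
  strongly_measurable (fun t => f t + g t).
Proof.
move=> [s ss sf] [s' ss' sg]; exists (fun n t => s n t + s' n t) => [n|t].
  exact: simple2.
exact: hcvgD.
Qed.

Lemma smZ a (f : R -> E) : strongly_measurable f ->
  strongly_measurable (fun t => a *: f t).
Proof.
move=> [s ss sf]; exists (fun n t => a *: s n t) => [n|t].
  exact: (simple1 (fun x => a *: x)).
exact: hcvgZ.
Qed.

Lemma sm_norm (f : R -> E) : strongly_measurable f ->
  measurable_fun setT ((fun t => hnorm (f t)) : T -> R).
Proof.
move=> [s ss sf].
apply: (@measurable_fun_cvg _ _ _ _ (fun n t => hnorm (s n t))) => [n|t _].
  by apply: simple_measurable; exact: simple1.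
exact: hcvg_norm.
Qed.

Lemma reip_polar (x y : E) :
  reip x y = 4^-1 * (hnorm (x + y) ^+ 2 - hnorm (x + (-1) *: y) ^+ 2).
Proof.
rewrite !hnorm_sqr scaleN1r !(reipDl, reipDr, reipNl, reipNr) (reipC y x).
by field.
Qed.

Lemma sm_reip (f g : R -> E) : strongly_measurable f -> strongly_measurable g ->
  measurable_fun setT ((fun t => reip (f t) (g t)) : T -> R).
Proof.
move=> mf mg; under eq_fun do rewrite reip_polar.
apply: measurable_funM => //; apply: measurable_funB.
  by apply: measurable_funX; apply: sm_norm; exact: smD.
by apply: measurable_funX; apply: sm_norm; apply: smD => //; exact: smZ.
Qed.

Lemma siP (f : R -> E) : square_integrable f <-> strongly_measurable f /\
  (circle R).-integrable setT (fun t => (hnorm (f t) ^+ 2)%:E).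
Proof.
have absE : (fun t => `|(hnorm (f t) ^+ 2)%:E|)%E = (fun t => (hnorm (f t) ^+ 2)%:E).
  by apply/funext => t; rewrite gee0_abs // lee_fin sqr_ge0.
split=> [[mf h]|[mf /integrableP[_]]]; last by rewrite absE.
split => //; apply/integrableP; rewrite absE; split => //.
by apply/measurable_EFinP; apply: measurable_funX; exact: sm_norm.
Qed.

Lemma si_reip (f g : R -> E) : square_integrable f -> square_integrable g ->
  (circle R).-integrable setT (fun t => (reip (f t) (g t))%:E).
Proof.
move=> /siP[mf iff] /siP[mg ig].
apply: (@le_integrable _ _ _ (circle R) setT measurableT _
  (fun t => (hnorm (f t) ^+ 2)%:E + (hnorm (g t) ^+ 2)%:E)%E).
- by apply/measurable_EFinP; exact: sm_reip.
- move=> t _; rewrite /= lee_fin [leRHS]ger0_norm ?addr_ge0 ?sqr_ge0 //.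
  exact: reip_le.
- exact: integrableD.
Qed.

Lemma siZ a (f : R -> E) : square_integrable f ->
  square_integrable (fun t => a *: f t).
Proof.
move=> /siP[mf iff]; apply/siP; split; first exact: smZ.
under eq_fun do rewrite hnormZ exprMn EFinM.
exact: integrableZl.
Qed.

Lemma siD (f g : R -> E) : square_integrable f -> square_integrable g ->
  square_integrable (fun t => f t + g t).
Proof.
move=> sf sg; have [mf iff] := (siP _).1 sf; have [mg ig] := (siP _).1 sg.
apply/siP; split; first exact: smD.
have -> : (fun t => (hnorm (f t + g t) ^+ 2)%:E) =
    (fun t => ((hnorm (f t) ^+ 2)%:E + (hnorm (g t) ^+ 2)%:E) +
              (2%:E * (reip (f t) (g t))%:E))%E.
  apply/funext => t; rewrite -!EFinM -!EFinD; congr EFin.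
  by rewrite !hnorm_sqr !(reipDl, reipDr) (reipC (g t)); ring.
apply: integrableD => //; first exact: integrableD.
by apply: integrableZl => //; exact: si_reip.
Qed.

Lemma si0 : square_integrable (fun=> 0 : E).
Proof.
split; first exact: sm_cst.
under eq_integral do rewrite hnorm_sqr /reip inner0l /=.
by rewrite integral0.
Qed.

End Measurability.

Lemma aeS4 (d : measure_display) (T : measurableType d) (R : realType)
    (mu : {measure set T -> \bar R}) (P1 P2 P3 P4 Q : T -> Prop) :
  (forall t, P1 t -> P2 t -> P3 t -> P4 t -> Q t) ->
  (\forall t \ae mu, P1 t) -> (\forall t \ae mu, P2 t) ->
  (\forall t \ae mu, P3 t) -> (\forall t \ae mu, P4 t) -> \forall t \ae mu, Q t.
Proof.
move=> h h1 h2 h3 h4.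
by apply: filterS2 (filterI h1 h2) (filterI h3 h4) => t [? ?] [? ?]; exact: h.
Qed.

Section L2type.
Context {R : realType}.
Variable E : innerType R.

Record l2fun := L2fun {
  l2val :> R -> E;
  l2valP : square_integrable l2val }.

HB.instance Definition _ := gen_eqMixin l2fun.
HB.instance Definition _ := gen_choiceMixin l2fun.

Definition l2_eq (f g : l2fun) : bool := `[< \forall t \ae circle R, f t = g t >].

Let l2_eq_refl : reflexive l2_eq.
Proof. by move=> f; apply/asboolP; exact: aeW. Qed.

Let l2_eq_sym : symmetric l2_eq.
Proof. by move=> f g; apply/idP/idP => /asboolP h; apply/asboolP; apply: filterS h => t ->. Qed.

Let l2_eq_trans : transitive l2_eq.
Proof.
move=> f g h /asboolP gf /asboolP fh; apply/asboolP.
by apply: filterS2 gf fh => t -> ->.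
Qed.

Canonical l2_eq_canonical := EquivRel l2_eq l2_eq_refl l2_eq_sym l2_eq_trans.

Definition L2 : Type := {eq_quot l2_eq}%qT.
HB.instance Definition _ := Choice.on L2.
HB.instance Definition _ := EqQuotient.on L2.

Definition L2_fun (f : L2) : R -> E := repr f.
Coercion L2_fun : L2 >-> Funclass.

Lemma L2_si (f : L2) : square_integrable f.
Proof. exact: l2valP. Qed.

Lemma L2P (f g : L2) : (\forall t \ae circle R, f t = g t) -> f = g.
Proof.
move=> fg; rewrite -[f]reprK -[g]reprK; apply/eqmodP/asboolP.
exact: fg.
Qed.

(* The class of a function; a junk value if g is not almost everywhere equal to
   a square integrable function. *)
Definition L2of (g : R -> E) : L2 :=
  xget (\pi_L2 (L2fun (si0 E)))%qT
       [set f : L2 | \forall t \ae circle R, f t = g t].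

Lemma L2ofE (g : R -> E) : square_integrable g ->
  \forall t \ae circle R, L2of g t = g t.
Proof.
move=> sg; rewrite /L2of; case: xgetP => [f _ //|/(_ (\pi_L2 (L2fun sg))%qT)[]].
have /eqmodP/asboolP := reprK (\pi_L2 (L2fun sg))%qT.
by apply: filterS => t.
Qed.

Definition L2_zero : L2 := L2of (fun=> 0).
Definition L2_opp (f : L2) : L2 := L2of (fun t => - f t).
Definition L2_add (f g : L2) : L2 := L2of (fun t => f t + g t).
Definition L2_scale (a : R[i]) (f : L2) : L2 := L2of (fun t => a *: f t).

Lemma L2_zeroE : \forall t \ae circle R, L2_zero t = 0.
Proof. exact: L2ofE (si0 E). Qed.

Lemma L2_oppE (f : L2) : \forall t \ae circle R, L2_opp f t = - f t.
Proof.
by apply: L2ofE; under eq_fun do rewrite -scaleN1r; exact: siZ (L2_si f).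
Qed.

Lemma L2_addE (f g : L2) : \forall t \ae circle R, L2_add f g t = f t + g t.
Proof. by apply: L2ofE; exact: siD (L2_si f) (L2_si g). Qed.

Lemma L2_scaleE a (f : L2) : \forall t \ae circle R, L2_scale a f t = a *: f t.
Proof. by apply: L2ofE; exact: siZ (L2_si f). Qed.

Let addA : associative L2_add.
Proof.
move=> f g h; apply: L2P.
have := L2_addE f (L2_add g h); have := L2_addE g h.
have := L2_addE (L2_add f g) h; have := L2_addE f g.
by apply: aeS4 => t -> -> -> ->; rewrite addrA.
Qed.

Let addC : commutative L2_add.
Proof.
move=> f g; apply: L2P; have := L2_addE f g; have := L2_addE g f.
by apply: filterS2 => t -> ->; rewrite addrC.
Qed.

Let add0 : left_id L2_zero L2_add.
Proof.
move=> f; apply: L2P; have := L2_addE L2_zero f; have := L2_zeroE.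
by apply: filterS2 => t + -> => ->; rewrite add0r.
Qed.

Let addN : left_inverse L2_zero L2_opp L2_add.
Proof.
move=> f; apply: L2P; have := L2_addE (L2_opp f) f; have := L2_oppE f.
have := L2_zeroE.
by apply: filterS3 => t -> + -> => ->; rewrite addNr.
Qed.

HB.instance Definition _ := GRing.isZmodule.Build L2 addA addC add0 addN.

Lemma L2DE (f g : L2) : \forall t \ae circle R, (f + g : L2) t = f t + g t.
Proof. exact: L2_addE. Qed.

Let scaleA a b (f : L2) : L2_scale a (L2_scale b f) = L2_scale (a * b) f.
Proof.
apply: L2P; have := L2_scaleE a (L2_scale b f); have := L2_scaleE b f.
have := L2_scaleE (a * b) f.
by apply: filterS3 => t -> + -> => ->; rewrite scalerA.
Qed.

Let scale1 : left_id 1 L2_scale.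
Proof.
move=> f; apply: L2P; have := L2_scaleE 1 f.
by apply: filterS => t ->; rewrite scale1r.
Qed.

Let scaleDr : right_distributive L2_scale +%R.
Proof.
move=> a f g; apply: L2P.
have h1 := L2_scaleE a (f + g); have h2 := L2DE f g.
have h3 := L2DE (L2_scale a f) (L2_scale a g).
have h4 := L2_scaleE a f; have h5 := L2_scaleE a g.
apply: filterS3 (filterI h1 h2) h3 (filterI h4 h5) => t [e1 e2] e3 [e4 e5].
by rewrite e1 e2 e3 e4 e5 scalerDr.
Qed.

Let scaleDl (f : L2) : {morph L2_scale^~ f : a b / a + b}.
Proof.
move=> a b; apply: L2P.
have := L2_scaleE (a + b) f; have := L2DE (L2_scale a f) (L2_scale b f).
have := L2_scaleE a f; have := L2_scaleE b f.
by apply: aeS4 => t + + -> -> => -> ->; rewrite scalerDl.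
Qed.

HB.instance Definition _ :=
  GRing.Zmodule_isLmodule.Build R[i] L2 scaleA scale1 scaleDr scaleDl.

Lemma L2ZE a (f : L2) : \forall t \ae circle R, (a *: f : L2) t = a *: f t.
Proof. exact: L2_scaleE. Qed.

End L2type.

Definition circle_integral (R : realType) (F : R -> R[i]) : R[i] :=
  (\int[circle R]_t complex.Re (F t))%R +i* (\int[circle R]_t complex.Im (F t))%R.

Section L2inner.
Context {R : realType}.
Variable E : innerType R.
Local Notation mu := (circle R).

Definition L2_inner (f g : L2 E) : R[i] :=
  circle_integral (fun t => inner (f t) (g t)).

Lemma L2_reip_integrable (f g : L2 E) :
  mu.-integrable setT (EFin \o (fun t => reip (f t) (g t))).
Proof. exact: si_reip (L2_si f) (L2_si g). Qed.

Lemma L2_imip_integrable (f g : L2 E) :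
  mu.-integrable setT (EFin \o (fun t => complex.Im (inner (f t) (g t)))).
Proof.
rewrite (_ : _ \o _ = fun t => (reip (f t) ('i *: g t))%:E).
  exact: si_reip (L2_si f) (siZ _ (L2_si g)).
by apply/funext => t /=; rewrite Im_inner.
Qed.

Lemma Rintegral_ae (F G : R -> R) :
  mu.-integrable setT (EFin \o F) -> mu.-integrable setT (EFin \o G) ->
  (\forall t \ae mu, F t = G t) ->
  (\int[mu]_t F t = \int[mu]_t G t)%R.
Proof.
move=> /integrableP[mF _] /integrableP[mG _] FG.
rewrite /Rintegral; congr fine; apply: ae_eq_integral => //.
by apply: filterS FG => t /= -> _.
Qed.

Let L2_inner_linear a (f g h : L2 E) :
  L2_inner (a *: f + g) h = a * L2_inner f h + L2_inner g h.
Proof.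
have h1 := L2DE (a *: f) g; have h2 := L2ZE a f.
have re := L2_reip_integrable; have im := L2_imip_integrable.
case: a h1 h2 => a b h1 h2.
have iL (F G H : R -> R) (c d : R) : mu.-integrable setT (EFin \o F) ->
    mu.-integrable setT (EFin \o G) -> mu.-integrable setT (EFin \o H) ->
    mu.-integrable setT (EFin \o (fun t => c * F t + d * G t + H t)) /\
    (\int[mu]_t (c * F t + d * G t + H t) =
     c * \int[mu]_t F t + d * \int[mu]_t G t + \int[mu]_t H t)%R.
  move=> iF iG iH.
  have icF : mu.-integrable setT (EFin \o (fun t => c * F t)).
    rewrite (_ : _ \o _ = fun t => (c%:E * (F t)%:E)%E) //.
    exact: integrableZl.
  have idG : mu.-integrable setT (EFin \o (fun t => d * G t)).
    rewrite (_ : _ \o _ = fun t => (d%:E * (G t)%:E)%E) //.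
    exact: integrableZl.
  have iFG : mu.-integrable setT (EFin \o (fun t => c * F t + d * G t)).
    rewrite (_ : _ \o _ = fun t => ((EFin \o (fun t => (c * F t)%R)) t +
       (EFin \o (fun t => (d * G t)%R)) t)%E) //.
    exact: integrableD.
  split; last by rewrite RintegralD // RintegralD // !RintegralZl.
  rewrite (_ : _ \o _ = fun t => ((EFin \o (fun t => (c * F t + d * G t)%R)) t +
     (EFin \o H) t)%E) //.
  exact: integrableD.
have [iR eR] := iL _ _ _ a (- b) (re f h) (im f h) (re g h).
have [iI eI] := iL _ _ _ a b (im f h) (re f h) (im g h).
rewrite /L2_inner /circle_integral.
have -> : (\int[mu]_t complex.Re (inner (((a +i* b) *: f + g : L2 E) t) (h t)) =
    \int[mu]_t (a * reip (f t) (h t) + - b * complex.Im (inner (f t) (h t)) +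
      reip (g t) (h t)))%R.
  apply: Rintegral_ae => //; first exact: (re ((a +i* b) *: f + g) h).
  apply: filterS2 h1 h2 => t -> ->; rewrite -/(reip _ _) reipDl reipZl.
  by rewrite mulNr.
have -> : (\int[mu]_t complex.Im (inner (((a +i* b) *: f + g : L2 E) t) (h t)) =
    \int[mu]_t (a * complex.Im (inner (f t) (h t)) + b * reip (f t) (h t) +
      complex.Im (inner (g t) (h t))))%R.
  apply: Rintegral_ae => //.
  apply: filterS2 h1 h2 => t -> ->; rewrite innerDl innerZl /reip.
  by case: (inner (f t) (h t)) (inner (g t) (h t)) => [? ?] [? ?] /=.
rewrite eR eI /reip /=.
by congr (_ +i* _); ring.
Qed.

Let L2_inner_herm (f g : L2 E) : L2_inner f g = (L2_inner g f)^*.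
Proof.
rewrite /L2_inner /circle_integral /=; congr (_ +i* _).
  by apply: eq_Rintegral => t _; rewrite innerC; case: (inner _ _).
rewrite -mulN1r -RintegralZl //; last exact: L2_imip_integrable.
by apply: eq_Rintegral => t _; rewrite innerC mulN1r; case: (inner _ _).
Qed.

Let L2_inner_pos (f : L2 E) : f != 0 -> 0 < L2_inner f f.
Proof.
move=> f0.
have e : L2_inner f f = (\int[mu]_t (hnorm (f t) ^+ 2))%R%:C.
  rewrite /L2_inner /circle_integral; congr (_ +i* _).
    by apply: eq_Rintegral => t _; rewrite hnorm_sqr.
  under eq_Rintegral do rewrite inner_reip /=.
  by rewrite /Rintegral integral0.
rewrite e ltcR lt_neqAle Rintegral_ge0 ?andbT; last by move=> *; exact: sqr_ge0.
apply: contra_neqN f0 => /eqP i0; apply: L2P.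
have [mf iff] := (siP _).1 (L2_si f).
have : (\int[mu]_t `|(hnorm (f t) ^+ 2)%:E| = 0)%E.
  under eq_integral do rewrite gee0_abs ?lee_fin ?sqr_ge0 //.
  rewrite -[LHS]fineK; first by rewrite [X in X%:E](esym i0).
  exact: integrable_fin_num.
move=> /(ae_eq_integral_abs _ measurableT _).1 h.
have {}h : \forall t \ae mu, [set: R] t -> (hnorm (f t) ^+ 2)%:E = cst 0%E t.
  by apply: h; apply/measurable_EFinP; apply: measurable_funX; exact: sm_norm.
apply: filterS2 h (L2_zeroE E) => t /(_ I) /= [h2] z.
rewrite [RHS]z; apply: inner_eq0; rewrite inner_reip -hnorm_sqr h2.
by [].
Qed.

HB.instance Definition _ := Lmodule_isInner.Build R (L2 E)
  (make_dot L2_inner_linear L2_inner_herm L2_inner_pos).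

Lemma L2_innerE (f g : L2 E) :
  inner f g = circle_integral (fun t => inner (f t) (g t)).
Proof. by []. Qed.

End L2inner.

Section ProdInner.
Context {R : realType}.
Variables V W : innerType R.

Definition prod_inner (p q : V * W) : R[i] := inner p.1 q.1 + inner p.2 q.2.

Let prod_inner_linear a p q r :
  prod_inner (a *: p + q) r = a * prod_inner p r + prod_inner q r.
Proof. by rewrite /prod_inner /= !innerDl !innerZl mulrDr addrACA. Qed.

Let prod_inner_herm p q : prod_inner p q = (prod_inner q p)^*.
Proof. by rewrite /prod_inner innerC [X in _ + X]innerC -rmorphD. Qed.

Let prod_inner_pos p : p != 0 -> 0 < prod_inner p p.
Proof.
move=> p0; rewrite lt_neqAle addr_ge0 ?inner_ge0 // andbT eq_sym.
rewrite paddr_eq0 ?inner_ge0 //; apply: contra p0.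
by case: p => x y /= /andP[/eqP/inner_eq0-> /eqP/inner_eq0->].
Qed.

HB.instance Definition _ := Lmodule_isInner.Build R (V * W)%type
  (make_dot prod_inner_linear prod_inner_herm prod_inner_pos).

Lemma prod_innerE (p q : V * W) : inner p q = inner p.1 q.1 + inner p.2 q.2.
Proof. by []. Qed.

End ProdInner.

(* Subspaces are sets; an operator between subspaces M and N of V and W is a
   function V -> W of which only the restriction to M matters. *)
Section Operators.
Context {R : realType}.
Implicit Types V W : innerType R.

Definition hclosure V (A : set V) : set V :=
  [set x | exists2 u : nat -> V, forall n, A (u n) & hcvg u x].

Definition lspan V (A : set V) : set V :=
  [set x | exists n (a : 'I_n -> R[i]) (v : 'I_n -> V),
     (forall i, A (v i)) /\ x = \sum_i a i *: v i].

Definition cspan V (A : set V) : set V := hclosure (lspan A).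

Definition orth V (A : set V) : set V :=
  [set x | forall y, A y -> inner x y = 0].

Definition closed_subspace V (M : set V) : Prop :=
  [/\ M 0, forall a x y, M x -> M y -> M (a *: x + y) & hclosure M `<=` M].

Definition linear_on V W (M : set V) (A : V -> W) : Prop :=
  forall a x y, M x -> M y -> A (a *: x + y) = a *: A x + A y.

Definition contraction V W (A : V -> W) : Prop :=
  forall x, hnorm (A x) <= hnorm x.

Definition contraction_on V W (M : set V) (N : set W) (A : V -> W) : Prop :=
  [/\ linear_on M A, forall x, M x -> N (A x) &
      forall x, M x -> hnorm (A x) <= hnorm x].

Definition isometry_on V W (M : set V) (A : V -> W) : Prop :=
  linear_on M A /\ forall x, M x -> hnorm (A x) = hnorm x.

Definition unitary_on V W (M : set V) (N : set W) (A : V -> W) : Prop :=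
  isometry_on M A /\ A @` M = N.

(* The next four operators are given by a description, with junk value 0 when no
   vector (or no operator) satisfies it. *)
Definition hproj V (M : set V) (x : V) : V :=
  xget 0 [set y | M y /\ orth M (x - y)].

(* The adjoint W -> M of the operator A : M -> W. *)
Definition hadj V W (M : set V) (A : V -> W) (y : W) : V :=
  xget 0 [set x | M x /\ forall z, M z -> inner (A z) y = inner z x].

Definition hinv V W (A : V -> W) (y : W) : V := xget 0 [set x | A x = y].

(* In a complex space 0 <= inner (S x) x includes self-adjointness. *)
Definition positive_on V (M : set V) (S : V -> V) : Prop :=
  [/\ linear_on M S, forall x, M x -> M (S x) &
      forall x, M x -> 0 <= inner (S x) x].

Definition hsqrt V (M : set V) (A : V -> V) (x : V) : V :=
  xget 0 [set y | exists S : V -> V,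
    [/\ positive_on M S, forall z, M z -> S (S z) = A z & y = S x]].

(* Only meaningful for unitary U, where the adjoint is the inverse. *)
Definition zpower V (U : V -> V) (n : int) (x : V) : V :=
  match n with
  | Posz m => iter m U x
  | Negz m => iter m.+1 (hadj setT U) x
  end.

Definition orthonormal_basis V (M B : set V) : Prop :=
  [/\ B `<=` M, forall x, B x -> inner x x = 1,
      forall x y, B x -> B y -> x <> y -> inner x y = 0 &
      M `<=` cspan B].

Definition same_dimension V W (M : set V) (N : set W) : Prop :=
  exists A B, [/\ orthonormal_basis M A, orthonormal_basis N B & (A #= B)%card].

Definition infinite_dimensional V : Prop :=
  forall B : set V, orthonormal_basis setT B -> infinite_set B.

Definition defect V (A : V -> V) : V -> V :=
  hsqrt setT (fun x => x - hadj setT A (A x)).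

Definition defect_space V (A : V -> V) : set V := hclosure (range (defect A)).

Definition cnu V (A : V -> V) : Prop :=
  forall M : set V, closed_subspace M ->
    (forall x, M x -> M (A x)) -> (forall x, M x -> M (hadj setT A x)) ->
    unitary_on M M A -> M `<=` [set 0].

(* Sz.-Nagy--Foias characteristic function, for |z| < 1. *)
Definition char_fun V (A : V -> V) (z : R[i]) (x : V) : V :=
  - A x + z *: defect (hadj setT A)
                 (hinv (fun y => y - z *: hadj setT A y) (defect A x)).

(* Radial boundary values, in the strong-* operator topology, of an operator
   function on the disk. The exceptional null set is allowed to depend on the
   vector, which makes no difference on separable spaces and is unavoidable on
   non-separable ones; almost everywhere existence of the limits (Fatou) makes the
   boundary function unique up to a null set for each vector. *)
Definition boundary_function V W (M : set V) (N : set W)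
    (F : R[i] -> V -> W) (Fb : R -> V -> W) : Prop :=
  [/\ \forall t \ae circle R, contraction_on M N (Fb t),
      forall x, M x -> \forall t \ae circle R,
        hnorm (F (r%:C * zeta t) x - Fb t x) @[r --> (1 : R)^'-] --> (0 : R) &
      forall y, N y -> \forall t \ae circle R,
        hnorm (hadj M (F (r%:C * zeta t)) y - hadj M (Fb t) y)
          @[r --> (1 : R)^'-] --> (0 : R)].

End Operators.

Section FunctionSpaces.
Context {R : realType} {H : innerType R}.

Definition L2_in (M : set H) : set (L2 H) :=
  [set f | \forall t \ae circle R, M (f t)].

(* Functions whose Fourier coefficients of negative index vanish. *)
Definition H2_in (M : set H) : set (L2 H) :=
  [set f | L2_in M f /\ forall (n : nat) (x : H), (0 < n)%N ->
     circle_integral (fun t => zeta t ^+ n * inner (f t) x) = 0].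

Definition mult (Phi : R -> H -> H) (f : L2 H) : L2 H :=
  L2of (fun t => Phi t (f t)).

Definition direct_sum (A B : L2 H -> L2 H) (p : L2 H * L2 H) : L2 H * L2 H :=
  (A p.1, B p.2).

End FunctionSpaces.

Section Ando.
Context {R : realType} {H : hilbertType R}.
Variables T1 T2 : H -> H.

Local Notation T := (T1 \o T2).
Local Notation T1s := (hadj setT T1).
Local Notation T2s := (hadj setT T2).
Local Notation Ts := (hadj setT T).

(* Inclusions of Hilbert spaces, here and below, are isometric embeddings. *)
Record ando_dilation := AndoDilation {
  ad_K : hilbertType R;
  ad_emb : {linear H -> ad_K};
  ad_V1 : {linear ad_K -> ad_K};
  ad_V2 : {linear ad_K -> ad_K};
  ad_emb_isometry : isometry_on setT ad_emb;
  ad_V1_isometry : isometry_on setT ad_V1;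
  ad_V2_isometry : isometry_on setT ad_V2;
  ad_commute : forall x, ad_V1 (ad_V2 x) = ad_V2 (ad_V1 x);
  ad_V1_extends : forall h, hadj setT ad_V1 (ad_emb h) = ad_emb (T1s h);
  ad_V2_extends : forall h, hadj setT ad_V2 (ad_emb h) = ad_emb (T2s h) }.

Variable D : ando_dilation.
Local Notation K := (ad_K D).
Local Notation V1 := (@ad_V1 D).
Local Notation V2 := (@ad_V2 D).

Definition ad_delta (h : H) : K := ad_emb D h - V1 (V2 (ad_emb D (Ts h))).
Definition ad_delta1 (h : H) : K := ad_emb D h - V1 (ad_emb D (T1s h)).
Definition ad_delta2 (h : H) : K := ad_emb D h - V2 (ad_emb D (T2s h)).

Definition ad_L : set K := hclosure (range ad_delta).
Definition ad_L1 : set K := hclosure (range ad_delta1).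
Definition ad_L2 : set K := hclosure (range ad_delta2).
Definition ad_L12 : set (K * K) := [set p | ad_L1 p.1 /\ ad_L2 p.2].

Definition ad_range : set (K * K) :=
  hclosure (range (fun h => (ad_delta1 h, ad_delta2 (T1s h)))).

(* L_1 (+) L_2 or L_1 (+) L_2 (+) l^2, both realized inside K * K * l^2: the last
   component vanishes when the orthogonal complements of the domain dom and of the
   range of U0 in L_1 (+) L_2 have equal dimension. *)
Definition ad_F (dom : set (K * K)) (ell2 : hilbertType R) :
    set (K * K * ell2) :=
  [set p | ad_L12 p.1 /\
    (same_dimension (ad_L12 `&` orth dom) (ad_L12 `&` orth ad_range) ->
     p.2 = 0)].

Record ando_tuple := AndoTuple {
  at_iota : K -> H;
  at_Lambda : K -> K * K;
  at_U0 : K * K -> K * K;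
  at_ell2 : hilbertType R;
  at_U : K * K * at_ell2 -> K * K * at_ell2;
  at_dom := hclosure (at_Lambda @` ad_L);
  at_iota_unitary : unitary_on ad_L (defect_space Ts) at_iota;
  at_iotaE : forall h, at_iota (ad_delta h) = defect Ts h;
  at_Lambda_isometry : isometry_on ad_L at_Lambda;
  at_LambdaE :
    forall h, at_Lambda (ad_delta h) = (ad_delta1 (T2s h), ad_delta2 h);
  at_U0_unitary : unitary_on at_dom ad_range at_U0;
  at_U0E : forall h, at_U0 (ad_delta1 (T2s h), ad_delta2 h) =
                     (ad_delta1 h, ad_delta2 (T1s h));
  at_ell2_infinite : infinite_dimensional at_ell2;
  at_U_unitary : unitary_on (@ad_F at_dom at_ell2) (@ad_F at_dom at_ell2) at_U;
  at_U_extends : forall p, at_dom p -> at_U (p, 0) = (at_U0 p, 0) }.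

Variable A : ando_tuple.
Local Notation F := (@ad_F (@at_dom A) (at_ell2 A)).
Local Notation U := (@at_U A).
Local Notation iota := (@at_iota A).
Local Notation iotas := (hadj ad_L (@at_iota A)).

Definition at_LambdaF (x : K) : K * K * at_ell2 A := (at_Lambda A x, 0).
Local Notation Lambda := at_LambdaF.
Local Notation Lambdas := (hadj ad_L at_LambdaF).

Definition at_P (p : K * K * at_ell2 A) : K * K * at_ell2 A := (p.1.1, 0, 0).
Definition at_Pperp (p : K * K * at_ell2 A) : K * K * at_ell2 A := p - at_P p.

Definition G_sharp1 (x : H) : H :=
  iota (Lambdas (at_Pperp (U (Lambda (iotas x))))).
Definition G_sharp2 (x : H) : H :=
  iota (Lambdas (hadj F U (at_P (Lambda (iotas x))))).

End Ando.

Section Residual.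
Context {R : realType} {H : hilbertType R}.
Variables (T1 T2 : H -> H) (Theta : R -> H -> H).

Local Notation T := (T1 \o T2).
Local Notation T1s := (hadj setT T1).
Local Notation T2s := (hadj setT T2).
Local Notation Ts := (hadj setT T).

(* Theta t stands for the boundary value of the characteristic function of T at
   the point zeta t. *)
Definition Delta (t : R) : H -> H :=
  hsqrt (defect_space T)
        (fun x => x - hadj (defect_space T) (Theta t) (Theta t x)).

Definition DeltaL2 : set (L2 H) :=
  hclosure (mult Delta @` L2_in (defect_space T)).

(* A final s denotes an adjoint: cu_W1s is the operator W_{d1}^*, and so on. *)
Record canonical_unitaries := CanonicalUnitaries {
  cu_Q : {linear H -> H};
  cu_RD : hilbertType R;
  cu_emb : H -> cu_RD;
  cu_X1s : H -> H;
  cu_X2s : H -> H;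
  cu_WDs : {linear cu_RD -> cu_RD};
  cu_W1s : {linear cu_RD -> cu_RD};
  cu_W2s : {linear cu_RD -> cu_RD};
  cu_ranQ := hclosure (range cu_Q);
  cu_Q_pos : positive_on setT cu_Q;
  cu_Q_lim : forall h, hcvg (fun n => iter n T (iter n Ts h)) (cu_Q (cu_Q h));
  cu_X1s_isometry : isometry_on cu_ranQ cu_X1s;
  cu_X2s_isometry : isometry_on cu_ranQ cu_X2s;
  cu_X1sE : forall h, cu_X1s (cu_Q h) = cu_Q (T1s h);
  cu_X2sE : forall h, cu_X2s (cu_Q h) = cu_Q (T2s h);
  cu_emb_isometry : isometry_on cu_ranQ cu_emb;
  cu_WDs_unitary : unitary_on setT setT cu_WDs;
  cu_WDs_extends : forall x, cu_ranQ x ->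
    cu_WDs (cu_emb x) = cu_emb (cu_X1s (cu_X2s x));
  cu_WDs_minimal :
    cspan [set y | exists n x, cu_ranQ x /\
                     y = iter n (hadj setT cu_WDs) (cu_emb x)] = setT;
  cu_W1s_unitary : unitary_on setT setT cu_W1s;
  cu_W2s_unitary : unitary_on setT setT cu_W2s;
  cu_W1s_extends : forall x, cu_ranQ x -> cu_W1s (cu_emb x) = cu_emb (cu_X1s x);
  cu_W2s_extends : forall x, cu_ranQ x -> cu_W2s (cu_emb x) = cu_emb (cu_X2s x);
  cu_commute : forall y, cu_W1s (cu_W2s y) = cu_W2s (cu_W1s y);
  cu_product : forall y, cu_W1s (cu_W2s y) = cu_WDs y }.

Record minimal_unitary_dilation := MinimalUnitaryDilation {
  ud_K : hilbertType R;
  ud_emb : {linear H -> ud_K};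
  ud_U : {linear ud_K -> ud_K};
  ud_emb_isometry : isometry_on setT ud_emb;
  ud_U_unitary : unitary_on setT setT ud_U;
  ud_dilation : forall n h,
    hproj (range ud_emb) (iter n ud_U (ud_emb h)) = ud_emb (iter n T h);
  ud_minimal :
    cspan [set y | exists n h, y = zpower ud_U n (ud_emb h)] = setT }.

Section Identification.
Variables (C : canonical_unitaries) (D : minimal_unitary_dilation).
Local Notation K := (ud_K D).
Local Notation U := (@ud_U D).

Definition ud_L : set K :=
  hclosure (range (fun h => U (ud_emb D h) - ud_emb D (T h))).
Definition ud_Ls : set K :=
  hclosure (range (fun h => ud_emb D h - U (ud_emb D (Ts h)))).

(* The orthogonal sum of the spaces U^n L: for wandering L, the closed span. *)
Definition ud_M (L : set K) : set K :=
  cspan [set y | exists n x, L x /\ y = zpower U n x].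

Definition ud_R : set K := orth (ud_M ud_Ls).

Record identification := Identification {
  id_iota : K -> L2 H;
  id_omegaD : K -> cu_RD C;
  id_omegaNF : K -> L2 H;
  id_iota_unitary : unitary_on (ud_M ud_L) (L2_in (defect_space T)) id_iota;
  id_iotaE : forall n h,
    id_iota (zpower U n (U (ud_emb D h) - ud_emb D (T h))) =
    L2of (fun t => zeta t ^ n *: defect T h);
  id_omegaD_unitary : unitary_on ud_R setT id_omegaD;
  id_omegaDE : forall n h,
    id_omegaD (iter n U (hproj ud_R (ud_emb D h))) =
    iter n (hadj setT (@cu_WDs C)) (@cu_emb C (@cu_Q C h));
  id_omegaNF_unitary : unitary_on ud_R DeltaL2 id_omegaNF;
  id_omegaNFE : forall l, ud_M ud_L l ->
    id_omegaNF (hproj ud_R l) = mult Delta (id_iota l) }.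

Variable I : identification.

Definition id_u (y : cu_RD C) : L2 H := id_omegaNF I (hadj ud_R (@id_omegaD I) y).

Definition W_sharp1 (f : L2 H) : L2 H :=
  id_u (hadj setT (@cu_W1s C) (hadj setT id_u f)).
Definition W_sharp2 (f : L2 H) : L2 H :=
  id_u (hadj setT (@cu_W2s C) (hadj setT id_u f)).

End Identification.
End Residual.

Section Model.
Context {R : realType} {H : hilbertType R}.
Variables T1 T2 : H -> H.

Local Notation T := (T1 \o T2).
Local Notation Ts := (hadj setT T).

Record characteristic_data := CharacteristicData {
  cd_dilation : ando_dilation T1 T2;
  cd_tuple : ando_tuple cd_dilation;
  cd_Theta : R -> H -> H;
  cd_ThetaE : boundary_function (defect_space T) (defect_space Ts)
                (char_fun T) cd_Theta;
  cd_canonical : canonical_unitaries T1 T2;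
  cd_udilation : minimal_unitary_dilation T1 T2;
  cd_identification : identification cd_Theta cd_canonical cd_udilation }.

Variable c : characteristic_data.

Definition G1 : H -> H := G_sharp1 (cd_tuple c).
Definition G2 : H -> H := G_sharp2 (cd_tuple c).
Definition W1 : L2 H -> L2 H := W_sharp1 (cd_identification c).
Definition W2 : L2 H -> L2 H := W_sharp2 (cd_identification c).

Local Notation DTs := (defect_space Ts).

Definition model_total : set (L2 H * L2 H) :=
  [set p | H2_in DTs p.1 /\ DeltaL2 T1 T2 (cd_Theta c) p.2].

Definition model_space : set (L2 H * L2 H) :=
  model_total `&`
  orth ((fun f => (mult (cd_Theta c) f, mult (Delta T1 T2 (cd_Theta c)) f))
          @` H2_in (defect_space T)).

Definition model_op1 : L2 H * L2 H -> L2 H * L2 H :=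
  direct_sum (mult (fun t x => hadj DTs G1 x + zeta t *: G2 x)) W1.

Definition model_op2 : L2 H * L2 H -> L2 H * L2 H :=
  direct_sum (mult (fun t x => hadj DTs G2 x + zeta t *: G1 x)) W2.

Definition model_op : L2 H * L2 H -> L2 H * L2 H :=
  direct_sum (mult (fun t x => zeta t *: x)) (mult (fun t x => zeta t *: x)).

Definition coinvariant (M : set (L2 H * L2 H))
    (A : L2 H * L2 H -> L2 H * L2 H) : Prop :=
  forall p, M p -> M (hadj model_total A p).

Definition compression (M : set (L2 H * L2 H))
    (A : L2 H * L2 H -> L2 H * L2 H) (p : L2 H * L2 H) : L2 H * L2 H :=
  hproj M (A p).

End Model.

(* Main.v *)
(* Let Ts be the adjoint of T = T1 T2 and Ds the defect operator of Ts. The unitary is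
   Pi h = (\sum_n zeta^n Ds Ts^n h, omega_NF P_R h); the squared norms of its two
   components are |h|^2 - |Qh|^2 and |Qh|^2. Each model operator A_k satisfies
   <A_k z, Pi h> = <z, Pi (T_k^* h)>: in the Hardy component because of
   <G_1 Ds x, Ds y> = <T_1^* x, y> - <Ts x, T_2^* y> and its mirror image, which the
   unitary of the Ando tuple encodes, and in the residual component because W_{d k}^*
   extends X_k^*. So it remains to identify the range of Pi with the model space. Let
   sigma be multiplication by zeta. Then sigma (Pi g) - Pi (T g) is the vector
   (Theta_T (D_T g), Delta_T (D_T g)), the first component being an Abel limit, so the
   range is orthogonal to the graph of (Theta_T, Delta_T). Conversely, a vector of the
   model space orthogonal to the range is orthogonal to all sigma^n (Pi h), hence to
   sigma^n (Ds h, 0) = sigma^n (Pi h) - sigma^(n+1) (Pi (Ts h)), which kills its first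
   component, and minimality of the unitary dilation kills the second one. *)

(* Projections, adjoints, square roots and classes of functions are descriptions with a default
   value, so each use requires existence and uniqueness of the object described. Square roots are
   limits of polynomials, which also gives [T D = Ds T] for the defect operators D of T and Ds of
   [Ts]. The obstacle is that H may be non-separable: the exceptional null sets of [Theta] depend on
   the vector, and for general f neither [Theta f] nor [Delta f] is known beforehand to be square
   integrable. So [Theta] is computed only on vectors D g, where [D^2 = 1 - Ts T] removes the inner
   root: [Theta(z) D g = z Ds (1 - z Ts)^-1 g - Ds (1 - z Ts)^-1 T g]. Everything else is reached by
   closure arguments in L2; they need completeness of L2 and density of the monomials in H2, which
   rests on the uniqueness of Fourier coefficients. For [Delta], linearity and boundedness are read
   off from the identity [omega_NF P_R = Delta iota] instead of being proved pointwise. *)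
From HB Require Import structures.
From mathcomp Require Import all_boot all_order all_algebra.
From mathcomp Require Import complex.
From mathcomp Require Import all_classical all_reals all_analysis.
From mathcomp Require Import measurable_realfun.
From mathcomp Require Import ring lra.
Require Import Defs.

Set Implicit Arguments.
Unset Strict Implicit.
Unset Printing Implicit Defensive.

Import Order.TTheory GRing.Theory Num.Theory.
Import numFieldTopology.Exports numFieldNormedType.Exports.

Local Open Scope classical_set_scope.
Local Open Scope ring_scope.
Local Open Scope complex_scope.

(** * Inner product and Hilbert spaces *)

Section InnerProductSpaces.
Context {R : realType}.
Implicit Types V W : innerType R.

Lemma complex_eta (z : R[i]) : z = complex.Re z +i* complex.Im z.
Proof. by case: z. Qed.

Lemma inner0r V (x : V) : inner x 0 = 0.
Proof. by rewrite innerC inner0l rmorph0. Qed.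

Lemma innerBl V (x y z : V) : inner (x - y) z = inner x z - inner y z.
Proof. by rewrite innerDl innerNl. Qed.

Lemma innerBr V (x y z : V) : inner x (y - z) = inner x y - inner x z.
Proof. by rewrite innerDr innerNr. Qed.

Lemma reipBl V (x y z : V) : reip (x - y) z = reip x z - reip y z.
Proof. by rewrite reipDl reipNl. Qed.

Lemma reipBr V (x y z : V) : reip x (y - z) = reip x y - reip x z.
Proof. by rewrite reipDr reipNr. Qed.

Lemma reip0l V (x : V) : reip 0 x = 0.
Proof. by rewrite /reip inner0l. Qed.

Lemma reipZCl V (a : R) (x y : V) : reip (a%:C *: x) y = a * reip x y.
Proof. by rewrite reipZl mul0r subr0. Qed.

Lemma reipZCr V (a : R) (x y : V) : reip x (a%:C *: y) = a * reip x y.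
Proof. by rewrite reipC reipZCl reipC. Qed.

Lemma inner_eta V (x y : V) : inner x y = reip x y +i* reip x ('i *: y).
Proof. by rewrite [LHS]complex_eta Im_inner. Qed.

(** The imaginary part of an inner product is a real part against ['i *: y], so complex identities
    reduce to real ones, for which polarization is available. *)
Lemma eq_inner V W (x y : V) (x' y' : W) :
  reip x y = reip x' y' -> reip x ('i *: y) = reip x' ('i *: y') ->
  inner x y = inner x' y'.
Proof. by rewrite !inner_eta => -> ->. Qed.

Lemma hnorm0 V : hnorm (0 : V) = 0.
Proof. by rewrite /hnorm inner0l sqrtr0. Qed.

Lemma hnorm_eq0 V (x : V) : hnorm x = 0 -> x = 0.
Proof.
by move=> x0; apply: inner_eq0; rewrite inner_reip -hnorm_sqr x0 expr0n.
Qed.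

Lemma hnormB V (x y : V) : hnorm (x - y) = hnorm (y - x).
Proof. by rewrite -hnormN opprB. Qed.

Lemma hnorm_triangle V (z x y : V) : hnorm (x - y) <= hnorm (x - z) + hnorm (z - y).
Proof. by apply: le_trans (hnormD _ _); rewrite addrA subrK. Qed.

Lemma hnormZC V (a : R) (x : V) : hnorm (a%:C *: x) = `|a| * hnorm x.
Proof.
rewrite hnormZ /= oppr0 mulr0 subr0; congr (_ * _).
by rewrite -expr2 sqrtr_sqr.
Qed.

Lemma hnormZ_unit V (a : R[i]) (x : V) : a * a^* = 1 -> hnorm (a *: x) = hnorm x.
Proof. by move=> a1; rewrite hnormZ a1 /= sqrtr1 mul1r. Qed.

Lemma normr_reip V (x y : V) : `|reip x y| <= hnorm x * hnorm y.
Proof.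
rewrite -(@ler_pXn2r _ 2) // ?nnegrE ?mulr_ge0 ?hnorm_ge0 //.
by rewrite real_normK ?num_real // exprMn !hnorm_sqr reip_CS.
Qed.

Lemma inner_eq0r V (x : V) : (forall y, inner x y = 0) -> x = 0.
Proof. by move=> h; exact: inner_eq0. Qed.

Lemma hcvgP V (u : nat -> V) x : hcvg u x <->
  forall e : R, 0 < e -> exists N, forall n, (N <= n)%N -> hnorm (u n - x) < e.
Proof.
split => [/cvgrPdist_lt h e /h [N _ hN]|h].
  by exists N => n /hN; rewrite sub0r normrN ger0_norm // hnorm_ge0.
apply/cvgrPdist_lt => e /h [N hN]; exists N => // n /hN.
by rewrite sub0r normrN ger0_norm // hnorm_ge0.
Qed.

Lemma hcvg_cst V (x : V) : hcvg (fun=> x) x.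
Proof. by rewrite /hcvg subrr hnorm0; exact: cvg_cst. Qed.

Lemma hcvg_le V W (u : nat -> V) x (v : nat -> W) y (C : R) :
  hcvg u x -> (forall n, hnorm (v n - y) <= C * hnorm (u n - x)) -> hcvg v y.
Proof.
move=> ux h; apply: (@squeeze_cvgr _ _ _ _ (fun=> 0) (fun n => C * hnorm (u n - x))).
- by apply: nearW => n; rewrite hnorm_ge0 h.
- exact: cvg_cst.
- by rewrite -[0](mulr0 C); exact: cvgMr.
Qed.

Lemma hcvg_isometry V W (u : nat -> V) x (v : nat -> W) y :
  hcvg u x -> (forall n, hnorm (v n - y) = hnorm (u n - x)) -> hcvg v y.
Proof. by move=> ux h; apply: (hcvg_le (C := 1) ux) => n; rewrite mul1r h. Qed.

Lemma hcvgN V (u : nat -> V) x : hcvg u x -> hcvg (fun n => - u n) (- x).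
Proof. by move=> ux; apply: (hcvg_isometry ux) => n; rewrite -opprD hnormN. Qed.

Lemma hcvgB V (u v : nat -> V) x y :
  hcvg u x -> hcvg v y -> hcvg (fun n => u n - v n) (x - y).
Proof. by move=> ux /hcvgN; exact: hcvgD. Qed.

(* Nondecreasing index sequences are too restrictive for subsequences obtained by
   choice, hence the weaker growth condition. *)
Lemma hcvg_sub V (u : nat -> V) x (k : nat -> nat) :
  (forall n, (n <= k n)%N) -> hcvg u x -> hcvg (u \o k) x.
Proof.
move=> kn /hcvgP ux; apply/hcvgP => e /ux [N hN].
by exists N => n Nn; apply: hN; exact: leq_trans (kn n).
Qed.

Lemma hcvg_reip V (u v : nat -> V) x y :
  hcvg u x -> hcvg v y -> reip (u n) (v n) @[n --> \oo] --> reip x y.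
Proof.
move=> ux vy; under eq_fun do rewrite reip_polar; rewrite reip_polar.
apply: cvgMr; apply: cvgB.
  by rewrite !expr2; apply: cvgM; exact/hcvg_norm/hcvgD.
have h := hcvg_norm (hcvgD ux (hcvgZ (-1) vy)).
by rewrite !expr2; exact: cvgM.
Qed.

Lemma hcvg_unique V (u : nat -> V) x y : hcvg u x -> hcvg u y -> x = y.
Proof.
move=> ux uy; apply/eqP; rewrite -subr_eq0; apply/eqP/hnorm_eq0.
have := hcvg_norm (hcvgB ux uy); under eq_fun do rewrite subrr hnorm0.
by move=> h; apply: (cvg_unique _ h); [exact: Rhausdorff | exact: cvg_cst].
Qed.

(** How orthogonality relations and pairings pass to limits; constant sequences serve for the
    arguments that stay fixed. *)
Lemma hcvg_inner_eq V W (u v : nat -> V) (u' v' : nat -> W) x y x' y' :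
  hcvg u x -> hcvg v y -> hcvg u' x' -> hcvg v' y' ->
  (forall n, inner (u n) (v n) = inner (u' n) (v' n)) -> inner x y = inner x' y'.
Proof.
move=> ux vy ux' vy' e.
have E (f g : R^nat) (a b : R) : f @ \oo --> a -> g @ \oo --> b -> f =1 g -> a = b.
  move=> fa gb /funext fg; move: gb; rewrite -fg => gb.
  by apply: (cvg_unique _ fa gb); exact: Rhausdorff.
apply: eq_inner.
  by apply: E (hcvg_reip ux vy) (hcvg_reip ux' vy') _ => n; rewrite /reip e.
apply: E (hcvg_reip ux (hcvgZ 'i vy)) (hcvg_reip ux' (hcvgZ 'i vy')) _ => n.
by rewrite /reip !innerZr e.
Qed.

Lemma hcvg_hcauchy V (u : nat -> V) x : hcvg u x -> hcauchy u.
Proof.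
move=> /hcvgP ux e e0; have [N hN] := ux _ (divr_gt0 e0 (ltr0n _ 2)).
exists N => m n Nm Nn; apply: le_lt_trans (hnorm_triangle x _ _) _.
rewrite (hnormB x); have := hN _ Nm; have := hN _ Nn; lra.
Qed.

Lemma hcvg_prod V W (u : nat -> V * W) x y :
  hcvg u (x, y) <-> hcvg (fun n => (u n).1) x /\ hcvg (fun n => (u n).2) y.
Proof.
have E (p : V * W) : hnorm p ^+ 2 = hnorm p.1 ^+ 2 + hnorm p.2 ^+ 2.
  by rewrite !hnorm_sqr /reip prod_innerE ReD.
split=> [h|[hx hy]].
  split; apply: (hcvg_le (C := 1) h) => n; rewrite mul1r.
    rewrite -(@ler_pXn2r _ 2) // ?nnegrE ?hnorm_ge0 // E /=.
    by rewrite lerDl sqr_ge0.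
  rewrite -(@ler_pXn2r _ 2) // ?nnegrE ?hnorm_ge0 // E /=.
  by rewrite lerDr sqr_ge0.
apply: (@squeeze_cvgr _ _ _ _ (fun=> 0)
  (fun n => hnorm ((u n).1 - x) + hnorm ((u n).2 - y))).
- apply: nearW => n; rewrite hnorm_ge0 /=.
  rewrite -(@ler_pXn2r _ 2) // ?nnegrE ?addr_ge0 ?hnorm_ge0 // E /=.
  by have := hnorm_ge0 ((u n).1 - x); have := hnorm_ge0 ((u n).2 - y); nra.
- exact: cvg_cst.
- by rewrite -[0](addr0 0); exact: cvgD.
Qed.

End InnerProductSpaces.

(** * Closed subspaces, spans, uniqueness of projections and adjoints *)

Section Subspaces.
Context {R : realType}.
Implicit Types V W : innerType R.

Definition subspace V (M : set V) : Prop :=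
  M 0 /\ forall a x y, M x -> M y -> M (a *: x + y).

Lemma closed_subspaceW V (M : set V) : closed_subspace M -> subspace M.
Proof. by case. Qed.

Section SubspaceTheory.
Variables (V : innerType R) (M : set V).
Hypothesis sM : subspace M.

Lemma subspace0 : M 0. Proof. exact: sM.1. Qed.

Lemma subspaceD x y : M x -> M y -> M (x + y).
Proof. by move=> Mx My; have := sM.2 1 x y Mx My; rewrite scale1r. Qed.

Lemma subspaceZ a x : M x -> M (a *: x).
Proof. by move=> Mx; have := sM.2 a x 0 Mx sM.1; rewrite addr0. Qed.

Lemma subspaceN x : M x -> M (- x).
Proof. by move=> /(subspaceZ (-1)); rewrite scaleN1r. Qed.

Lemma subspaceB x y : M x -> M y -> M (x - y).
Proof. by move=> Mx /subspaceN; exact: subspaceD. Qed.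

Lemma subspace_sum n (a : 'I_n -> R[i]) (v : 'I_n -> V) :
  (forall i, M (v i)) -> M (\sum_i a i *: v i).
Proof.
by move=> Mv; apply: big_ind => //; [exact: subspace0 | exact: subspaceD |
  move=> i _; exact: subspaceZ].
Qed.

Lemma lspan_min A : A `<=` M -> lspan A `<=` M.
Proof. by move=> AM x [n [a [v [Av ->]]]]; apply: subspace_sum => i; exact: AM. Qed.

Section LinearOn.
Variables (W : innerType R) (A : V -> W).
Hypothesis lA : linear_on M A.

Lemma linear_on0 : A 0 = 0.
Proof.
have := lA 1 subspace0 subspace0; rewrite !scale1r addr0.
by move=> /(congr1 (fun y => y - A 0)); rewrite addrK subrr => <-.
Qed.

Lemma linear_onD x y : M x -> M y -> A (x + y) = A x + A y.
Proof. by move=> Mx My; have := lA 1 Mx My; rewrite !scale1r. Qed.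

Lemma linear_onZ a x : M x -> A (a *: x) = a *: A x.
Proof. by move=> Mx; have := lA a Mx subspace0; rewrite linear_on0 !addr0. Qed.

Lemma linear_onN x : M x -> A (- x) = - A x.
Proof. by move=> Mx; rewrite -scaleN1r linear_onZ // scaleN1r. Qed.

Lemma linear_onB x y : M x -> M y -> A (x - y) = A x - A y.
Proof. by move=> Mx My; rewrite linear_onD ?linear_onN //; exact: subspaceN. Qed.

Lemma linear_on_sum (I : Type) (r : seq I) (F : I -> V) :
  (forall i, M (F i)) -> A (\sum_(i <- r) F i) = \sum_(i <- r) A (F i).
Proof.
move=> MF; elim: r => [|i r ih]; first by rewrite !big_nil linear_on0.
rewrite !big_cons linear_onD ?ih //.
by apply: big_ind => //; [exact: subspace0 | exact: subspaceD].
Qed.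

Lemma subspace_image : subspace (A @` M).
Proof.
split; first by exists 0; [exact: subspace0 | exact: linear_on0].
by move=> a _ _ [x Mx <-] [y My <-]; exists (a *: x + y); [exact: sM.2 | exact: lA].
Qed.

Lemma isometry_inner x y : (forall z, M z -> hnorm (A z) = hnorm z) ->
  M x -> M y -> inner (A x) (A y) = inner x y.
Proof.
move=> nA Mx My.
have E z : M z -> reip (A x) (A z) = reip x z.
  move=> Mz; rewrite !reip_polar -linear_onZ // -!linear_onD ?nA //.
  - by apply: subspaceD => //; exact: subspaceZ.
  - exact: subspaceD.
  - exact: subspaceZ.
by apply: eq_inner; rewrite -?linear_onZ ?E //; exact: subspaceZ.
Qed.

Lemma bounded_hcvg (C : R) (u : nat -> V) x :
  (forall z, M z -> hnorm (A z) <= C * hnorm z) ->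
  (forall n, M (u n)) -> M x -> hcvg u x -> hcvg (A \o u) (A x).
Proof.
move=> bA Mu Mx ux; apply: (hcvg_le (C := C) ux) => n /=.
by rewrite -linear_onB // bA //; exact: subspaceB.
Qed.

End LinearOn.
End SubspaceTheory.

Lemma subspaceT V : subspace [set: V]. Proof. by []. Qed.

Lemma subset_hclosure V (A : set V) : A `<=` hclosure A.
Proof. by move=> x Ax; exists (fun=> x) => //; exact: hcvg_cst. Qed.

(** [hclosure] is sequential, so its idempotence would call for a diagonal sequence; in the metric
    form [hclosureK] is a triangle inequality. *)
Lemma hclosureP V (A : set V) x : hclosure A x <->
  forall e : R, 0 < e -> exists2 a, A a & hnorm (a - x) < e.
Proof.
split=> [[u Au /hcvgP ux] e /ux [N hN]|h]; first by exists (u N) => //; exact: hN.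
have p n : 0 < n.+1%:R^-1 :> R by rewrite invr_gt0 ltr0n.
pose f n := s2val (cid2 (h _ (p n))).
have Af n : A (f n) by rewrite /f; case: cid2.
exists f => //; apply: (@squeeze_cvgr _ _ _ _ (fun=> 0) (fun n => n.+1%:R^-1)).
- by apply: nearW => n; rewrite hnorm_ge0 /= ltW // /f; case: cid2.
- exact: cvg_cst.
- exact: cvg_harmonic.
Qed.

Lemma hclosureS V (A B : set V) : A `<=` B -> hclosure A `<=` hclosure B.
Proof. by move=> AB x [u Au ux]; exists u => // n; exact: AB. Qed.

Lemma hclosureK V (A : set V) : hclosure (hclosure A) `<=` hclosure A.
Proof.
move=> x /hclosureP h; apply/hclosureP => e e0.
have e20 : 0 < e / 2 by rewrite divr_gt0.
have [a /hclosureP /(_ _ e20) [b Ab ba] ax] := h _ e20.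
exists b => //; apply: le_lt_trans (hnorm_triangle a _ _) _.
by rewrite [ltRHS](splitr e) ltrD.
Qed.

Lemma hclosure_subspace V (M : set V) : subspace M -> closed_subspace (hclosure M).
Proof.
move=> sM; split; first by apply: subset_hclosure; exact: subspace0.
  move=> a x y [u Mu ux] [v Mv vy]; exists (fun n => a *: u n + v n).
    by move=> n; exact: sM.2.
  by apply: hcvgD => //; exact: hcvgZ.
exact: hclosureK.
Qed.

Lemma subset_lspan V (A : set V) : A `<=` lspan A.
Proof.
move=> x Ax; exists 1%N, (fun=> 1), (fun=> x); split=> //.
by rewrite big_ord1 scale1r.
Qed.

Lemma lspan_subspace V (A : set V) : subspace (lspan A).
Proof.
split; first by exists 0%N, (fun=> 0), (fun=> 0); split; [case | rewrite big_ord0].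
move=> a x y [n [b [v [Av ->]]]] [m [c [w [Aw ->]]]].
exists (n + m)%N, (fun i => match fintype.split i with inl j => a * b j | inr k => c k end),
  (fun i => match fintype.split i with inl j => v j | inr k => w k end); split.
  by move=> i; case: fintype.split.
rewrite big_split_ord /= scaler_sumr; congr (_ + _); apply: eq_bigr => i _.
  by case: splitP => j /= e; [rewrite (ord_inj e) scalerA |
    have := ltn_ord i; rewrite e ltnNge leq_addr].
case: splitP => j /= e; last by have /addnI/ord_inj -> := e.
by have := ltn_ord j; rewrite -e ltnNge leq_addr.
Qed.

Lemma cspan_closed V (A : set V) : closed_subspace (cspan A).
Proof. exact/hclosure_subspace/lspan_subspace. Qed.

Lemma subset_cspan V (A : set V) : A `<=` cspan A.
Proof. by move=> x /subset_lspan /subset_hclosure. Qed.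

Lemma cspan_min V (A M : set V) : closed_subspace M -> A `<=` M -> cspan A `<=` M.
Proof.
move=> cM AM x h; case: (cM) => _ _; apply; apply: hclosureS h.
by apply: lspan_min => //; exact: closed_subspaceW.
Qed.

Lemma orth_closed V (A : set V) : closed_subspace (orth A).
Proof.
split; first by move=> y _; rewrite inner0l.
  by move=> a x y hx hy z Az; rewrite innerDl innerZl hx ?hy // mulr0 addr0.
move=> x [u Au ux] y Ay; rewrite -(inner0l y).
apply: (hcvg_inner_eq ux (hcvg_cst y) (hcvg_cst 0) (hcvg_cst y)) => n.
by rewrite inner0l Au.
Qed.

Lemma setT_closed V : closed_subspace [set: V]. Proof. by split. Qed.

Lemma orth_cspan V (A : set V) x : orth A x -> orth (cspan A) x.
Proof.
move=> Ax y yA; rewrite innerC.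
suff -> : inner y x = 0 by rewrite rmorph0.
have : cspan A `<=` orth [set x] by apply: cspan_min => [|z Az w ->];
  [exact: orth_closed | rewrite innerC Ax // rmorph0].
by apply.
Qed.

Lemma orth_hclosure V (A : set V) x : orth A x -> orth (hclosure A) x.
Proof.
by move=> /orth_cspan h y yA; apply: h; apply: hclosureS yA; exact: subset_lspan.
Qed.

(** [hproj] selects from a set of candidates. Orthogonality leaves at most one candidate in a
    subspace, so a projection is evaluated by exhibiting it; [hadj_eq] does the same for
    adjoints. *)
Lemma hproj_eq V (M : set V) x y : subspace M -> M y -> orth M (x - y) ->
  hproj M x = y.
Proof.
move=> sM My oy; apply: xget_unique => [//|z [Mz oz]].
apply/eqP; rewrite -subr_eq0; apply/eqP/inner_eq0.
rewrite -[X in inner X _](_ : (x - y) - (x - z) = z - y); last first.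
  by rewrite opprB addrC addrA subrK.
by rewrite innerBl oy ?oz ?subrr //; exact: subspaceB.
Qed.

Lemma hadj_eq V W (M : set V) (A : V -> W) y x : subspace M -> M x ->
  (forall z, M z -> inner (A z) y = inner z x) -> hadj M A y = x.
Proof.
move=> sM Mx h; apply: xget_unique => [//|x' [Mx' h']].
apply/eqP; rewrite -subr_eq0; apply/eqP/inner_eq0.
have Md := subspaceB sM Mx' Mx.
by rewrite innerBr -h // -h' // subrr.
Qed.

Section Unitary.
Variables (V W : innerType R) (M : set V) (N : set W) (A : V -> W).
Hypotheses (sM : subspace M) (uA : unitary_on M N A).

Lemma unitary_inner x y : M x -> M y -> inner (A x) (A y) = inner x y.
Proof. by have [[lA nA] _] := uA; exact: isometry_inner. Qed.

Lemma unitary_in x : M x -> N (A x).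
Proof. by have [_ <-] := uA; exists x. Qed.

Lemma unitary_hadjK x : M x -> hadj M A (A x) = x.
Proof. by move=> Mx; apply: hadj_eq => // z Mz; exact: unitary_inner. Qed.

Lemma unitary_hadj_in y : N y -> M (hadj M A y).
Proof. by have [_ <-] := uA => -[x Mx <-]; rewrite unitary_hadjK. Qed.

Lemma unitary_Khadj y : N y -> A (hadj M A y) = y.
Proof. by have [_ <-] := uA => -[x Mx <-]; rewrite unitary_hadjK. Qed.

Lemma unitary_adj x y : M x -> N y -> inner (A x) y = inner x (hadj M A y).
Proof.
move=> Mx Ny; rewrite -[in LHS](unitary_Khadj Ny) unitary_inner //.
exact: unitary_hadj_in.
Qed.

End Unitary.
End Subspaces.

(** * Existence of projections and Riesz representation *)

Section HilbertSpaces.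
Context {R : realType}.
Implicit Types V : hilbertType R.

Lemma closed_complete V (M : set V) (u : nat -> V) : closed_subspace M ->
  (forall n, M (u n)) -> hcauchy u -> exists2 x, M x & hcvg u x.
Proof.
move=> [_ _ cM] Mu /hilbert_complete [x ux].
by exists x => //; apply: cM; exists u.
Qed.

Lemma parallelogram (V : innerType R) (x y : V) :
  hnorm (x + y) ^+ 2 + hnorm (x - y) ^+ 2 = 2 * hnorm x ^+ 2 + 2 * hnorm y ^+ 2.
Proof. by rewrite !hnorm_sqr !(reipDl, reipDr, reipNl, reipNr); ring. Qed.

Lemma hproj_spec V (M : set V) (x : V) : closed_subspace M ->
  M (hproj M x) /\ orth M (x - hproj M x).
Proof.
move=> cM; have sM := closed_subspaceW cM.
pose S := [set hnorm (x - y) ^+ 2 | y in M].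
have Sn : S !=set0 by exists (hnorm (x - 0) ^+ 2); exists 0 => //; exact: subspace0.
have Sb : has_lbound S by exists 0 => _ [y _ <-]; rewrite sqr_ge0.
pose d := inf S.
have dle y : M y -> d <= hnorm (x - y) ^+ 2 by move=> My; apply: ge_inf => //; exists y.
have ex n : exists2 y, M y & hnorm (x - y) ^+ 2 < d + n.+1%:R^-1.
  have n0 : 0 < n.+1%:R^-1 :> R by rewrite invr_gt0 ltr0n.
  have [_ [y My <-] h] := inf_adherent n0 (conj Sn Sb).
  by exists y.
pose u n := s2val (cid2 (ex n)).
have Mu n : M (u n) by rewrite /u; case: cid2.
have hu n : hnorm (x - u n) ^+ 2 < d + n.+1%:R^-1 by rewrite /u; case: cid2.
have par y z : M y -> M z ->
    hnorm (y - z) ^+ 2 <= 2 * hnorm (x - y) ^+ 2 + 2 * hnorm (x - z) ^+ 2 - 4 * d.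
  move=> My Mz; have := parallelogram (x - y) (x - z).
  have -> : x - y - (x - z) = z - y by rewrite opprB addrC addrA subrK.
  (* The midpoint of y and z lies in M, so its distance to x is bounded below by [d]; the factor 2
     becomes the 4 in [4 * d]. *)
  have -> : x - y + (x - z) = (2%:C) *: (x - (2^-1)%:C *: (y + z)).
    rewrite scalerBr scalerA -rmorphM /= mulfV // scale1r opprD addrACA.
    by rewrite -[2]natr1 rmorphD scalerDl scale1r.
  rewrite hnormZC exprMn real_normK ?num_real // (hnormB z y) => <-.
  have := dle _ (subspaceZ sM (2^-1)%:C (subspaceD sM My Mz)); lra.
have cu : hcauchy u.
  move=> e e0; have e2 : 0 < e ^+ 2 / 4 by rewrite divr_gt0 ?exprn_gt0.
  have [N _ hN] := (near_infty_natSinv_lt (PosNum e2)).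
  exists N => m n Nm Nn; rewrite -(@ltr_pXn2r _ 2) ?nnegrE ?hnorm_ge0 ?ltW //.
  apply: le_lt_trans (par _ _ (Mu m) (Mu n)) _.
  have := hu m; have := hu n.
  have h1 : m.+1%:R^-1 < e ^+ 2 / 4 := hN _ Nm.
  have h2 : n.+1%:R^-1 < e ^+ 2 / 4 := hN _ Nn.
  by move: h1 h2; move: (m.+1%:R^-1) (n.+1%:R^-1) => a b; lra.
have [y My uy] := closed_complete cM Mu cu.
have dy : hnorm (x - y) ^+ 2 = d.
  apply/eqP; rewrite eq_le dle // andbT.
  have h1 : hnorm (x - u n) ^+ 2 @[n --> \oo] --> hnorm (x - y) ^+ 2.
    have h := hcvg_norm (hcvgB (hcvg_cst x) uy).
    by rewrite expr2; under eq_fun do rewrite expr2; exact: cvgM.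
  have h2 : d + n.+1%:R^-1 @[n --> \oo] --> d.
    by rewrite -[X in _ --> X]addr0; apply: cvgD; [exact: cvg_cst | exact: cvg_harmonic].
  apply: (@ler_cvg_to _ _ _ _ _ _ _ _ h1 h2).
  by apply: nearW => n; exact: ltW.
suff oy : orth M (x - y) by rewrite (hproj_eq sM My oy).
move=> z Mz.
have key c : reip (x - y) (c *: z) = 0.
  set w := c *: z; have Mw : M w by exact: subspaceZ.
  have q t : 0 <= t ^+ 2 * reip w w - 2 * t * reip (x - y) w.
    have := dle _ (subspaceD sM My (subspaceZ sM t%:C Mw)).
    rewrite -dy opprD addrA !hnorm_sqr !(reipBl, reipBr, reipZCl, reipZCr).
    rewrite (reipC y x) (reipC w x) (reipC w y); lra.
  (* The minimizer of the quadratic would divide by [reip w w], which may vanish; adding 1 still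
     makes the value a negative multiple of [reip (x - y) w ^+ 2]. *)
  have := q (reip (x - y) w / (1 + reip w w)).
  have w0 := reip_ge0 w; set p := reip (x - y) w.
  have -> : (p / (1 + reip w w)) ^+ 2 * reip w w - 2 * (p / (1 + reip w w)) * p =
     - (p ^+ 2 * ((2 + reip w w) / (1 + reip w w) ^+ 2)) by field; lra.
  rewrite oppr_ge0 pmulr_lle0; last by rewrite divr_gt0 ?exprn_gt0 //; lra.
  move=> p0; apply/eqP; rewrite -sqrf_eq0 eq_le p0 sqr_ge0 //.
have k1 := key 1; rewrite scale1r in k1.
by rewrite inner_eta k1 key.
Qed.

Lemma hproj_in V (M : set V) x : closed_subspace M -> M (hproj M x).
Proof. by move=> /(hproj_spec x)[]. Qed.

Lemma hproj_orth V (M : set V) x : closed_subspace M -> orth M (x - hproj M x).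
Proof. by move=> /(hproj_spec x)[]. Qed.

Lemma inner_hprojl V (M : set V) x y : closed_subspace M -> M y ->
  inner (hproj M x) y = inner x y.
Proof.
move=> cM My; have /(_ _ My)/eqP := hproj_orth x cM.
by rewrite innerBl subr_eq0 => /eqP.
Qed.

Lemma inner_hprojr V (M : set V) x y : closed_subspace M -> M x ->
  inner x (hproj M y) = inner x y.
Proof. by move=> cM Mx; rewrite innerC inner_hprojl // -innerC. Qed.

Lemma hproj_linear V (M : set V) : closed_subspace M -> linear_on setT (hproj M).
Proof.
move=> cM a x y _ _; have sM := closed_subspaceW cM.
apply: hproj_eq => //; first by apply: sM.2; exact: hproj_in.
move=> z Mz; rewrite innerBl !innerDl !innerZl !inner_hprojl //.
by rewrite subrr.
Qed.

Lemma hproj_norm V (M : set V) x : closed_subspace M -> hnorm (hproj M x) <= hnorm x.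
Proof.
move=> cM; rewrite -(@ler_pXn2r _ 2) // ?nnegrE ?hnorm_ge0 // !hnorm_sqr.
have h : reip (hproj M x) (x - hproj M x) = 0.
  by rewrite reipC /reip hproj_orth //; exact: hproj_in.
have -> : reip x x = reip (hproj M x + (x - hproj M x)) (hproj M x + (x - hproj M x)).
  by rewrite addrC subrK.
move: h; move: (hproj M x) => p; move: (x - p) => q h.
rewrite !(reipDl, reipDr) (reipC q p) h !addr0 add0r lerDl.
exact: reip_ge0.
Qed.

(** Riesz representation for the functional z |-> <A z, y>, the form in which it produces adjoints.
    The representing vector is a multiple of a vector [z1] of M orthogonal to the kernel [K]. *)
Lemma riesz V (W : innerType R) (M : set V) (A : V -> W) (C : R) (y : W) :
  closed_subspace M -> linear_on M A ->
  (forall z, M z -> hnorm (A z) <= C * hnorm z) ->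
  exists2 x, M x & forall z, M z -> inner (A z) y = inner z x.
Proof.
move=> cM lA bA; have sM := closed_subspaceW cM.
pose K := [set z | M z /\ inner (A z) y = 0].
have cK : closed_subspace K.
  split; first by split; [exact: subspace0 | rewrite (linear_on0 sM lA) inner0l].
    move=> a z w [Mz z0] [Mw w0]; split; first exact: sM.2.
    by rewrite lA // innerDl innerZl z0 w0 mulr0 addr0.
  move=> z [u Ku uz]; have Mz : M z by case: cM => _ _; apply; exists u => // n; case: (Ku n).
  split=> //; rewrite -(inner0l y).
  have Mu n : M (u n) by case: (Ku n).
  apply: (hcvg_inner_eq (bounded_hcvg sM lA bA Mu Mz uz) (hcvg_cst y) (hcvg_cst 0)
    (hcvg_cst y)) => n /=.
  by rewrite inner0l; case: (Ku n).
have [MK|] := pselect (M `<=` K).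
  exists 0; first exact: subspace0.
  by move=> z /MK [_ ->]; rewrite inner0r.
move=> /existsNP[z0 /not_implyP[Mz0 nKz0]].
pose z1 := z0 - hproj K z0.
have Mz1 : M z1 by apply: subspaceB => //; have [] := hproj_in z0 cK.
have oz1 : orth K z1 by exact: hproj_orth.
have c0 : inner (A z1) y != 0.
  apply/eqP => h; apply: nKz0.
  have Kz1 : K z1 by [].
  rewrite (_ : z0 = 1 *: z1 + hproj K z0); last by rewrite scale1r subrK.
  by apply: (closed_subspaceW cK).2 => //; exact: hproj_in.
have n0 : inner z1 z1 != 0.
  apply: contra c0 => /eqP/inner_eq0 ->.
  by rewrite (linear_on0 sM lA) inner0l.
set c := inner (A z1) y in c0.
(* The scalar is forced by z = [z1]; it is conjugated because [inner] is conjugate-linear in its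
   second argument. *)
exists ((c^* / (inner z1 z1)^*) *: z1); first exact: subspaceZ.
move=> z Mz.
have Kz : K (z - (inner (A z) y / c) *: z1).
  split; first by apply: subspaceB => //; exact: subspaceZ.
  rewrite (linear_onB sM lA) ?(linear_onZ sM lA) //; last exact: subspaceZ.
  by rewrite innerBl innerZl -/c divfK // subrr.
have : inner (z - (inner (A z) y / c) *: z1) z1 = 0.
  by rewrite innerC oz1 // rmorph0.
move=> /eqP; rewrite innerBl innerZl subr_eq0 => /eqP h.
rewrite innerZr h rmorphM fmorphV /= !conjCK.
by field; apply/andP; split.
Qed.

Lemma hadj_spec V (W : innerType R) (M : set V) (A : V -> W) (C : R) (y : W) :
  closed_subspace M -> linear_on M A ->
  (forall z, M z -> hnorm (A z) <= C * hnorm z) ->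
  M (hadj M A y) /\ forall z, M z -> inner (A z) y = inner z (hadj M A y).
Proof.
move=> cM lA bA; have [x Mx h] := riesz y cM lA bA.
by rewrite (hadj_eq (closed_subspaceW cM) Mx h).
Qed.

End HilbertSpaces.

Section Adjoint.
Context {R : realType}.
Variables (V : hilbertType R) (W : innerType R) (M : set V) (A : V -> W) (C : R).
Hypotheses (cM : closed_subspace M) (lA : linear_on M A)
  (bA : forall z, M z -> hnorm (A z) <= C * hnorm z).

Lemma hadj_in y : M (hadj M A y).
Proof. by have [] := hadj_spec y cM lA bA. Qed.

Lemma inner_hadjr z y : M z -> inner z (hadj M A y) = inner (A z) y.
Proof. by have [_ h] := hadj_spec y cM lA bA => /h. Qed.

Lemma inner_hadjl z y : M z -> inner (hadj M A y) z = inner y (A z).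
Proof. by move=> Mz; rewrite innerC inner_hadjr // -innerC. Qed.

Lemma hadj_linear : linear_on setT (hadj M A).
Proof.
move=> a x y _ _; apply: hadj_eq; first exact: closed_subspaceW.
  by apply: (closed_subspaceW cM).2; exact: hadj_in.
by move=> z Mz; rewrite !innerDr !innerZr !inner_hadjr.
Qed.

(** The absolute value matters: when M contains only 0, the bound on A allows a negative [C]. *)
Lemma hadj_norm y : hnorm (hadj M A y) <= `|C| * hnorm y.
Proof.
set x := hadj M A y; have Mx : M x by exact: hadj_in.
have [x0|x0] := eqVneq (hnorm x) 0; first by rewrite x0 mulr_ge0 // hnorm_ge0.
have xp : 0 < hnorm x by rewrite lt_neqAle eq_sym x0 hnorm_ge0.
rewrite -(ler_pM2l xp) -expr2 hnorm_sqr /reip {2}/x inner_hadjr // -/(reip _ _).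
apply: le_trans (ler_norm _) _; apply: le_trans (normr_reip _ _) _.
rewrite mulrA ler_wpM2r ?hnorm_ge0 //; apply: le_trans (bA Mx) _.
by rewrite mulrC ler_wpM2l ?hnorm_ge0 // ler_norm.
Qed.

End Adjoint.

(** * Square roots of positive operators *)

Section PositiveOperators.
Context {R : realType} (V : innerType R) (M : set V).
Hypothesis sM : subspace M.
Implicit Types S X Y : V -> V.

(** The form <S z, z> is real; testing this at x + y and at x + i y compares the imaginary and then
    the real parts of the two sides. *)
Lemma positive_sym S x y : positive_on M S -> M x -> M y ->
  inner (S x) y = inner x (S y).
Proof.
move=> [lS SM pS] Mx My.
have reel z : M z -> complex.Im (inner (S z) z) = 0.
  by move=> /pS; rewrite lecE => /andP[/eqP].
have Miy : M ('i *: y) by exact: subspaceZ.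
have h1 := reel _ (subspaceD sM Mx My); have h2 := reel _ (subspaceD sM Mx Miy).
move: h1 h2; rewrite !(linear_onD lS) ?(linear_onZ sM lS) //.
rewrite [inner x _]innerC !(innerDl, innerDr, innerZl, innerZr).
have := reel _ Mx; have := reel _ My.
case: (inner (S x) x) (inner (S y) y) (inner (S x) y) (inner (S y) x) =>
  [a1 a2] [b1 b2] [c1 c2] [d1 d2] /=.
by move=> -> -> h1 h2; congr (_ +i* _); move: h1 h2; lra.
Qed.

Lemma positive_reip S x : positive_on M S -> M x -> 0 <= reip (S x) x.
Proof. by move=> [_ _ pS] /pS; rewrite lecE => /andP[]. Qed.

Lemma positive_reip_sym S x y : positive_on M S -> M x -> M y ->
  reip (S x) y = reip x (S y).
Proof. by move=> pS Mx My; rewrite /reip positive_sym. Qed.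

Lemma positive_CS S x y : positive_on M S -> M x -> M y ->
  reip (S x) y ^+ 2 <= reip (S x) x * reip (S y) y.
Proof.
move=> pS Mx My; have [lS _ _] := pS.
have q t : 0 <= reip (S x) x + 2 * t * reip (S x) y + t ^+ 2 * reip (S y) y.
  have Mz : M (t%:C *: y) by exact: subspaceZ.
  have := positive_reip pS (subspaceD sM Mx Mz).
  rewrite (linear_onD lS) // (linear_onZ sM lS) //.
  rewrite !(reipDl, reipDr, reipZCl, reipZCr).
  by rewrite (positive_reip_sym pS My Mx) (reipC y); lra.
move: (reip (S x) x) (reip (S x) y) (reip (S y) y) (positive_reip pS My) (positive_reip pS Mx) q.
move=> a b c c0 a0 q.
have [c00|c00] := eqVneq c 0.
  (* For c = 0 the quadratic is affine in t, and this t would give it the value -1 unless b = 0. *)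
  have := q (- (a + 1) / (2 * b)); rewrite c00 !mulr0 addr0.
  have [->|b0] := eqVneq b 0; first by rewrite expr0n.
  have -> : a + 2 * (- (a + 1) / (2 * b)) * b = -1 by field.
  by lra.
have cp : 0 < c by rewrite lt_neqAle eq_sym c00.
have := q (- b / c).
have -> : a + 2 * (- b / c) * b + (- b / c) ^+ 2 * c = (a * c - b ^+ 2) / c by field.
by rewrite pmulr_lge0 ?invr_gt0 // subr_ge0.
Qed.

(** This is [S^2 <= S] for [0 <= S <= 1], from Cauchy-Schwarz for the form of S at x and S x. It
    turns monotone convergence of quadratic forms into convergence in norm. *)
Lemma positive_norm S x : positive_on M S ->
  (forall z, M z -> reip (S z) z <= reip z z) -> M x ->
  hnorm (S x) ^+ 2 <= reip (S x) x.
Proof.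
move=> pS S1 Mx; have [_ SM _] := pS.
have MSx := SM _ Mx; rewrite hnorm_sqr.
have := positive_CS pS Mx MSx; have := S1 _ MSx; have := positive_reip pS Mx.
have := positive_reip pS MSx; have := reip_ge0 (S x).
move: (reip (S x) (S x)) (reip (S x) x) (reip (S (S x)) (S x)) => a b c.
move=> a0 c0 b0 ca ab.
have [->//|an0] := eqVneq a 0.
have ap : 0 < a by rewrite lt_neqAle eq_sym an0.
by rewrite -(ler_pM2r ap) -expr2; apply: le_trans ab _; rewrite ler_wpM2l.
Qed.

Lemma positive_contraction S x : positive_on M S ->
  (forall z, M z -> reip (S z) z <= reip z z) -> M x -> hnorm (S x) <= hnorm x.
Proof.
move=> pS S1 Mx; rewrite -(@ler_pXn2r _ 2) ?nnegrE ?hnorm_ge0 //.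
by apply: le_trans (positive_norm pS S1 Mx) _; rewrite hnorm_sqr S1.
Qed.

(* Polynomials in [B] with nonnegative coefficients: a multiplicative cone of
   positive operators. *)
Inductive cone (B : V -> V) : (V -> V) -> Prop :=
| cone_iter k : cone B (iter k B)
| cone_add X Y : cone B X -> cone B Y -> cone B (fun x => X x + Y x)
| cone_scale (r : R) X : 0 <= r -> cone B X -> cone B (fun x => r%:C *: X x)
| cone_eq X Y : (forall x, M x -> X x = Y x) -> cone B X -> cone B Y.

Section Cone.
Variable B : V -> V.
Hypothesis pB : positive_on M B.

Let lB : linear_on M B. Proof. by case: pB. Qed.
Let BM x : M x -> M (B x). Proof. by case: pB => _ h _ /h. Qed.

Let iterM k x : M x -> M (iter k B x).
Proof. by move=> Mx; elim: k => //= k; exact: BM. Qed.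

Lemma cone_positive X : cone B X -> positive_on M X.
Proof.
elim => [k|{}X Y _ [lX XM pX] _ [lY YM pY]|r {}X r0 _ [lX XM pX]|{}X Y XY _ [lX XM pX]].
- split; [|by move=> x; exact: iterM|].
    by elim: k => [|k ih] a x y Mx My //=; rewrite ih // lB //; exact: iterM.
  (* Powers go down by two, [<B^(k+2) x, x> = <B^k (B x), B x>], so the exponents 0 and 1 are the
     base cases. *)
  have [n] := ubnP k; elim: n k => // n ih [|[|k]] kn x Mx /=.
  + exact: inner_ge0.
  + by case: pB => _ _; exact.
  + rewrite positive_sym //; last exact: (iterM k.+1).
    by rewrite -/(iter k.+1 B x) iterSr; apply: ih => //; [exact: ltnW | exact: BM].
- split=> [a x y Mx My|x Mx|x Mx].
  + by rewrite lX ?lY // scalerDr addrACA.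
  + by apply: subspaceD; [| exact: XM | exact: YM].
  + by rewrite innerDl addr_ge0 ?pX ?pY.
- split=> [a x y Mx My|x Mx|x Mx].
  + by rewrite lX // scalerDr !scalerA mulrC.
  + by apply: subspaceZ => //; exact: XM.
  + by rewrite innerZl mulr_ge0 ?pX // ler0c.
- split=> [a x y Mx My|x Mx|x Mx].
  + by rewrite -!XY ?lX //; exact: sM.2.
  + by rewrite -XY //; exact: XM.
  + by rewrite -XY // pX.
Qed.

(** Positivity of a product of commuting positive operators usually goes through square roots, which
    are still to be built. Inside the cone both factors expand into powers of B, and a product of
    powers is a power. *)
Lemma cone_comp X Y : cone B X -> cone B Y -> cone B (X \o Y).
Proof.
move=> cX; elim: cX Y => [k|{}X X' _ ih _ ih'|r {}X r0 _ ih|{}X X' XX _ ih] Y cY.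
- have [lk kM _] := cone_positive (cone_iter B k).
  elim: cY => [j|Y1 Y2 c1 h1 c2 h2|r {}Y r0 cY h|Y1 Y2 Y12 cY h].
  + by apply: cone_eq (cone_iter B (k + j)) => x _ /=; rewrite iterD.
  + apply: cone_eq (cone_add h1 h2) => x Mx /=; rewrite (linear_onD lk) //.
      by have [_ + _] := cone_positive c1; exact.
    by have [_ + _] := cone_positive c2; exact.
  + apply: cone_eq (cone_scale r0 h) => x Mx /=; rewrite (linear_onZ sM lk) //.
    by have [_ + _] := cone_positive cY; exact.
  + by apply: cone_eq h => x Mx /=; rewrite Y12.
- exact: (cone_add (ih _ cY) (ih' _ cY)).
- exact: (cone_scale r0 (ih _ cY)).
- apply: cone_eq (ih _ cY) => x Mx /=; rewrite XX //.
  by have [_ + _] := cone_positive cY; exact.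
Qed.

End Cone.

(* [x - sqrt_iter B n x] increases to the square root of [1 - B]. *)
Fixpoint sqrt_iter (B : V -> V) (n : nat) (x : V) : V :=
  if n is m.+1 then (2^-1)%:C *: (B x + sqrt_iter B m (sqrt_iter B m x)) else 0.

Section SqrtIter.
Variable B : V -> V.
Hypothesis pB : positive_on M B.
Hypothesis B1 : forall z, M z -> reip (B z) z <= reip z z.

Let half_ge0 : 0 <= 2^-1 :> R. Proof. by rewrite invr_ge0. Qed.

Let iterSE n x : sqrt_iter B n.+1 x =
  (2^-1)%:C *: (B x + sqrt_iter B n (sqrt_iter B n x)).
Proof. by []. Qed.

Lemma cone_sqrt_iter n : cone B (sqrt_iter B n).
Proof.
elim: n => [|n ih] /=.
  by apply: cone_eq (cone_scale (lexx 0) (cone_iter B 0)) => x _; rewrite scale0r.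
exact: (cone_scale half_ge0 (cone_add (cone_iter B 1) (cone_comp pB ih ih))).
Qed.

Lemma sqrt_iter_in n x : M x -> M (sqrt_iter B n x).
Proof. by have [_ + _] := cone_positive pB (cone_sqrt_iter n); exact. Qed.

Lemma sqrt_iter_linear n : linear_on M (sqrt_iter B n).
Proof. by have [] := cone_positive pB (cone_sqrt_iter n). Qed.

Lemma sqrt_iter_norm n x : M x -> hnorm (sqrt_iter B n x) <= hnorm x.
Proof.
elim: n x => [|n ih] x Mx /=; first by rewrite hnorm0 hnorm_ge0.
rewrite hnormZC ger0_norm //.
have h1 := positive_contraction pB B1 Mx.
have h2 := le_trans (ih _ (sqrt_iter_in n Mx)) (ih _ Mx).
have h3 := hnormD (B x) (sqrt_iter B n (sqrt_iter B n x)).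
by move: h1 h2 h3; lra.
Qed.

(** Write Y and Z for the iterates of ranks n and n + 1. The next increment is half of
    [Z^2 - Y^2 = Z (Z - Y) + (Z - Y) Y], a sum of products of members of the cone. *)
Lemma cone_sqrt_iterS n : cone B (fun x => sqrt_iter B n.+1 x - sqrt_iter B n x).
Proof.
elim: n => [|n ih].
  apply: cone_eq (cone_scale half_ge0 (cone_iter B 1)) => x _ /=.
  by rewrite addr0 subr0.
have c2 := cone_add (cone_comp pB (cone_sqrt_iter n.+1) ih)
                    (cone_comp pB ih (cone_sqrt_iter n)).
apply: cone_eq (cone_scale half_ge0 c2) => x Mx.
rewrite /comp.
have l1 := sqrt_iter_linear n.+1.
have m0 := sqrt_iter_in n Mx; have m1 := sqrt_iter_in n.+1 Mx.
rewrite (linear_onB sM l1) // addrA subrK.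
rewrite (iterSE n.+1 x) [in X in _ = _ - X](iterSE n x).
by rewrite -scalerBr opprD addrACA subrr add0r.
Qed.

Lemma cone_sqrt_iterB m n : (n <= m)%N ->
  cone B (fun x => sqrt_iter B m x - sqrt_iter B n x).
Proof.
move=> /subnK <-; elim: (m - n)%N => [|k ih].
  apply: cone_eq (cone_scale (lexx 0) (cone_iter B 0)) => x _.
  by rewrite add0n subrr scale0r.
apply: cone_eq (cone_add (cone_sqrt_iterS (k + n)) ih) => x _.
by rewrite addrA subrK addSn.
Qed.

Lemma sqrt_iter_dist m n x : (n <= m)%N -> M x ->
  hnorm (sqrt_iter B m x - sqrt_iter B n x) ^+ 2 <=
  reip (sqrt_iter B m x) x - reip (sqrt_iter B n x) x.
Proof.
move=> nm Mx; rewrite -reipBl.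
apply: (positive_norm (cone_positive pB (cone_sqrt_iterB nm))) => // z Mz.
rewrite reipBl; have := positive_reip (cone_positive pB (cone_sqrt_iter n)) Mz.
have : reip (sqrt_iter B m z) z <= reip z z.
  apply: le_trans (ler_norm _) _; apply: le_trans (normr_reip _ _) _.
  by rewrite -hnorm_sqr expr2 ler_wpM2r ?hnorm_ge0 // sqrt_iter_norm.
by lra.
Qed.

Lemma sqrt_iter_cauchy x : M x -> hcauchy (fun n => sqrt_iter B n x).
Proof.
move=> Mx; pose a n := reip (sqrt_iter B n x) x.
have nda : nondecreasing_seq a.
  move=> n m nm; rewrite /a -subr_ge0.
  by apply: le_trans (sqrt_iter_dist nm Mx); exact: sqr_ge0.
have uba : has_ubound (range a).
  exists (reip x x) => _ [n _ <-]; rewrite /a.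
  apply: le_trans (ler_norm _) _; apply: le_trans (normr_reip _ _) _.
  by rewrite -hnorm_sqr expr2 ler_wpM2r ?hnorm_ge0 // sqrt_iter_norm.
have ca := nondecreasing_cvgn nda uba.
move=> e e0; have e2 : 0 < e ^+ 2 by rewrite exprn_gt0.
move/cvgrPdist_lt : (ca) => /(_ _ e2) [N _ hN].
have key m n : (N <= n)%N -> (n <= m)%N ->
    hnorm (sqrt_iter B m x - sqrt_iter B n x) < e.
  move=> Nn nm; rewrite -(@ltr_pXn2r _ 2) ?nnegrE ?hnorm_ge0 ?ltW //.
  apply: le_lt_trans (sqrt_iter_dist nm Mx) _.
  rewrite -/(a m) -/(a n).
  have am : a m <= sup (range a) by apply: ub_le_sup => //; exists m.
  have := hN _ Nn => /=; rewrite ltr_norml => /andP[_]; lra.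
exists N => m n Nm Nn; have [|mn] := leqP n m; first exact: key.
by rewrite hnormB; apply: key => //; exact: ltnW.
Qed.

End SqrtIter.

End PositiveOperators.

(** Serves twice: with T a square root of A, for the uniqueness of square roots, and with a
    contraction T, to move it past its defect operators. *)
Lemma sqrt_iter_intertwine (R : realType) (V W : innerType R) (M : set V)
    (T : V -> W) (B : V -> V) (B' : W -> W) n x :
  subspace M -> linear_on M T -> positive_on M B ->
  (forall z, M z -> T (B z) = B' (T z)) ->
  M x -> T (sqrt_iter B n x) = sqrt_iter B' n (T x).
Proof.
move=> sM lT pB TB; elim: n x => [|n ih] x Mx /=; first by rewrite (linear_on0 sM lT).
have [_ BM _] := pB; have m0 := sqrt_iter_in sM pB n Mx.
have m1 := sqrt_iter_in sM pB n m0.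
rewrite (linear_onZ sM lT); last by apply: subspaceD => //; exact: BM.
by rewrite (linear_onD lT) ?TB ?ih //; exact: BM.
Qed.

Section SquareRoot.
Context {R : realType} (V : hilbertType R) (M : set V).
Hypothesis cM : closed_subspace M.
Variable A : V -> V.
Hypothesis A1 : forall z, M z -> reip (A z) z <= reip z z.

Let sM : subspace M := closed_subspaceW cM.
Local Notation B := (fun x => x - A x).

Lemma inner_ge0_lim (W : innerType R) (u : nat -> W) x y : hcvg u y ->
  (forall n, 0 <= inner (u n) x) -> 0 <= inner y x.
Proof.
move=> uy u0.
have E n : complex.Im (inner (u n) x) = 0 /\ 0 <= reip (u n) x.
  by have := u0 n; rewrite lecE => /andP[/eqP].
rewrite lecE; apply/andP; split.
  have := hcvg_reip uy (hcvg_cst ('i *: x)).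
  under eq_fun do rewrite -Im_inner (E _).1.
  rewrite -Im_inner => h; apply/eqP; rewrite -[LHS]/(complex.Im _).
  by apply: (cvg_unique _ h); [exact: Rhausdorff | exact: cvg_cst].
have c0 : (fun=> 0 : R) n @[n --> \oo] --> (0 : R) by exact: cvg_cst.
apply: (@ler_cvg_to _ _ _ _ _ _ _ _ c0 (hcvg_reip uy (hcvg_cst x))).
by apply: nearW => n; exact: (E n).2.
Qed.

Lemma complement_positive : positive_on M A -> positive_on M B /\
  forall z, M z -> reip (z - A z) z <= reip z z.
Proof.
move=> pA; have [lA AM _] := pA; split; last first.
  by move=> z Mz; rewrite reipBl; have := positive_reip pA Mz; lra.
split=> [a x y Mx My|x Mx|x Mx].
- by rewrite lA // opprD addrACA scalerBr.
- by apply: subspaceB => //; exact: AM.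
- rewrite innerBl; have [_ _ /(_ _ Mx)] := pA; have := A1 Mx.
  rewrite /reip inner_reip !lecE /reip.
  case: (inner (A x) x) => a b /=; rewrite subr_ge0 => -> /andP[/eqP-> _].
  by rewrite subrr eqxx.
Qed.

Lemma sqrt_exists : positive_on M A -> exists S,
  [/\ positive_on M S, forall x, M x -> S (S x) = A x &
      forall x, M x -> hcvg (fun n => x - sqrt_iter B n x) (S x)].
Proof.
move=> pA; have [pB B1] := complement_positive pA.
have Zin := sqrt_iter_in sM pB; have Zlin := sqrt_iter_linear sM pB.
have Znorm := sqrt_iter_norm sM pB B1.
have exW z : exists w, M z -> M w /\ hcvg (fun n => sqrt_iter B n z) w.
  have [Mz|] := pselect (M z); last by exists 0.
  have [w Mw zw] := closed_complete cM (fun n => Zin n _ Mz)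
    (sqrt_iter_cauchy sM pB B1 Mz).
  by exists w.
have [W hW] := choice exW.
pose S0 z := z - W z.
have WM z : M z -> M (W z) by move=> /hW[].
have ZW z : M z -> hcvg (fun n => sqrt_iter B n z) (W z) by move=> /hW[].
have lW : linear_on M W.
  move=> a y z My Mz; apply: (hcvg_unique (ZW _ (sM.2 a _ _ My Mz))).
  rewrite (_ : (fun n => _) = fun n => a *: sqrt_iter B n y + sqrt_iter B n z).
    by apply: hcvgD; [apply: hcvgZ; exact: ZW | exact: ZW].
  by apply/funext => n; rewrite Zlin.
(* The limit of the recursion, [2 W = (1 - A) + W^2], which says [(1 - W)^2 = A]. Contractivity of
   the iterates lets the limit pass through their composition. *)
have WW z : M z -> W (W z) = A z - z + (2%:C) *: W z.
  move=> Mz.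
  have h : hcvg (fun n => sqrt_iter B n (sqrt_iter B n z)) (W (W z)).
    have h1 : hcvg (fun n => sqrt_iter B n (sqrt_iter B n z - W z)) 0.
      have h0 := hcvgB (ZW _ Mz) (hcvg_cst (W z)).
      rewrite subrr in h0; apply: (hcvg_le (C := 1) h0) => n.
      by rewrite !subr0 mul1r Znorm //; apply: subspaceB => //; [exact: Zin | exact: WM].
    have := hcvgD h1 (ZW _ (WM _ Mz)); rewrite add0r.
    congr (hcvg _ _); apply/funext => n.
    by rewrite (linear_onB sM (Zlin n)) ?subrK //; [exact: Zin | exact: WM].
  have h2 : hcvg (fun n => sqrt_iter B n.+1 z) (W z).
    exact: (hcvg_sub (k := S) (leqnSn) (ZW _ Mz)).
  have h3 := hcvgZ (2^-1)%:C (hcvgD (hcvg_cst (z - A z)) h).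
  have e : W z = (2^-1)%:C *: (z - A z + W (W z)) by exact: (hcvg_unique h2 h3).
  by rewrite [in RHS]e scalerA -rmorphM /= mulfV // scale1r -[A z - z]opprB addKr.
have p0 : positive_on M S0.
  split=> [a y z My Mz|z Mz|z Mz].
  - by rewrite /S0 lW // opprD addrACA scalerBr.
  - by apply: subspaceB => //; exact: WM.
  - apply: inner_ge0_lim (hcvgB (hcvg_cst z) (ZW _ Mz)) _ => n.
    have [lZ ZM pZ] := cone_positive sM pB (cone_sqrt_iter sM pB n).
    rewrite innerBl.
    have := pZ _ Mz; have : reip (sqrt_iter B n z) z <= reip z z.
      apply: le_trans (ler_norm _) _; apply: le_trans (normr_reip _ _) _.
      by rewrite -hnorm_sqr expr2 ler_wpM2r ?hnorm_ge0 // Znorm.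
    rewrite /reip inner_reip !lecE /reip.
    case: (inner (sqrt_iter B n z) z) => a b /=; rewrite subr_ge0 => -> /andP[/eqP-> _].
    by rewrite subrr eqxx.
have S02 z : M z -> S0 (S0 z) = A z.
  move=> Mz; rewrite /S0 (linear_onB sM lW) ?WW //; last exact: WM.
  rewrite (_ : 2%:C = 1 + 1 :> R[i]); last by rewrite -[2]natr1 rmorphD.
  rewrite scalerDl scale1r opprB [A z - z + (_ + _)]addrA addrK addrACA addNr addr0.
  by rewrite addrC subrK.
by exists S0; split => // z Mz; exact: hcvgB (hcvg_cst z) (ZW _ Mz).
Qed.

Section Uniqueness.
Variable S : V -> V.
Hypotheses (pS : positive_on M S) (S2 : forall x, M x -> S (S x) = A x).

Let lS : linear_on M S. Proof. by case: pS. Qed.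
Let SM x : M x -> M (S x). Proof. by case: pS => _ h _ /h. Qed.

Lemma sqrt_contraction x : M x -> hnorm (S x) <= hnorm x.
Proof.
move=> Mx; rewrite -(@ler_pXn2r _ 2) ?nnegrE ?hnorm_ge0 // !hnorm_sqr.
by rewrite (positive_reip_sym sM pS) // ?S2 ?(reipC x) ?A1 //; exact: SM.
Qed.

Let S1 x : M x -> reip (S x) x <= reip x x.
Proof.
move=> Mx; apply: le_trans (ler_norm _) _; apply: le_trans (normr_reip _ _) _.
by rewrite -hnorm_sqr expr2 ler_wpM2r ?hnorm_ge0 // sqrt_contraction.
Qed.

Let pA : positive_on M A.
Proof.
split=> [a x y Mx My|x Mx|x Mx].
- by rewrite -!S2 ?lS //; [exact: SM | exact: SM | exact: sM.2].
- by rewrite -S2 //; do 2 apply: SM.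
- by rewrite -S2 // (positive_sym sM pS) ?inner_ge0 //; exact: SM.
Qed.

(** For [y = S x - S' x], commutation gives [(S + S') y = (S^2 - S'^2) x = 0]. Both forms then
    vanish at y, so S y = S' y = 0 by [positive_norm], and <y, y> = 0 by symmetry. *)
Lemma sqrt_unique S' : positive_on M S' -> (forall x, M x -> S' (S' x) = A x) ->
  (forall x, M x -> S (S' x) = S' (S x)) -> forall x, M x -> S x = S' x.
Proof.
move=> pS' S2' com x Mx; have [lS' SM' _] := pS'.
set y := S x - S' x.
have My : M y by apply: subspaceB => //; [exact: SM | exact: SM'].
have h : reip (S y) y + reip (S' y) y = 0.
  rewrite -reipDl /y (linear_onB sM lS) ?(linear_onB sM lS') //;
    [|exact: SM|exact: SM'|exact: SM|exact: SM'].
  by rewrite S2 // S2' // com // addrA subrK subrr reip0l.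
have Sy : S y = 0.
  apply/hnorm_eq0/eqP; rewrite -sqrf_eq0 eq_le sqr_ge0 andbT.
  apply: le_trans (positive_norm sM pS S1 My) _.
  by have := positive_reip pS My; have := positive_reip pS' My; move: h; lra.
have S1' z : M z -> reip (S' z) z <= reip z z.
  move=> Mz; apply: le_trans (ler_norm _) _; apply: le_trans (normr_reip _ _) _.
  rewrite -hnorm_sqr expr2 ler_wpM2r ?hnorm_ge0 //.
  rewrite -(@ler_pXn2r _ 2) ?nnegrE ?hnorm_ge0 // !hnorm_sqr.
  by rewrite (positive_reip_sym sM pS') // ?S2' ?(reipC z) ?A1 //; exact: SM'.
have Sy' : S' y = 0.
  apply/hnorm_eq0/eqP; rewrite -sqrf_eq0 eq_le sqr_ge0 andbT.
  apply: le_trans (positive_norm sM pS' S1' My) _.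
  by have := positive_reip pS My; have := positive_reip pS' My; move: h; lra.
apply/eqP; rewrite -subr_eq0; apply/eqP/inner_eq0.
rewrite -/y {1}/y innerBl (positive_sym sM pS) // (positive_sym sM pS') //.
by rewrite Sy Sy' subrr.
Qed.

(** Any positive root S commutes with [A = S^2], hence with the iterates and with their limit, so
    [sqrt_unique] applies. Consequently all positive roots agree and [hsqrt] is well defined. *)
Theorem sqrt_cvg x : M x -> hcvg (fun n => x - sqrt_iter B n x) (S x).
Proof.
move=> Mx; have [S' [pS' S2' cS']] := sqrt_exists pA.
have [pB _] := complement_positive pA; have [lS' SM' _] := pS'.
rewrite (_ : S x = S' x); first exact: cS'.
apply: (sqrt_unique pS') => // z Mz.
have Mu n : M (z - sqrt_iter B n z) by apply: subspaceB => //; exact: sqrt_iter_in.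
apply: (hcvg_unique (bounded_hcvg (C := 1) sM lS _ Mu (SM' _ Mz) (cS' _ Mz))).
  by move=> w Mw; rewrite mul1r sqrt_contraction.
have := cS' _ (SM Mz); congr (hcvg _ _); apply/funext => n /=.
rewrite (linear_onB sM lS) //; last exact: sqrt_iter_in.
congr (_ - _); apply/esym; apply: (sqrt_iter_intertwine (M := M)) => // w Mw.
by rewrite (linear_onB sM lS) ?S2 -?S2 //; [exact: SM | do 2 apply: SM].
Qed.

End Uniqueness.

Lemma hsqrtE S x : positive_on M S -> (forall x, M x -> S (S x) = A x) ->
  M x -> hsqrt M A x = S x.
Proof.
move=> pS S2 Mx; apply: xget_unique; first by exists S.
move=> y [S' [pS' S2' ->]].
exact: hcvg_unique (sqrt_cvg pS' S2' Mx) (sqrt_cvg pS S2 Mx).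
Qed.

(** The default value 0 is homogeneous as well, so both cases of the description are covered;
    [Delta_mult] applies this pointwise on the circle. *)
Lemma hsqrtZ a x : M x -> hsqrt M A (a *: x) = a *: hsqrt M A x.
Proof.
move=> Mx; have [[S [pS S2]]|nS] := pselect (exists S, positive_on M S /\
    forall x, M x -> S (S x) = A x).
  rewrite !(hsqrtE pS S2) //; last exact: subspaceZ.
  by case: (pS) => lS _ _; rewrite (linear_onZ sM lS).
have z y : hsqrt M A y = 0.
  by rewrite /hsqrt xgetPN // => w [S [pS S2 _]]; apply: nS; exists S.
by rewrite !z scaler0.
Qed.

Lemma hsqrt_spec : positive_on M A ->
  [/\ positive_on M (hsqrt M A), forall x, M x -> hsqrt M A (hsqrt M A x) = A x &
      forall x, M x -> hcvg (fun n => x - sqrt_iter B n x) (hsqrt M A x)].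
Proof.
move=> pA; have [S [pS S2 cS]] := sqrt_exists pA.
have E := hsqrtE pS S2; have [lS SM pp] := pS; split=> [|x Mx|x Mx].
- split=> [a x y Mx My|x Mx|x Mx].
  + by rewrite !E ?lS //; exact: sM.2.
  + by rewrite E //; exact: SM.
  + by rewrite E //; exact: pp.
- by rewrite (E _ Mx) E ?S2 //; exact: SM.
- by rewrite E //; exact: cS.
Qed.

End SquareRoot.

(** * Vector-valued square integrable functions *)

Section Measurability.
Context {R : realType}.
Local Notation mu := (circle R).
Local Notation T := (measurableTypeR R).
Implicit Types E F : innerType R.

Import HBSimple.

Lemma circleT : mu setT = 1%E.
Proof.
transitivity (lebesgue_measure ([set: R] `&` `[0%R, 1%R])) => //.
by rewrite setTI lebesgue_measure_itv /= lte_fin ltr01 oppr0 adde0.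
Qed.

Lemma sm_simple E (s : T -> E) : simple s -> strongly_measurable s.
Proof. by move=> ss; exists (fun=> s) => // t; exact: hcvg_cst. Qed.

Lemma sm_comp E F (phi : E -> F) (f : R -> E) :
  (forall u x, hcvg u x -> hcvg (phi \o u) (phi x)) ->
  strongly_measurable f -> strongly_measurable (fun t => phi (f t)).
Proof.
move=> cphi [s ss sf]; exists (fun n t => phi (s n t)) => [n|t].
  exact: (simple1 phi).
exact: cphi (sf t).
Qed.

Lemma smB E (f g : R -> E) : strongly_measurable f -> strongly_measurable g ->
  strongly_measurable (fun t => f t - g t).
Proof.
move=> sf sg; under eq_fun do rewrite -scaleN1r.
by apply: smD => //; exact: smZ.
Qed.

Lemma hcvg_scale E (a : R^nat) (b : R) (u : nat -> E) x :
  a @ \oo --> b -> hcvg u x -> hcvg (fun n => (a n)%:C *: u n) (b%:C *: x).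
Proof.
move=> ab ux; apply: (@squeeze_cvgr _ _ _ _ (fun=> 0)
  (fun n => `|a n - b| * hnorm (u n) + `|b| * hnorm (u n - x))).
- apply: nearW => n; rewrite hnorm_ge0 /= -!hnormZC; apply: le_trans (hnormD _ _).
  by rewrite scalerBr rmorphB scalerBl addrA subrK.
- exact: cvg_cst.
- rewrite -[X in _ --> X]addr0; apply: cvgD; last first.
    by rewrite -(mulr0 `|b|); apply: cvgMr; exact: ux.
  rewrite -(mul0r (hnorm x)); apply: cvgM; last exact: hcvg_norm.
  rewrite -(normr0 R) -(subrr b); apply: cvg_norm; apply: cvgB => //.
  exact: cvg_cst.
Qed.

Lemma sm_mulr E (m : T -> R) (f : R -> E) : measurable_fun setT m ->
  strongly_measurable f -> strongly_measurable (fun t => (m t)%:C *: f t).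
Proof.
move=> mm [s ss sf].
have [g gm] := approximation_sfun measurableT ((measurable_EFinP setT m).2 mm).
exists (fun n t => (g n t)%:C *: s n t) => [n|t].
  apply: (simple2 (fun (a : R) x => a%:C *: x)) => //.
apply: hcvg_scale => //.
by have /fine_cvgP[_] := gm t I.
Qed.

Definition sqint E (f : R -> E) : \bar R := (\int[mu]_t (hnorm (f t) ^+ 2)%:E)%E.

Lemma sqint_ge0 E (f : R -> E) : (0 <= sqint f)%E.
Proof. by apply: integral_ge0 => t _; rewrite lee_fin sqr_ge0. Qed.

Lemma measurable_sqnorm E (f : R -> E) : strongly_measurable f ->
  measurable_fun setT ((fun t => (hnorm (f t) ^+ 2)%:E) : T -> \bar R).
Proof.
by move=> sf; apply/measurable_EFinP; apply: measurable_funX; exact: sm_norm.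
Qed.

Lemma le_sqint E F (f : R -> E) (g : R -> F) :
  strongly_measurable f -> strongly_measurable g ->
  (\forall t \ae mu, hnorm (f t) <= hnorm (g t)) -> (sqint f <= sqint g)%E.
Proof.
move=> sf sg fg; apply: ae_ge0_le_integral => //.
- by move=> t _; rewrite lee_fin sqr_ge0.
- exact: measurable_sqnorm.
- by move=> t _; rewrite lee_fin sqr_ge0.
- exact: measurable_sqnorm.
- by apply: filterS fg => t fg _; rewrite lee_fin ler_pXn2r // nnegrE hnorm_ge0.
Qed.

Lemma eq_sqint E F (f : R -> E) (g : R -> F) :
  strongly_measurable f -> strongly_measurable g ->
  (\forall t \ae mu, hnorm (f t) = hnorm (g t)) -> sqint f = sqint g.
Proof.
move=> sf sg fg; apply/eqP; rewrite eq_le.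
by apply/andP; split; apply: le_sqint => //; apply: filterS fg => t ->.
Qed.

Lemma si_le E F (f : R -> E) (g : R -> F) : strongly_measurable f ->
  square_integrable g -> (\forall t \ae mu, hnorm (f t) <= hnorm (g t)) ->
  square_integrable f.
Proof. by move=> sf [sg ig] fg; split=> //; apply: le_lt_trans ig; exact: le_sqint. Qed.

Lemma siB E (f g : R -> E) : square_integrable f -> square_integrable g ->
  square_integrable (fun t => f t - g t).
Proof.
move=> sf sg; under eq_fun do rewrite -scaleN1r.
by apply: siD => //; exact: siZ.
Qed.

Lemma si_bounded E (f : R -> E) (C : R) : strongly_measurable f ->
  (forall t, hnorm (f t) <= C) -> square_integrable f.
Proof.
move=> sf fC; split => //; apply: (@le_lt_trans _ _ (\int[mu]_t (C ^+ 2)%:E)%E).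
  apply: ge0_le_integral => //.
  - by move=> t _; rewrite lee_fin sqr_ge0.
  - exact: measurable_sqnorm.
  - by move=> t _; rewrite lee_fin ler_pXn2r // nnegrE ?(le_trans _ (fC t)) // hnorm_ge0.
by rewrite integral_cst //= circleT mule1 ltry.
Qed.

Lemma L2_sqint E (f : L2 E) : sqint f = (hnorm f ^+ 2)%:E.
Proof.
have [sf iff] := L2_si f.
rewrite hnorm_sqr /reip L2_innerE /= /Rintegral fineK.
  by apply: eq_integral => t _; rewrite hnorm_sqr.
under eq_integral do rewrite -/(reip _ _) -hnorm_sqr.
by rewrite ge0_fin_numE // sqint_ge0.
Qed.

Lemma eq_L2of E (f g : R -> E) : (\forall t \ae mu, f t = g t) -> L2of f = L2of g.
Proof.
move=> fg; rewrite /L2of; congr xget; apply/funext => h; apply/propext.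
by split=> hh; apply: filterS2 hh fg => t -> ->.
Qed.

Lemma L2of_L2 E (f : L2 E) : L2of f = f.
Proof. by apply: L2P; apply: L2ofE; exact: L2_si. Qed.

Lemma L2of_si_ae E (g : R -> E) (f : L2 E) : (\forall t \ae mu, f t = g t) -> L2of g = f.
Proof. by move=> fg; rewrite -[RHS]L2of_L2; apply: eq_L2of; apply: filterS fg => t ->. Qed.

Lemma L2BE E (f g : L2 E) : \forall t \ae mu, (f - g : L2 E) t = f t - g t.
Proof.
have h := L2DE f (- g); have h' := L2ZE (-1) g.
by apply: filterS2 h h' => t; rewrite scaleN1r => -> ->; rewrite scaleN1r.
Qed.

(** [phi] is the sum of the functions [4^n |d_n|^2]; the bounds make their integrals at most
    [2^-(n+1)], with sum 1. Where [phi] is finite, [|d_n| <= 2^-n sqrt phi], a geometric majorant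
    used for subsequences and for completeness alike. *)
Lemma fast_decay E (d : nat -> R -> E) :
  (forall n, strongly_measurable (d n)) ->
  (forall n, (sqint (d n) <= ((4 ^+ n * 2 ^+ n.+1)^-1)%:E)%E) ->
  exists phi : T -> \bar R, [/\ measurable_fun setT phi,
    forall t, (0 <= phi t)%E, (\int[mu]_t phi t <= 1)%E &
    forall n t, ((4 ^+ n * hnorm (d n t) ^+ 2)%:E <= phi t)%E].
Proof.
move=> sd id; pose f n t : \bar R := (4 ^+ n * hnorm (d n t) ^+ 2)%:E.
have f0 n t : (0 <= f n t)%E by rewrite lee_fin; apply: mulr_ge0; [exact: exprn_ge0 | exact:
  sqr_ge0].
have mf n : measurable_fun setT (f n : T -> \bar R).
  apply/measurable_EFinP; apply: measurable_funM => //.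
  by apply: measurable_funX; exact: sm_norm.
exists (fun t => \sum_(n <oo) f n t)%E; split.
- by apply: ge0_emeasurable_sum.
- by move=> t; apply: nneseries_ge0 => n _ _; exact: f0.
- rewrite integral_nneseries //.
  have -> : 1%E = (\sum_(n <oo) ((2 ^+ n.+1)^-1)%:E)%E :> \bar R.
    have := @cvg_geometric_eseries_half R 1 0.
    move=> /(cvg_lim (@ereal_hausdorff R)); rewrite expr0 divr1 => <-.
    congr (limn _); apply/funext => n; apply: eq_bigr => k _.
    by rewrite addn1 mul1r natrX.
  apply: lee_nneseries => [n _ _|n _]; first by apply: integral_ge0.
  rewrite /f; under eq_integral do rewrite EFinM.
  rewrite ge0_integralZl_EFin ?exprn_ge0 //; last exact: measurable_sqnorm.
    apply: le_trans (lee_wpmul2l _ (id n)) _; first by rewrite lee_fin exprn_ge0.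
    by rewrite -EFinM invfM mulrA mulfV ?mul1r // expf_neq0.
  by move=> t _; rewrite lee_fin sqr_ge0.
- move=> n t; have := @nneseries_split R (fun k => f k t) 0 n.+1.
  rewrite add0n => -> //; rewrite big_nat_recr //= -[leLHS]adde0 -[leLHS]add0e -addeA.
  apply: leeD; last apply: leeD => //.
    by apply: sume_ge0.
  by apply: nneseries_ge0.
Qed.

Lemma fast_decay_ae E (d : nat -> R -> E) :
  (forall n, strongly_measurable (d n)) ->
  (forall n, (sqint (d n) <= ((4 ^+ n * 2 ^+ n.+1)^-1)%:E)%E) ->
  \forall t \ae mu, hcvg (d^~ t) 0.
Proof.
move=> sd id; have [phi [mphi phi0 iphi phib]] := fast_decay sd id.
have : mu.-integrable setT phi.
  apply/integrableP; split => //; under eq_integral do rewrite gee0_abs //.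
  by apply: le_lt_trans iphi _; exact: ltry.
move=> /(integrable_ae measurableT); apply: filterS => t /(_ I) phit.
have {}phib n : hnorm (d n t) <= Num.sqrt (fine (phi t)) * 2^-1 ^+ n.
  rewrite -(@ler_pXn2r _ 2) ?nnegrE ?hnorm_ge0 ?mulr_ge0 ?sqrtr_ge0 ?exprn_ge0 ?invr_ge0 //.
  have e : (2^-1 ^+ n) ^+ 2 = (4 ^+ n)^-1 :> R.
    by rewrite exprAC -exprVn; congr (_ ^+ _); field.
  rewrite exprMn e [X in _ <= X * _]sqr_sqrtr ?fine_ge0 // ler_pdivlMr ?exprn_gt0 //.
  by rewrite mulrC -lee_fin fineK.
apply: (@squeeze_cvgr _ _ _ _ (fun=> 0)
    (fun n => Num.sqrt (fine (phi t)) * 2^-1 ^+ n)).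
- by apply: nearW => n; rewrite subr0 hnorm_ge0 phib.
- exact: cvg_cst.
- rewrite -(mulr0 (Num.sqrt (fine (phi t)))); apply: cvgMr.
  by apply: cvg_expr; rewrite ger0_norm ?invr_ge0 // invf_lt1 // ltr1n.
Qed.

(** The bridge from L2 limits to pointwise ones. The indices are chosen one by one, fast enough for
    [fast_decay_ae]. *)
Lemma L2_ae_subseq E (u : nat -> L2 E) (f : L2 E) : hcvg u f ->
  exists k : nat -> nat, (forall n, (n <= k n)%N) /\
    \forall t \ae mu, hcvg (fun n => u (k n) t) (f t).
Proof.
move=> /hcvgP uf.
have ex n : exists k, (n <= k)%N /\ hnorm (u k - f) ^+ 2 <= (4 ^+ n * 2 ^+ n.+1)^-1.
  have p : 0 < (4 ^+ n * 2 ^+ n.+1)^-1 :> R by rewrite invr_gt0 mulr_gt0 ?exprn_gt0.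
  have [|N hN] := uf (Num.sqrt ((4 ^+ n * 2 ^+ n.+1)^-1)); first by rewrite sqrtr_gt0.
  exists (maxn n N); split; first exact: leq_maxl.
  rewrite -[leRHS](sqr_sqrtr (ltW p)) ler_pXn2r ?nnegrE ?hnorm_ge0 ?sqrtr_ge0 //.
  by rewrite ltW // hN // leq_maxr.
have [k hk] := choice ex; exists k; split=> [n|]; first by case: (hk n).
pose d n t := u (k n) t - f t.
have sd n : strongly_measurable (d n).
  by apply: smB; [case: (L2_si (u (k n))) | case: (L2_si f)].
have id n : (sqint (d n) <= ((4 ^+ n * 2 ^+ n.+1)^-1)%:E)%E.
  have [_ hn] := hk n; rewrite -lee_fin -L2_sqint in hn.
  apply: le_trans hn; apply: le_sqint => //; first by case: (L2_si (u (k n) - f)).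
  by apply: filterS (L2BE (u (k n)) f) => t ->.
apply: filterS (fast_decay_ae sd id) => t h.
by apply: (hcvg_isometry h) => n; rewrite subr0.
Qed.

Lemma simple_dense E (f : L2 E) (e : R) : 0 < e ->
  exists s : T -> E, [/\ simple s, square_integrable s & hnorm (f - L2of s) < e].
Proof.
move=> e0; have [sf iff] := L2_si f; have [s ss sc] := sf.
(* Cutting the approximants off at 2|f| keeps them simple and dominates the squared errors by
   9|f|^2, where 9 = (1 + 2)^2. Where f is nonzero the cut is eventually inactive; where f vanishes
   it gives 0. *)
pose b n t : bool := hnorm (s n t) <= 2 * hnorm (f t).
pose s' n t : E := if b n t then s n t else 0.
have nf0 t : 0 <= hnorm (f t) by exact: hnorm_ge0.
have mb n : simple (b n : T -> bool).
  have mA : measurable [set t : T | b n t].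
    have h1 := sm_norm (sm_simple (ss n)).
    have h2 : measurable_fun setT ((fun t => 2 * hnorm (f t)) : T -> R).
      by apply: measurable_funM => //; exact: sm_norm.
    have := measurable_fun_le measurableT h1 h2.
    by rewrite setTI.
  split; first exact: finite_finset.
  move=> [].
    by rewrite (_ : _ @^-1` _ = [set t : T | b n t]) //; apply/seteqP; split.
  rewrite (_ : _ @^-1` _ = ~` [set t : T | b n t]); first exact: measurableC.
  by apply/seteqP; split => t /=; [move=> -> | move/negP/negbTE].
have ss' n : simple (s' n : T -> E).
  exact: (simple2 (fun (c : bool) x => if c then x else 0) (mb n) (ss n)).
have bs' n t : hnorm (s' n t) <= 2 * hnorm (f t).
  by rewrite /s'; case: ifPn => // _; rewrite hnorm0 mulr_ge0.
have sis' n : square_integrable (s' n).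
  apply: (@si_le _ _ _ (fun t => 2%:C *: f t)); first exact: sm_simple.
    exact: siZ (L2_si f).
  by apply: aeW => t; rewrite hnormZC ger0_norm.
have cs' t : hcvg (s'^~ t) (f t).
  have [ft0|ft0] := eqVneq (hnorm (f t)) 0.
    rewrite (hnorm_eq0 ft0) (_ : s'^~ t = fun=> 0); first exact: hcvg_cst.
    apply/funext => n; apply: hnorm_eq0; apply/eqP; rewrite eq_le hnorm_ge0 andbT.
    by apply: le_trans (bs' n t) _; rewrite ft0 mulr0.
  have fp : 0 < hnorm (f t) by rewrite lt_neqAle eq_sym ft0 hnorm_ge0.
  have /hcvgP h := sc t; apply/hcvgP => e1 e10.
  have [N1 h1] := h _ e10; have [N2 h2] := h _ fp.
  exists (maxn N1 N2) => n; rewrite geq_max => /andP[n1 n2].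
  rewrite /s' /b ifT ?h1 //.
  have := hnormD (s n t - f t) (f t); rewrite subrK.
  by have := h2 _ n2; lra.
pose F n t : \bar R := (hnorm (f t - s' n t) ^+ 2)%:E.
pose G t : \bar R := (9%:E * (hnorm (f t) ^+ 2)%:E)%E.
have iG : mu.-integrable setT G.
  by apply: integrableZl => //; have [_] := (siP _).1 (L2_si f).
have mF n : measurable_fun setT (F n : T -> \bar R).
  by apply: measurable_sqnorm; apply: smB => //; exact: sm_simple.
have cF : {ae mu, forall t, setT t -> F ^~ t @ \oo --> 0%E}.
  apply: aeW => t _; apply: cvg_EFin; first exact: nearW.
  have h : hnorm (f t - s' n t) @[n --> \oo] --> (0 : R).
    by have := cs' t; rewrite /hcvg; under eq_fun do rewrite hnormB.
  rewrite (_ : _ \o _ = (fun n => hnorm (f t - s' n t) * hnorm (f t - s' n t))).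
    by rewrite -[X in _ --> X](mulr0 (0 : R)); exact: cvgM.
  by apply/funext => n; rewrite /= expr2.
have dF : {ae mu, forall t n, setT t -> (`|F n t| <= G t)%E}.
  apply: aeW => t n _; rewrite /F /G gee0_abs; last by rewrite lee_fin sqr_ge0.
  rewrite -EFinM lee_fin.
  have h : hnorm (f t - s' n t) <= 3 * hnorm (f t).
    by have := hnormD (f t) (- s' n t); have := bs' n t; rewrite hnormN; lra.
  by have := hnorm_ge0 (f t - s' n t); have := nf0 t; move: h; nra.
have [_ _] := dominated_convergence measurableT mF (@measurable_cst _ _ _ _ _ _) cF iG dF.
rewrite integral0 => /fine_cvgP[_ /cvgrPdist_lt /(_ _ (exprn_gt0 2 e0))[N _ hN]].
exists (s' N); split => //.
rewrite -(@ltr_pXn2r _ 2) ?nnegrE ?hnorm_ge0 ?ltW // -lte_fin -L2_sqint.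
rewrite (@eq_sqint _ _ _ (fun t => f t - s' N t)); last 3 first.
- by case: (L2_si (f - L2of (s' N))).
- by apply: smB => //; exact: sm_simple.
- by apply: filterS2 (L2BE f (L2of (s' N))) (L2ofE (sis' N)) => t -> ->.
have := hN N (leqnn N); rewrite /= sub0r normrN => h.
have fi : sqint (fun t => f t - s' N t) \is a fin_num.
  rewrite ge0_fin_numE ?sqint_ge0 //.
  by have [_] := siB (L2_si f) (sis' N).
rewrite -(fineK fi) lte_fin; exact: le_lt_trans (ler_norm _) h.
Qed.

End Measurability.

(** * Completeness of the vector-valued L2 space *)

Section Completeness.
Context {R : realType}.
Local Notation mu := (circle R).
Local Notation T := (measurableTypeR R).

(** Applied pointwise in the proof of completeness of L2, where the explicit rate is needed to
    integrate the error, and again to the Neumann series. *)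
Lemma geometric_limit (V : hilbertType R) (s : nat -> V) (C q : R) : 0 <= q < 1 ->
  (forall n, hnorm (s n.+1 - s n) <= C * q ^+ n) ->
  exists x, hcvg s x /\ forall n, hnorm (s n - x) <= C / (1 - q) * q ^+ n.
Proof.
move=> /andP[q0 q1] h; have C0 : 0 <= C.
  by have := le_trans (hnorm_ge0 _) (h 0%N); rewrite expr0 mulr1.
have p0 : 0 < 1 - q by rewrite subr_gt0.
pose D := C / (1 - q); have D0 : 0 <= D by rewrite divr_ge0 // ltW.
have DE : C = D * (1 - q) by rewrite /D divfK // gt_eqF.
have key n k : hnorm (s (n + k)%N - s n) <= D * q ^+ n.
  suff: hnorm (s (n + k)%N - s n) <= D * q ^+ n - D * q ^+ (n + k).
    by move=> /le_trans; apply; rewrite gerBl mulr_ge0 // exprn_ge0.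
  elim: k => [|k ih]; first by rewrite addn0 !subrr hnorm0.
  apply: le_trans (hnorm_triangle (s (n + k)%N) _ _) _; rewrite addnS.
  have := h (n + k)%N; rewrite DE; move: ih; rewrite exprS.
  move: (q ^+ (n + k)) (q ^+ n) => a b; set c := hnorm _; set d := hnorm _.
  have -> : D * (q * a) = D * a - D * (1 - q) * a by ring.
  by lra.
have z : (fun n => D * q ^+ n) @ \oo --> (0 : R).
  rewrite -(mulr0 D); apply: cvgMr.
  by apply: cvg_expr; rewrite ger0_norm.
have cs : hcauchy s.
  move=> e e0; move/cvgrPdist_lt : z => /(_ _ (divr_gt0 e0 (ltr0n _ 2)))[N _ hN].
  exists N => m n Nm Nn.
  have hh j : (N <= j)%N -> hnorm (s j - s N) < e / 2.
    move=> /subnKC <-; apply: le_lt_trans (key _ _) _.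
    by have := hN _ (leqnn N); rewrite sub0r normrN => /(le_lt_trans (ler_norm _)).
  apply: le_lt_trans (hnorm_triangle (s N) _ _) _; rewrite (hnormB (s N)).
  by rewrite [ltRHS]splitr ltrD // hh.
have [x sx] := hilbert_complete _ cs; exists x; split => // n.
have h1 : hnorm (s n - s (n + k)%N) @[k --> \oo] --> hnorm (s n - x).
  apply: hcvg_norm; apply: hcvgB; first exact: hcvg_cst.
  have := hcvg_sub (k := addn n) (leq_addl n) sx.
  by apply.
have c0 : (fun=> D * q ^+ n : R) k @[k --> \oo] --> D * q ^+ n by exact: cvg_cst.
apply: (@ler_cvg_to _ _ _ _ _ _ _ _ h1 c0).
by apply: nearW => k; rewrite hnormB.
Qed.

Variable E : hilbertType R.

(* Riesz-Fischer: along rapidly convergent simple functions the increments are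
   dominated, almost everywhere, by a geometric series. *)
Lemma L2_complete (u : nat -> L2 E) : hcauchy u -> exists x, hcvg u x.
Proof.
(* Increments of the simple approximants will be at most [3 * a n], and [(3 * a n) ^+ 2] has to stay
   below the bound required by [fast_decay]. *)
move=> cu; pose a n : R := 4^-1 ^+ n.+2.
have a0 n : 0 < a n by rewrite exprn_gt0 // invr_gt0.
have [N hN] := choice (fun n => cu _ (a0 n)).
pose k n := (\max_(i < n.+1) N i)%N.
have kS n : (k n <= k n.+1)%N by rewrite /k [X in (_ <= X)%N]big_ord_recr leq_maxl.
have Nk n : (N n <= k n)%N by exact: (leq_bigmax (ord_max : 'I_n.+1)).
(* Simple functions replace the given sequence so that their pointwise limit is strongly measurable
   by definition. *)
have exs n : exists s : T -> E, [/\ simple s, square_integrable s &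
    hnorm (u (k n) - L2of s) < a n] by exact: simple_dense.
have [s hs] := choice exs.
have ss n : simple (s n) by case: (hs n).
have sis n : square_integrable (s n) by case: (hs n).
pose v n : L2 E := L2of (s n).
have uv n : hnorm (u (k n) - v n) < a n by case: (hs n).
pose d n t := s n.+1 t - s n t.
have sd n : strongly_measurable (d n) by apply: smB; exact: sm_simple.
have id n : (sqint (d n) <= ((4 ^+ n * 2 ^+ n.+1)^-1)%:E)%E.
  rewrite (@eq_sqint _ _ _ _ (v n.+1 - v n : L2 E)) //; last 2 first.
  - by case: (L2_si (v n.+1 - v n : L2 E)).
  - apply: filterS3 (L2BE (v n.+1) (v n)) (L2ofE (sis n.+1)) (L2ofE (sis n)).
    by move=> t -> -> ->.
  rewrite L2_sqint lee_fin.
  have h : hnorm (v n.+1 - v n) <= 3 * a n.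
    apply: le_trans (hnorm_triangle (u (k n.+1)) _ _) _.
    have := hnorm_triangle (u (k n)) (u (k n.+1)) (v n).
    rewrite (hnormB (v n.+1)).
    have := uv n.+1; have := uv n; have := hN n _ _ (leq_trans (Nk n) (kS n)) (Nk n).
    have : a n.+1 <= a n by rewrite /a exprS ler_piMl ?exprn_ge0 ?invr_ge0 // invf_le1 // ler1n.
    have lr (x y z w b c : R) : c <= b -> x < b -> y < b -> z < c ->
      w <= x + y -> z + w <= 3 * b by lra.
    exact: lr.
  have e1 : 3 * a n = (3 / 16) * 4^-1 ^+ n.
    by rewrite /a !exprS; field.
  apply: (@le_trans _ _ ((3 * a n) ^+ 2)).
    by rewrite ler_pXn2r ?nnegrE ?hnorm_ge0 // mulr_ge0 // ltW.
  have -> : (4 ^+ n * 2 ^+ n.+1)^-1 = 2^-1 * (4^-1 ^+ n * 2^-1 ^+ n) :> R.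
    by rewrite exprS !exprVn; field; rewrite !expf_neq0.
  rewrite e1.
  have p : 4^-1 ^+ n <= 2^-1 ^+ n :> R.
    by rewrite lerXn2r ?nnegrE ?invr_ge0 // lef_pV2 ?posrE // ler_nat.
  have q : 0 <= 4^-1 ^+ n :> R by rewrite exprn_ge0 // invr_ge0.
  move: (4^-1 ^+ n) (2^-1 ^+ n) p q => b c p q.
  by nra.
have [phi [mphi phi0 iphi phib]] := fast_decay sd id.
pose F t : bool := (phi t < +oo)%E.
have fF t : F t -> phi t \is a fin_num by move=> h; rewrite ge0_fin_numE.
pose r t := Num.sqrt (fine (phi t)).
have dr t n : F t -> hnorm (s n.+1 t - s n t) <= r t / 2 ^+ n.
  move=> Ft; have r0 : 0 <= r t by exact: sqrtr_ge0.
  rewrite -(@ler_pXn2r _ 2) ?nnegrE ?hnorm_ge0 ?divr_ge0 ?exprn_ge0 //.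
  rewrite expr_div_n [X in _ <= X / _]sqr_sqrtr ?fine_ge0 // ler_pdivlMr ?exprn_gt0 //.
  rewrite mulrC exprAC (_ : 2 ^+ 2 = 4 :> R); last by rewrite -natrX.
  by rewrite -lee_fin fineK ?fF //; exact: (phib n t).
(* Strong measurability asks for convergence at every point, so the sequence is set to 0 off the
   full-measure set where [phi] is finite. *)
pose s' n t : E := if F t then s n t else 0.
have exg t : exists x, hcvg (s'^~ t) x /\
    forall n, hnorm (s' n t - x) <= (if F t then 2 * r t / 2 ^+ n else 0).
  rewrite /s'; case: (boolP (F t)) => Ft; last first.
    by exists 0; split=> [|n]; [exact: hcvg_cst | rewrite subrr hnorm0].
  have [||x [sx hx]] := @geometric_limit E (s^~ t) (r t) 2^-1.
  - by rewrite invr_ge0 ler0n /= invf_lt1 // ltr1n.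
  - by move=> n; rewrite exprVn; exact: dr.
  exists x; split => // n; apply: le_trans (hx n) _.
  by rewrite exprVn le_eqVlt; apply/orP; left; apply/eqP; field; rewrite expf_neq0.
have [g hg] := choice exg.
have sF : simple (F : T -> bool).
  have mA : measurable [set t : T | F t].
    rewrite -[X in measurable X]setTI.
    by apply: (measurable_lte measurableT).
  split; first exact: finite_finset.
  move=> [].
    by rewrite (_ : _ @^-1` _ = [set t : T | F t]) //; apply/seteqP; split.
  rewrite (_ : _ @^-1` _ = ~` [set t : T | F t]); first exact: measurableC.
  by apply/seteqP; split => t /=; [move=> -> | move/negP/negbTE].
have ss' n : simple (s' n : T -> E).
  exact: (simple2 (fun (c : bool) x => if c then x else 0) sF (ss n)).
have aeF : \forall t \ae mu, F t.
  have : mu.-integrable setT phi.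
    apply/integrableP; split => //; under eq_integral do rewrite gee0_abs //.
    by apply: le_lt_trans iphi _; exact: ltry.
  move=> /(integrable_ae measurableT); apply: filterS => t /(_ I).
  by rewrite ge0_fin_numE.
have mg : strongly_measurable g by exists s' => // t; case: (hg t).
have sg n : (sqint (fun t => s' n t - g t)%R <= (4 * 4^-1 ^+ n)%:E)%E.
  apply: (@le_trans _ _ (\int[mu]_t ((4 * 4^-1 ^+ n)%:E * phi t))%E).
    apply: ge0_le_integral => //.
    - by move=> t _; rewrite lee_fin sqr_ge0.
    - by apply: measurable_sqnorm; apply: smB => //; exact: sm_simple.
    - exact: measurable_funeM.
    - move=> t _; have [_ /(_ n)] := hg t; case: ifPn => Ft h.
        rewrite -(fineK (fF _ Ft)) -EFinM lee_fin.
        have r0 : 0 <= r t by exact: sqrtr_ge0.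
        apply: (@le_trans _ _ ((2 * r t / 2 ^+ n) ^+ 2)).
          by rewrite ler_pXn2r ?nnegrE ?hnorm_ge0 // divr_ge0 ?mulr_ge0 // exprn_ge0.
        rewrite expr_div_n exprMn [r t ^+ 2]sqr_sqrtr ?fine_ge0 // exprAC.
        rewrite (_ : 2 ^+ 2 = 4 :> R); last by rewrite -natrX.
        by rewrite exprVn mulrAC.
      have -> : hnorm (s' n t - g t) = 0 by apply/eqP; rewrite eq_le h hnorm_ge0.
      rewrite expr0n mule_ge0 // lee_fin mulr_ge0 // exprn_ge0 // invr_ge0 //.
  have p : 0 <= 4 * 4^-1 ^+ n :> R by rewrite mulr_ge0 // exprn_ge0 // invr_ge0.
  by rewrite ge0_integralZl_EFin // -[leRHS]mule1 lee_wpmul2l.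
have sis' n : square_integrable (s' n).
  apply: si_le (sis n) _; first exact: sm_simple.
  by apply: filterS aeF => t; rewrite /s' => ->.
have sig : square_integrable g.
  have h0 : square_integrable (fun t => s' 0%N t - g t).
    split; first by apply: smB => //; exact: sm_simple.
    by apply: le_lt_trans (sg 0%N) _; exact: ltry.
  have := siB (sis' 0%N) h0; congr square_integrable.
  by apply/funext => t; rewrite subKr.
exists (L2of g).
have vg n : hnorm (v n - L2of g) <= 2 * 2^-1 ^+ n.
  rewrite -(@ler_pXn2r _ 2) ?nnegrE ?hnorm_ge0 ?mulr_ge0 ?exprn_ge0 ?invr_ge0 //.
  rewrite -lee_fin -L2_sqint (@eq_sqint _ _ _ _ (fun t => s' n t - g t)).
  - apply: le_trans (sg n) _; rewrite lee_fin le_eqVlt; apply/orP; left; apply/eqP.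
    rewrite exprMn exprAC; congr (_ * _ ^+ _); last by field.
    by rewrite -natrX.
  - by case: (L2_si (v n - L2of g : L2 E)).
  - by apply: smB => //; exact: sm_simple.
  - apply: (aeS4 _ (L2BE (v n) (L2of g)) aeF (L2ofE (sis n)) (L2ofE sig)) => t -> Ft e1 e2.
    by rewrite e1 e2 /s' Ft.
apply/hcvgP => e e0.
have z : (fun n => 2 * 2^-1 ^+ n) @ \oo --> (0 : R).
  rewrite -(mulr0 2); apply: cvgMr.
  by apply: cvg_expr; rewrite ger0_norm ?invr_ge0 // invf_lt1 // ltr1n.
have za : a @ \oo --> (0 : R).
  rewrite (_ : a = fun n => 4^-1 ^+ 2 * 4^-1 ^+ n).
    rewrite -(mulr0 (4^-1 ^+ 2)); apply: cvgMr.
    by apply: cvg_expr; rewrite ger0_norm ?invr_ge0 // invf_lt1 // ltr1n.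
  by apply/funext => n; rewrite /a -exprD add2n.
have e3 : 0 < e / 3 by rewrite divr_gt0.
move/cvgrPdist_lt : z => /(_ _ e3)[N1 _ h1].
move/cvgrPdist_lt : za => /(_ _ e3)[N2 _ h2].
pose n := maxn N1 N2.
have {}h1 : 2 * 2^-1 ^+ n < e / 3.
  by have := h1 n (leq_maxl _ _); rewrite sub0r normrN => /(le_lt_trans (ler_norm _)).
have {}h2 : a n < e / 3.
  by have := h2 n (leq_maxr _ _); rewrite /= sub0r normrN => /(le_lt_trans (ler_norm _)).
exists (k n) => m km.
have := hnorm_triangle (u (k n)) (u m) (L2of g).
have := hnorm_triangle (v n) (u (k n)) (L2of g).
have := vg n; have := uv n; have := hN n _ _ (leq_trans (Nk n) km) (Nk n).
have lr (x y z w y' b c : R) : x < c -> y < c -> y' <= z -> z < e / 3 -> c < e / 3 ->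
  b <= x + w -> w <= y + y' -> b < e by lra.
by move=> i1 i2 i3 i4 i5; exact: lr i1 i2 i3 h1 h2 i5 i4.
Qed.

HB.instance Definition _ := Inner_isComplete.Build R (L2 E) L2_complete.

End Completeness.

(** * Fourier series on the circle *)

Section Circle.
Context {R : realType}.
Local Notation mu := (circle R).
Local Notation lambda := (@lebesgue_measure R).
Local Notation T := (measurableTypeR R).

Lemma circleE (A : set T) : mu A = lambda (A `&` `[0%R, 1%R]).
Proof. by []. Qed.

Lemma aeI (P Q : R -> Prop) : (\forall t \ae mu, P t) ->
  (\forall t \ae mu, Q t) -> \forall t \ae mu, P t /\ Q t.
Proof. by move=> hP hQ; apply: filterS2 hP hQ. Qed.

Lemma ae_lebesgue_circle (P : R -> Prop) :
  (\forall t \ae lambda, P t) -> \forall t \ae mu, P t.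
Proof.
move=> [N [mN N0 PN]]; exists N; split=> //.
apply/eqP; rewrite eq_le measure_ge0 andbT -N0.
by apply: le_measure; rewrite ?inE //; exact: measurableI.
Qed.

Lemma ae_circle (P : R -> Prop) :
  (forall t, 0 <= t <= 1 -> P t) -> \forall t \ae mu, P t.
Proof.
move=> h; exists (~` `[0%R, 1%R]%classic); split.
- exact: measurableC.
- by rewrite circleE setICl measure0.
- by move=> t /= nP t01; apply: nP; apply: h; move: t01; rewrite /= in_itv.
Qed.

Lemma ae_circle_neq (a : R) : \forall t \ae mu, t != a.
Proof.
apply: ae_lebesgue_circle; exists [set a]; split=> //.
  exact: lebesgue_measure_set1.
by move=> t /= /negP; rewrite negbK => /eqP.
Qed.

Lemma integral_circle (f : T -> \bar R) : measurable_fun setT f ->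
  (\int[mu]_t f t = \int[lambda]_(t in `[0%R, 1%R]) f t)%E.
Proof.
move=> mf; pose D : set T := `[0%R, 1%R]%classic.
have mD : measurable D by exact: measurable_itv.
rewrite (ae_eq_integral (f \_ D)) //.
- rewrite -integral_mkcond; apply: eq_measure_integral => A mA AD.
  by rewrite circleE setIidl.
- by apply/(measurable_restrictT _ mD); exact: measurable_funS mf.
- by apply: ae_circle => t t01 _; rewrite patchE mem_set.
Qed.

Lemma zetaD (s t : R) : zeta (s + t) = zeta s * zeta t.
Proof.
rewrite /zeta mulrDr cosD sinD; congr (_ +i* _).
by rewrite addrC.
Qed.

Lemma zeta_unit (t : R) : zeta t * (zeta t)^*%R = 1.
Proof.
rewrite /zeta /=; apply/eqP; rewrite eq_complex /=.
by rewrite !mulrN opprK -!expr2 cos2Dsin2 eqxx [sin _ * _]mulrC addNr eqxx.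
Qed.

Lemma zeta_neq0 (t : R) : zeta t != 0.
Proof. by apply/eqP => z0; have /eqP := zeta_unit t; rewrite z0 mul0r eq_sym oner_eq0. Qed.

Lemma zeta_conj (t : R) : (zeta t)^*%R = (zeta t)^-1.
Proof. by apply: (mulfI (zeta_neq0 t)); rewrite zeta_unit mulfV // zeta_neq0. Qed.

Lemma zeta0 : zeta (0 : R) = 1.
Proof. by rewrite /zeta mulr0 cos0 sin0. Qed.

Lemma zetaX (t : R) (k : int) : zeta t ^ k = zeta (k%:~R * t).
Proof.
have E n : zeta t ^+ n = zeta (n%:R * t).
  elim: n => [|n ih]; first by rewrite mul0r zeta0.
  by rewrite exprS ih -zetaD -natr1 mulrDl mul1r addrC.
case: k => n; first by rewrite -exprnP E.
apply: (mulfI (expf_neq0 n.+1 (zeta_neq0 t))).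
rewrite NegzE -exprnN mulfV ?expf_neq0 ?zeta_neq0 // E -zetaD.
by rewrite mulrNz mulNr subrr zeta0.
Qed.

Lemma zetaX_conj (t : R) (k : int) : (zeta t ^ k)^*%R = zeta t ^ (- k).
Proof.
rewrite !zetaX mulrNz mulNr zeta_conj.
apply: (mulfI (zeta_neq0 (k%:~R * t))); rewrite -zetaD subrr zeta0.
by rewrite mulfV // zeta_neq0.
Qed.

Lemma zetaX_unit (t : R) (k : int) : zeta t ^ k * (zeta t ^ k)^*%R = 1.
Proof. by rewrite zetaX zeta_unit. Qed.

Lemma zeta_int (k : int) : zeta (k%:~R : R) = 1.
Proof.
rewrite -[k%:~R]mulr1 -zetaX /zeta mulr1 mulr_natl cos2pi sin2pi.
by rewrite exp1rz.
Qed.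

Lemma continuous_mul (c : R) (f : R -> R) : continuous f -> continuous (fun t => f (c * t)).
Proof.
move=> cf x; apply: (@continuous_comp _ _ _ (fun t => c * t) f); last exact: cf.
by apply: cvgMr; exact: cvg_id.
Qed.

Lemma measurable_cosM (c : R) : measurable_fun setT ((fun t => cos (c * t)) : T -> R).
Proof.
by apply: continuous_measurable_fun; apply: continuous_mul; exact: continuous_cos.
Qed.

Lemma measurable_sinM (c : R) : measurable_fun setT ((fun t => sin (c * t)) : T -> R).
Proof.
by apply: continuous_measurable_fun; apply: continuous_mul; exact: continuous_sin.
Qed.

Lemma integral_FTC (F f : R -> R) : continuous f ->
  (forall x : R, is_derive x (1 : R) F (f x)) ->
  (\int[lambda]_(t in `[0%R, 1%R]) (f t)%:E = (F 1 - F 0)%:E)%E.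
Proof.
move=> cf dF; rewrite (@continuous_FTC2 _ f F) //.
- exact: continuous_subspaceT.
- have cF : continuous F.
    by move=> x; apply: differentiable_continuous; apply/derivable1_diffP; case: (dF x).
  split.
  + by move=> x _; case: (dF x).
  + by apply: cvg_at_right_filter; exact: cF.
  + by apply: cvg_at_left_filter; exact: cF.
- by move=> x _; rewrite derive1E; exact: (@derive_val _ _ _ _ _ _ _ (dF x)).
Qed.

Lemma integral_zeta (k : int) : k != 0 ->
  circle_integral (fun t : R => zeta t ^ k) = 0.
Proof.
move=> k0; pose c : R := 2 * pi * k%:~R.
have c0 : c != 0 by rewrite !mulf_neq0 ?intr_eq0 // gt_eqF // pi_gt0.
have E t : zeta t ^ k = cos (c * t) +i* sin (c * t).
  by rewrite zetaX /zeta mulrA.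
have z1 : zeta (k%:~R : R) = 1 by exact: zeta_int.
have [c1 s1] : cos c = 1 /\ sin c = 0.
  by move: z1; rewrite /zeta -/c => -[].
have dc x : is_derive x (1 : R) (fun t : R => c * t) (c *: 1).
  exact: is_deriveZ.
rewrite /circle_integral; congr (_ +i* _); rewrite /Rintegral.
- under eq_integral do rewrite E /=.
  rewrite integral_circle; last first.
    by apply/measurable_EFinP; exact: measurable_cosM.
  have d x : is_derive x (1 : R) (fun t => c^-1 * sin (c * t)) (cos (c * x)).
    have ds := is_derive1_comp (is_derive_sin (c * x)) (dc x).
    by apply: (@is_derive_eq _ _ _ _ _ _ _ _ (is_deriveZ c^-1 ds)); rewrite /GRing.scale /=; field.
  rewrite (integral_FTC _ d) /=; last by apply: continuous_mul; exact: continuous_cos.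
  by rewrite mulr1 mulr0 sin0 s1 !mulr0 subrr.
- under eq_integral do rewrite E /=.
  rewrite integral_circle; last first.
    by apply/measurable_EFinP; exact: measurable_sinM.
  have d x : is_derive x (1 : R) (fun t => - c^-1 * cos (c * t)) (sin (c * x)).
    have ds := is_derive1_comp (is_derive_cos (c * x)) (dc x).
    by apply: (@is_derive_eq _ _ _ _ _ _ _ _ (is_deriveZ (- c^-1) ds)); rewrite /GRing.scale
      /=; field.
  rewrite (integral_FTC _ d) /=; last by apply: continuous_mul; exact: continuous_sin.
  by rewrite mulr1 mulr0 cos0 c1 subrr.
Qed.

Lemma circle_integral_cst (z : R[i]) : circle_integral (fun=> z) = z.
Proof.
rewrite /circle_integral /Rintegral !integral_cst //= circleT !mule1 /=.
by rewrite -complex_eta.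
Qed.

Lemma circle_integralMr (F : R -> R[i]) (c : R[i]) :
  mu.-integrable setT (EFin \o (fun t => complex.Re (F t))) ->
  mu.-integrable setT (EFin \o (fun t => complex.Im (F t))) ->
  circle_integral (fun t => F t * c) = circle_integral F * c.
Proof.
case: c => a b rF iF.
have Zr (f : R -> R) (e : R) : mu.-integrable setT (EFin \o f) ->
    mu.-integrable setT (EFin \o (fun t => f t * e)).
  move=> h; rewrite (_ : _ \o _ = fun t => ((f t)%:E * e%:E)%E) //.
  exact: integrableZr.
have ReM t : complex.Re (F t * (a +i* b)) =
    complex.Re (F t) * a - complex.Im (F t) * b by case: (F t).
have ImM t : complex.Im (F t * (a +i* b)) =
    complex.Re (F t) * b + complex.Im (F t) * a by case: (F t).
rewrite /circle_integral [RHS]/=; congr (_ +i* _).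
  under eq_Rintegral do rewrite ReM.
  by rewrite RintegralB ?RintegralZr //; exact: Zr.
under eq_Rintegral do rewrite ImM.
by rewrite RintegralD ?RintegralZr //; exact: Zr.
Qed.

Lemma bounded_integrable (f : T -> R) (C : R) : measurable_fun setT f ->
  (forall t, `|f t| <= C) -> mu.-integrable setT (EFin \o f).
Proof.
move=> mf fC; apply: measurable_bounded_integrable => //.
  by rewrite [X in (X < _)%E]circleT ltry.
by exists C; split; [exact: num_real | move=> x /ltW Cx t _; exact: le_trans Cx].
Qed.

Lemma zetaX_integrable_Re (k : int) :
  mu.-integrable setT (EFin \o (fun t : R => complex.Re (zeta t ^ k))).
Proof.
apply: (@bounded_integrable _ 1); last first.
  by move=> t; rewrite zetaX /= ler_norml cos_geN1 cos_le1.
under eq_fun do rewrite zetaX /= mulrA.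
exact: measurable_cosM.
Qed.

Lemma zetaX_integrable_Im (k : int) :
  mu.-integrable setT (EFin \o (fun t : R => complex.Im (zeta t ^ k))).
Proof.
apply: (@bounded_integrable _ 1); last first.
  by move=> t; rewrite zetaX /= ler_norml sin_geN1 sin_le1.
under eq_fun do rewrite zetaX /= mulrA.
exact: measurable_sinM.
Qed.

End Circle.

(** * Multiplication by powers of zeta and orthogonality of monomials *)

Section FourierBasis.
Context {R : realType} {E : innerType R}.
Local Notation mu := (circle R).
Implicit Types f g : L2 E.

Lemma sm_zetaX (k : int) (f : R -> E) : strongly_measurable f ->
  strongly_measurable (fun t => zeta t ^ k *: f t).
Proof.
move=> sf; pose c : R := 2 * pi * k%:~R.
have -> : (fun t => zeta t ^ k *: f t) =
    (fun t => (cos (c * t))%:C *: f t + (sin (c * t))%:C *: ('i *: f t)).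
  apply/funext => t; rewrite scalerA -scalerDl zetaX /zeta -mulrA -/c.
  congr (_ *: _); rewrite mulrA -/c /=; apply/eqP; rewrite eq_complex /=.
  by rewrite /c -!mulrA !mulr0 !mulr1 subr0 !addr0 add0r !eqxx.
apply: smD; first by apply: sm_mulr => //; exact: measurable_cosM.
by apply: sm_mulr; [exact: measurable_sinM | exact: smZ].
Qed.

Lemma si_zetaX (k : int) (f : R -> E) : square_integrable f ->
  square_integrable (fun t => zeta t ^ k *: f t).
Proof.
move=> sf; apply: (si_le _ sf); first by case: sf => sf _; exact: sm_zetaX.
by apply: aeW => t; rewrite hnormZ_unit // zetaX_unit.
Qed.

Definition zmul (k : int) f : L2 E := L2of (fun t => zeta t ^ k *: f t).

Lemma zmulE k f : \forall t \ae mu, zmul k f t = zeta t ^ k *: f t.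
Proof. exact/L2ofE/si_zetaX/L2_si. Qed.

Lemma zmul_linear k a f g : zmul k (a *: f + g) = a *: zmul k f + zmul k g.
Proof.
apply: L2P.
have h1 := zmulE k (a *: f + g); have h2 := aeI (L2DE (a *: f) g) (L2ZE a f).
have h3 := aeI (zmulE k f) (zmulE k g).
have h4 := aeI (L2DE (a *: zmul k f) (zmul k g)) (L2ZE a (zmul k f)).
apply: (aeS4 _ h1 h2 h3 h4) => t -> [-> ->] [e1 e2] [-> ->].
by rewrite e1 e2 scalerDr !scalerA mulrC.
Qed.

Lemma zmulA j k f : zmul j (zmul k f) = zmul (j + k) f.
Proof.
apply: L2P; apply: filterS3 (zmulE j (zmul k f)) (zmulE k f) (zmulE (j + k) f).
by move=> t -> -> ->; rewrite scalerA -expfzDr // zeta_neq0.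
Qed.

Lemma zmul0 f : zmul 0 f = f.
Proof. by apply: L2P; apply: filterS (zmulE 0 f) => t ->; rewrite expr0z scale1r. Qed.

Lemma zmulK k f : zmul k (zmul (- k) f) = f.
Proof. by rewrite zmulA subrr zmul0. Qed.

Lemma zmul1E f : mult (fun t x => zeta t *: x) f = zmul 1 f.
Proof. by rewrite /mult /zmul; under [in RHS]eq_fun do rewrite expr1z. Qed.

Lemma eq_circle_integral (F G : R -> R[i]) :
  mu.-integrable setT (EFin \o (fun t => complex.Re (F t))) ->
  mu.-integrable setT (EFin \o (fun t => complex.Im (F t))) ->
  mu.-integrable setT (EFin \o (fun t => complex.Re (G t))) ->
  mu.-integrable setT (EFin \o (fun t => complex.Im (G t))) ->
  (\forall t \ae mu, F t = G t) -> circle_integral F = circle_integral G.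
Proof.
move=> rF iF rG iG FG; rewrite /circle_integral; congr (_ +i* _).
  by apply: Rintegral_ae => //; apply: filterS FG => t ->.
by apply: Rintegral_ae => //; apply: filterS FG => t ->.
Qed.

Lemma si_integrable (f g : R -> E) : square_integrable f -> square_integrable g ->
  mu.-integrable setT (EFin \o (fun t => complex.Re (inner (f t) (g t)))) /\
  mu.-integrable setT (EFin \o (fun t => complex.Im (inner (f t) (g t)))).
Proof.
move=> sf sg; split; first exact: si_reip.
rewrite (_ : _ \o _ = fun t => (reip (f t) ('i *: g t))%:E).
  exact: si_reip sf (siZ _ sg).
by apply/funext => t /=; rewrite Im_inner.
Qed.

Lemma inner_L2of (f g : R -> E) : square_integrable f -> square_integrable g ->
  inner (L2of f) (L2of g) = circle_integral (fun t => inner (f t) (g t)).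
Proof.
move=> sf sg; have [r1 i1] := si_integrable sf sg.
have [r2 i2] := si_integrable (L2_si (L2of f)) (L2_si (L2of g)).
apply: eq_circle_integral => //.
by apply: filterS2 (L2ofE sf) (L2ofE sg) => t -> ->.
Qed.

Lemma inner_L2_ae (f g f' g' : L2 E) :
  (\forall t \ae mu, inner (f t) (g t) = inner (f' t) (g' t)) ->
  inner f g = inner f' g'.
Proof.
move=> e; have [r1 i1] := si_integrable (L2_si f) (L2_si g).
have [r2 i2] := si_integrable (L2_si f') (L2_si g').
exact: eq_circle_integral.
Qed.

Lemma inner_zmul k f g : inner (zmul k f) (zmul k g) = inner f g.
Proof.
apply: inner_L2_ae; apply: filterS2 (zmulE k f) (zmulE k g) => t -> ->.
by rewrite innerZl innerZr mulrA zetaX_unit mul1r.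
Qed.

Lemma inner_zmull k f g : inner (zmul k f) g = inner f (zmul (- k) g).
Proof. by rewrite -[in LHS](zmulK k g) inner_zmul. Qed.

Lemma hnorm_zmul k f : hnorm (zmul k f) = hnorm f.
Proof. by rewrite /hnorm inner_zmul. Qed.

Lemma si_cst (x : E) : square_integrable (fun=> x).
Proof. exact: (si_bounded (C := hnorm x) (sm_cst x)). Qed.

Definition monomial (k : int) (x : E) : L2 E := L2of (fun t => zeta t ^ k *: x).

Lemma monomialE k x : \forall t \ae mu, monomial k x t = zeta t ^ k *: x.
Proof. exact/L2ofE/si_zetaX/si_cst. Qed.

Lemma zmul_monomial j k x : zmul j (monomial k x) = monomial (j + k) x.
Proof.
apply: L2P; apply: filterS3 (zmulE j (monomial k x)) (monomialE k x) (monomialE (j + k) x).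
by move=> t -> -> ->; rewrite scalerA -expfzDr // zeta_neq0.
Qed.

Lemma monomial_linear k a x y :
  monomial k (a *: x + y) = a *: monomial k x + monomial k y.
Proof.
apply: L2P.
have h1 := aeI (L2DE (a *: monomial k x) (monomial k y)) (L2ZE a (monomial k x)).
apply: (aeS4 _ h1 (monomialE k (a *: x + y)) (monomialE k x) (monomialE k y)).
by move=> t [-> ->] -> -> ->; rewrite scalerDr !scalerA mulrC.
Qed.

Lemma monomial_linear_on k : linear_on setT (monomial k).
Proof. by move=> a x y _ _; exact: monomial_linear. Qed.

Lemma monomialZ k a x : monomial k (a *: x) = a *: monomial k x.
Proof. exact: (linear_onZ (subspaceT E) (monomial_linear_on k)). Qed.

Lemma monomialD k x y : monomial k (x + y) = monomial k x + monomial k y.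
Proof. exact: (linear_onD (monomial_linear_on k)). Qed.

Lemma zmul_linear_on k : linear_on setT (zmul k).
Proof. by move=> a x y _ _; exact: zmul_linear. Qed.

Lemma zmulD k f g : zmul k (f + g) = zmul k f + zmul k g.
Proof. exact: (linear_onD (zmul_linear_on k)). Qed.

Lemma zmulB k f g : zmul k (f - g) = zmul k f - zmul k g.
Proof. exact: (linear_onB (subspaceT _) (zmul_linear_on k)). Qed.

Lemma zmul_hcvg k (u : nat -> L2 E) f : hcvg u f -> hcvg (zmul k \o u) (zmul k f).
Proof.
move=> uf; apply: (hcvg_isometry uf) => n.
by rewrite /= -zmulB hnorm_zmul.
Qed.

Lemma inner_monomial j k x y :
  inner (monomial j x) (monomial k y) = if j == k then inner x y else 0.
Proof.
rewrite -[monomial j x](_ : zmul k (monomial (j - k) x) = _); last first.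
  by rewrite zmul_monomial addrC subrK.
rewrite -[monomial k y](_ : zmul k (monomial 0 y) = _); last first.
  by rewrite zmul_monomial addr0.
rewrite inner_zmul inner_L2of; [|exact/si_zetaX/si_cst|exact/si_zetaX/si_cst].
have [->|jk] := eqVneq j k.
  rewrite -[RHS]circle_integral_cst; congr circle_integral; apply/funext => t.
  by rewrite subrr !expr0z !scale1r.
have jk0 : j - k != 0 by rewrite subr_eq0.
rewrite -(mul0r (inner x y)) -(integral_zeta jk0) -circle_integralMr.
- by congr circle_integral; apply/funext => t; rewrite expr0z scale1r innerZl.
- exact: zetaX_integrable_Re.
- exact: zetaX_integrable_Im.
Qed.

Lemma inner_zmul_monomial j k f x :
  inner (zmul j f) (monomial k x) = inner f (monomial (k - j) x).
Proof. by rewrite inner_zmull zmul_monomial addrC. Qed.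

Lemma hnorm_monomial k x : hnorm (monomial k x) = hnorm x.
Proof. by rewrite /hnorm inner_monomial eqxx. Qed.

End FourierBasis.

(** * Indicator functions of arcs as limits of trigonometric polynomials *)

Section Multipliers.
Context {R : realType} {E : innerType R}.
Local Notation mu := (circle R).
Local Notation T := (measurableTypeR R).
Implicit Types (f : L2 E) (m : T -> R).

Definition null_coefficients f : Prop := forall (k : int) x, inner f (monomial k x) = 0.

Definition rmul m f : L2 E := L2of (fun t => (m t)%:C *: f t).

Lemma si_rmul m (C : R) (f : R -> E) : measurable_fun setT m ->
  (forall t, `|m t| <= C) -> square_integrable f ->
  square_integrable (fun t => (m t)%:C *: f t).
Proof.
move=> mm mC sf; apply: (si_le _ (siZ C%:C sf)).
  by apply: sm_mulr => //; case: sf.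
apply: aeW => t; rewrite !hnormZC ler_wpM2r ?hnorm_ge0 //.
exact: le_trans (mC t) (ler_norm _).
Qed.

(* Bounded functions whose multiplication operator preserves the space of functions
   with vanishing Fourier coefficients: an algebra closed under bounded pointwise
   limits, hence containing indicator functions of arcs. *)
Definition multiplier m : Prop :=
  [/\ measurable_fun setT m, exists C, forall t, `|m t| <= C &
      forall f, null_coefficients f -> null_coefficients (rmul m f)].

Lemma rmulE m f : multiplier m -> \forall t \ae mu, rmul m f t = (m t)%:C *: f t.
Proof. by move=> [mm [C mC] _]; apply: L2ofE; exact: si_rmul mC (L2_si f). Qed.

Lemma null_coefficientsD a f g : null_coefficients f -> null_coefficients g ->
  null_coefficients (a *: f + g).
Proof. by move=> hf hg k x; rewrite innerDl innerZl hf hg mulr0 addr0. Qed.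

Lemma null_coefficients_zmul k f : null_coefficients f -> null_coefficients (zmul k f).
Proof. by move=> hf j x; rewrite inner_zmul_monomial hf. Qed.

Lemma rmul_of m f (g : L2 E) : (\forall t \ae mu, (m t)%:C *: f t = g t) -> rmul m f = g.
Proof. by move=> h; apply: L2of_si_ae; apply: filterS h => t ->. Qed.

Lemma multiplier_cst (c : R) : multiplier (fun=> c).
Proof.
split; [exact: measurable_cst | by exists `|c| |] => f hf.
rewrite (rmul_of (g := c%:C *: f + 0)); first exact: null_coefficientsD (fun _ _ => inner0l _).
by rewrite addr0; apply: filterS (L2ZE c%:C f) => t ->.
Qed.

Lemma multiplierD m1 m2 : multiplier m1 -> multiplier m2 ->
  multiplier (fun t => m1 t + m2 t).
Proof.
move=> M1 M2; have [mm1 [C1 b1] h1] := M1; have [mm2 [C2 b2] h2] := M2.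
split; [exact: measurable_funD | |move=> f hf].
  by exists (C1 + C2) => t; apply: le_trans (ler_normD _ _) _; exact: lerD.
rewrite (rmul_of (g := 1 *: rmul m1 f + rmul m2 f)).
  by apply: null_coefficientsD; [exact: h1 | exact: h2].
rewrite scale1r; apply: filterS3 (L2DE (rmul m1 f) (rmul m2 f)) (rmulE f M1) (rmulE f M2).
by move=> t -> -> ->; rewrite rmorphD scalerDl.
Qed.

Lemma multiplierM m1 m2 : multiplier m1 -> multiplier m2 ->
  multiplier (fun t => m1 t * m2 t).
Proof.
move=> M1 M2; have [mm1 [C1 b1] h1] := M1; have [mm2 [C2 b2] h2] := M2.
split; [exact: measurable_funM | |move=> f hf].
  exists (C1 * C2) => t; rewrite normrM.
  by apply: ler_pM.
rewrite (rmul_of (g := rmul m1 (rmul m2 f))); first exact/h1/h2.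
apply: filterS2 (rmulE (rmul m2 f) M1) (rmulE f M2).
by move=> t -> ->; rewrite rmorphM scalerA.
Qed.

Lemma multiplierX m n : multiplier m -> multiplier (fun t => m t ^+ n).
Proof.
move=> M; elim: n => [|n ih].
  by under eq_fun do rewrite expr0; exact: multiplier_cst.
by under eq_fun do rewrite exprS; exact: multiplierM.
Qed.

Lemma multiplierZ (c : R) m : multiplier m -> multiplier (fun t => c * m t).
Proof. exact: multiplierM (multiplier_cst c). Qed.

Lemma multiplierB m1 m2 : multiplier m1 -> multiplier m2 ->
  multiplier (fun t => m1 t - m2 t).
Proof.
move=> M1 M2; under eq_fun do rewrite -mulN1r.
by apply: multiplierD => //; exact: multiplierZ.
Qed.

(** Dominated convergence with majorant (2C)^2 |f|^2 makes the products with f converge in L2, and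
    Fourier coefficients are continuous there. *)
Lemma multiplier_lim (m_ : nat -> T -> R) m (C : R) : (forall n, multiplier (m_ n)) ->
  (forall n t, `|m_ n t| <= C) -> (forall t, m_ ^~ t @ \oo --> m t) -> multiplier m.
Proof.
move=> M_ bm cm.
have mm : measurable_fun setT m.
  apply: (@measurable_fun_cvg _ _ _ _ m_) => [n|t _]; [by case: (M_ n) | exact: cm].
have bm' t : `|m t| <= C.
  have h1 : (fun n => `|m_ n t|) @ \oo --> `|m t| by apply: cvg_norm; exact: cm.
  have h2 : (fun=> C) n @[n --> \oo] --> C by exact: cvg_cst.
  by apply: (@ler_cvg_to _ _ _ _ _ _ _ _ h1 h2); apply: nearW => n; exact: bm.
have M_m n : measurable_fun setT (m_ n) by case: (M_ n).
split => //; first by exists C.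
move=> f hf k x.
have sif := L2_si f.
pose F n t : \bar R := (hnorm ((m_ n t - m t)%:C *: f t) ^+ 2)%:E.
pose G t : \bar R := (((2 * C) ^+ 2)%:E * (hnorm (f t) ^+ 2)%:E)%E.
have sF n : strongly_measurable (fun t => (m_ n t - m t)%:C *: f t).
  by apply: sm_mulr; [exact: measurable_funB | case: sif].
have iG : mu.-integrable setT G.
  by apply: integrableZl => //; have [_] := (siP _).1 sif.
have mF n : measurable_fun setT (F n : T -> \bar R) by exact: measurable_sqnorm.
have cF : {ae mu, forall t, setT t -> F ^~ t @ \oo --> 0%E}.
  apply: aeW => t _; apply: cvg_EFin; first exact: nearW.
  rewrite (_ : _ \o _ = (fun n => (`|m_ n t - m t| * hnorm (f t)) *
                                   (`|m_ n t - m t| * hnorm (f t)))); last first.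
    by apply/funext => n; rewrite /= hnormZC expr2.
  have h0 : `|m_ n t - m t| * hnorm (f t) @[n --> \oo] --> (0 : R).
    rewrite -(mul0r (hnorm (f t))); apply: cvgMl; rewrite -(normr0 R) -(subrr (m t)).
    by apply: cvg_norm; apply: cvgB; [exact: cm | exact: cvg_cst].
  by rewrite -[X in _ --> X](mulr0 (0 : R)); exact: cvgM.
have dF : {ae mu, forall t n, setT t -> (`|F n t| <= G t)%E}.
  apply: aeW => t n _; rewrite /F /G gee0_abs; last by rewrite lee_fin sqr_ge0.
  rewrite -EFinM lee_fin hnormZC -exprMn ler_pXn2r ?nnegrE ?mulr_ge0 ?hnorm_ge0 //.
    rewrite ler_wpM2r ?hnorm_ge0 //; apply: le_trans (ler_normB _ _) _.
    by rewrite mulr_natl mulr2n lerD.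
  exact: le_trans (bm 0%N t).
have [_ _] := dominated_convergence measurableT mF (@measurable_cst _ _ _ _ _ _) cF iG dF.
rewrite integral0 => /fine_cvgP[_ cF0].
have L : hcvg (fun n => rmul (m_ n) f) (rmul m f).
  apply/hcvgP => e e0; move/cvgrPdist_lt : cF0 => /(_ _ (exprn_gt0 2 e0))[N _ hN].
  exists N => n Nn; rewrite -(@ltr_pXn2r _ 2) ?nnegrE ?hnorm_ge0 ?ltW // -lte_fin -L2_sqint.
  rewrite (@eq_sqint _ _ _ _ (fun t => (m_ n t - m t)%:C *: f t)) //.
  - have := hN n Nn; rewrite /= sub0r normrN => h.
    have fi : sqint (fun t => (m_ n t - m t)%:C *: f t) \is a fin_num.
      rewrite ge0_fin_numE ?sqint_ge0 //.
      apply: le_lt_trans (integrable_lty measurableT iG).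
      apply: ge0_le_integral => //.
      + by move=> t _; rewrite lee_fin sqr_ge0.
      + exact: mF.
      + by have /integrableP[] := iG.
      + move=> t _; apply: le_trans (lee_abs _) _; rewrite -/(F n t) /F /G gee0_abs.
          rewrite -EFinM lee_fin hnormZC -exprMn ler_pXn2r ?nnegrE ?mulr_ge0 ?hnorm_ge0 //.
            rewrite ler_wpM2r ?hnorm_ge0 //; apply: le_trans (ler_normB _ _) _.
            by rewrite mulr_natl mulr2n lerD.
          exact: le_trans (bm 0%N t).
        by rewrite lee_fin sqr_ge0.
    by rewrite -(fineK fi) lte_fin; exact: le_lt_trans (ler_norm _) h.
  - by case: (L2_si (rmul (m_ n) f - rmul m f : L2 E)).
  - have h1 : \forall t \ae mu, rmul m f t = (m t)%:C *: f t.
      by apply: L2ofE; exact: si_rmul bm' sif.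
    apply: filterS3 (L2BE (rmul (m_ n) f) (rmul m f)) (rmulE f (M_ n)) h1 => t -> -> ->.
    by rewrite rmorphB scalerBl.
rewrite -(inner0l (monomial k x)).
apply: (hcvg_inner_eq L (hcvg_cst _) (hcvg_cst 0) (hcvg_cst (monomial k x))) => n.
by rewrite inner0l; case: (M_ n) => _ _ h; exact: h.
Qed.

(** The cosine is half of zeta plus its inverse, and multiplying by a power of zeta only shifts the
    coefficients. *)
Lemma multiplier_cos : multiplier (fun t => cos (2 * pi * t)).
Proof.
split; [exact: measurable_cosM | |move=> f hf].
  by exists 1 => t; rewrite ler_norml cos_geN1 cos_le1.
rewrite (rmul_of (g := (2^-1)%:C *: (1 *: zmul 1 f + zmul (-1) f) + 0)).
  apply: null_coefficientsD; last by move=> *; rewrite inner0l.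
  by apply: null_coefficientsD; exact: null_coefficients_zmul.
rewrite scale1r addr0; set g := zmul 1 f + zmul (-1) f.
apply: (aeS4 _ (L2ZE (2^-1)%:C g) (L2DE (zmul 1 f) (zmul (-1) f)) (zmulE 1 f) (zmulE (-1) f)).
move=> t -> -> -> ->; rewrite -scalerDl scalerA; congr (_ *: _).
rewrite -zetaX_conj expr1z /zeta /=; apply/eqP; rewrite eq_complex /=.
by apply/andP; split; apply/eqP; field.
Qed.

Lemma multiplier_sin : multiplier (fun t => sin (2 * pi * t)).
Proof.
split; [exact: measurable_sinM | |move=> f hf].
  by exists 1 => t; rewrite ler_norml sin_geN1 sin_le1.
rewrite (rmul_of (g := (0 +i* (- 2^-1)) *: (1 *: zmul 1 f + (-1 *: zmul (-1) f + 0)) + 0)).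
  apply: null_coefficientsD; last by move=> *; rewrite inner0l.
  apply: null_coefficientsD; first exact: null_coefficients_zmul.
  by apply: null_coefficientsD; [exact: null_coefficients_zmul | move=> *; rewrite inner0l].
rewrite scale1r !addr0 scaleN1r; set g := zmul 1 f - zmul (-1) f.
apply: (aeS4 _ (L2ZE (0 +i* (- 2^-1)) g) (L2BE (zmul 1 f) (zmul (-1) f))
  (zmulE 1 f) (zmulE (-1) f)).
move=> t -> -> -> ->; rewrite -scalerBl scalerA; congr (_ *: _).
rewrite -zetaX_conj expr1z /zeta /=; apply/eqP; rewrite eq_complex /=.
by apply/andP; split; apply/eqP; field.
Qed.

(** Polynomials in x increasing to the square root on [0, 1], in place of Weierstrass approximation.
    The recursion is that of [1 - sqrt_iter] with [B = 1 - x], started at 0 instead of 1. *)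
Fixpoint sqrt_approx (n : nat) (x : R) : R :=
  if n is k.+1 then sqrt_approx k x + 2^-1 * (x - sqrt_approx k x ^+ 2) else 0.

(** With s the root and y the approximation, one step multiplies the error s - y by [1 - (s + y)/2],
    which lies between 0 and [1 - s/2]. *)
Lemma sqrt_approx_bound n (x : R) : 0 <= x <= 1 ->
  0 <= sqrt_approx n x /\
  0 <= Num.sqrt x - sqrt_approx n x <= Num.sqrt x * (1 - 2^-1 * Num.sqrt x) ^+ n.
Proof.
move=> /andP[x0 x1]; set s := Num.sqrt x.
have s0 : 0 <= s by exact: sqrtr_ge0.
have s2 : s ^+ 2 = x by exact: sqr_sqrtr.
have s1 : s <= 1 by rewrite -(@ler_pXn2r _ 2) ?nnegrE // s2 expr1n.
elim: n => [|n [y0 /andP[e0 e1]]] /=; first by rewrite subr0 expr0 mulr1 s0 lexx.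
move: e0 e1; set y := sqrt_approx n x in y0 *; rewrite -s2 => e0 e1.
have Ed : s - (y + 2^-1 * (s ^+ 2 - y ^+ 2)) = (s - y) * (1 - 2^-1 * (s + y)) by field.
rewrite Ed; split; first by nra.
apply/andP; split; first by nra.
rewrite exprS mulrCA; apply: (@le_trans _ _ ((1 - 2^-1 * s) * (s - y))); first by nra.
by apply: ler_wpM2l => //; lra.
Qed.

Lemma multiplier_sqrt m : multiplier m -> (forall t, 0 <= m t <= 1) ->
  multiplier (fun t => Num.sqrt (m t)).
Proof.
move=> M m01; apply: (@multiplier_lim (fun n t => sqrt_approx n (m t)) _ 1).
- elim => [|n ih] /=; first exact: multiplier_cst.
  apply: multiplierD; first exact: ih.
  apply: multiplierZ; apply: multiplierB; first exact: M.
  exact: multiplierX.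
- move=> n t; have [h0 /andP[h1 _]] := sqrt_approx_bound n (m01 t).
  rewrite ger0_norm //; have : Num.sqrt (m t) <= 1.
    by rewrite -[1]sqrtr1 ler_wsqrtr //; case/andP: (m01 t).
  by move: h1; lra.
- move=> t; set s := Num.sqrt (m t).
  have s0 : 0 <= s by exact: sqrtr_ge0.
  have s1 : s <= 1 by rewrite -[1]sqrtr1 ler_wsqrtr //; case/andP: (m01 t).
  apply/(@cvgrPdist_le _ R) => e e0.
  have c : s * (1 - 2^-1 * s) ^+ n @[n --> \oo] --> (0 : R).
    have [->|sn0] := eqVneq s 0; first by under eq_fun do rewrite mul0r; exact: cvg_cst.
    have sp : 0 < s by rewrite lt_neqAle eq_sym sn0.
    rewrite -(mulr0 s); apply: cvgMr; apply: cvg_expr.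
    by rewrite ltr_norml; apply/andP; split; lra.
  move/(@cvgrPdist_le _ R) : c => /(_ _ e0); apply: filterS => n.
  have [_ /andP[h1 h2]] := sqrt_approx_bound n (m01 t).
  rewrite sub0r normrN ger0_norm; last exact: le_trans h2.
  by rewrite ger0_norm //; exact: le_trans.
Qed.

(** Absolute values come from the root of [m^2], so the positive part p is a multiplier; then
    [1 - (1 - p)^n] tends to the indicator of p > 0. *)
Lemma multiplier_indic m : multiplier m -> (forall t, `|m t| <= 1) ->
  multiplier (fun t => if 0 < m t then 1 else 0).
Proof.
move=> M m1.
have Ma : multiplier (fun t => `|m t|).
  have -> : (fun t => `|m t|) = fun t => Num.sqrt (m t ^+ 2).
    by apply/funext => t; rewrite sqrtr_sqr.
  apply: multiplier_sqrt; first exact: multiplierX.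
  move=> t; rewrite sqr_ge0 /= -[leRHS](expr1n _ 2) -real_normK ?num_real //.
  by rewrite ler_pXn2r ?nnegrE.
pose p t := 2^-1 * (m t + `|m t|).
have Mp : multiplier p by apply: multiplierZ; exact: multiplierD.
have p01 t : 0 <= p t <= 1.
  rewrite /p; have := m1 t; have := ler_norm (m t);
  have := ler_norm (- m t); rewrite normrN => h1 h2 h3.
  by apply/andP; split; lra.
apply: (@multiplier_lim (fun n t => 1 - (1 - p t) ^+ n) _ 1).
- move=> n; apply: multiplierB; first exact: multiplier_cst.
  by apply: multiplierX; apply: multiplierB; [exact: multiplier_cst | exact: Mp].
- move=> n t; have /andP[h0 h1] := p01 t.
  have q0 : 0 <= (1 - p t) ^+ n by rewrite exprn_ge0 // subr_ge0.
  have q1 : (1 - p t) ^+ n <= 1 by rewrite exprn_ile1 ?subr_ge0 // gerBl.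
  by rewrite ger0_norm; lra.
- move=> t; case: ifPn => mt.
    rewrite -[X in _ --> X]subr0; apply: cvgB; first exact: cvg_cst.
    apply: cvg_expr; have /andP[h0 h1] := p01 t.
    have : 0 < p t by rewrite /p gtr0_norm //; lra.
    by move=> pt; rewrite ltr_norml; apply/andP; split; lra.
  have -> : p t = 0.
    by rewrite /p; move: mt; rewrite -leNgt => mt; rewrite ler0_norm // addrN mulr0.
  by under eq_fun do rewrite subr0 expr1n subrr; exact: cvg_cst.
Qed.

(** The cosine centred at the midpoint s/2 of the arc, minus its value at the end points: a
    trigonometric polynomial of degree one, halved in the proof to be bounded by 1. *)
Lemma multiplier_arc (s : R) :
  multiplier (fun t => if 0 < cos (2 * pi * t - pi * s) - cos (pi * s) then 1 else 0).
Proof.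
have M : multiplier (fun t => 2^-1 * (cos (2 * pi * t - pi * s) - cos (pi * s))).
  apply: multiplierZ; apply: multiplierB; last exact: multiplier_cst.
  under eq_fun do rewrite cosB.
  apply: multiplierD; apply: multiplierM; try exact: multiplier_cst.
  - exact: multiplier_cos.
  - exact: multiplier_sin.
have := multiplier_indic M.
under eq_fun do rewrite pmulr_rgt0 ?invr_gt0 //.
apply=> t; have := cos_geN1 (2 * pi * t - pi * s); have := cos_le1 (2 * pi * t - pi * s).
have := cos_geN1 (pi * s); have := cos_le1 (pi * s).
by move=> *; rewrite ler_norml; apply/andP; split; lra.
Qed.

(** The difference of cosines is twice [sin (pi t) sin (pi (s - t))]. For t strictly inside [0, 1]
    the first factor is positive, and the second has the sign of s - t. *)
Lemma arcE (s t : R) : 0 < s < 1 -> 0 <= t <= 1 ->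
  (0 < cos (2 * pi * t - pi * s) - cos (pi * s)) = (0 < t < s).
Proof.
move=> /andP[s0 s1] /andP[t0 t1].
have -> : cos (2 * pi * t - pi * s) - cos (pi * s) = 2 * (sin (pi * t) * sin (pi * (s - t))).
  have -> : 2 * pi * t - pi * s = pi * t - pi * (s - t) by ring.
  have -> : cos (pi * s) = cos (pi * t + pi * (s - t)) by congr cos; ring.
  by rewrite cosB cosD; ring.
have p0 := pi_gt0 R.
rewrite pmulr_rgt0 //; have [->|tn0] := eqVneq t 0; first by rewrite mulr0 sin0 mul0r !ltxx.
have tp : 0 < t by rewrite lt_neqAle eq_sym tn0.
have [->|tn1] := eqVneq t 1.
  by rewrite mulr1 sinpi mul0r ltxx ltr01 /= lt_gtF.
have tl : t < 1 by rewrite lt_neqAle tn1.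
have sp : 0 < sin (pi * t).
  by apply: sin_gt0_pi; rewrite mulr_gt0 //= -[ltRHS]mulr1 ltr_pM2l.
rewrite tp /= pmulr_rgt0 //; have [ts|st] := ltP t s.
  apply: sin_gt0_pi; rewrite mulr_gt0 ?subr_gt0 //= -[ltRHS]mulr1 ltr_pM2l //.
  by lra.
apply/negbTE; rewrite -leNgt -opprB mulrN sinN oppr_le0.
apply: sin_ge0_pi; apply/andP; split; first by rewrite mulr_ge0 ?subr_ge0 // ltW.
by rewrite -[leRHS]mulr1 ler_pM2l //; lra.
Qed.

End Multipliers.

(** * Uniqueness of Fourier coefficients *)

Section Uniqueness.
Context {R : realType} {E : innerType R}.
Local Notation mu := (circle R).
Local Notation lambda := (@lebesgue_measure R).
Local Notation T := (measurableTypeR R).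
Implicit Types (f : L2 E).

Lemma null_coefficients_Rintegral f x : null_coefficients f ->
  (\int[mu]_t reip (f t) x = 0)%R.
Proof.
move=> /(_ 0 x); rewrite -[f in inner f]L2of_L2 inner_L2of;
  [|exact: L2_si|exact/si_zetaX/si_cst].
rewrite /circle_integral => -[h _]; rewrite -[RHS]h.
by apply: eq_Rintegral => t _; rewrite expr0z scale1r.
Qed.

(** Multiplying f by the indicator of an arc keeps its coefficients zero, so the integral of <f, x>
    from 0 to y vanishes for every y; Lebesgue differentiation of this constant function gives the
    claim almost everywhere. *)
Lemma null_coefficients_reip f x : null_coefficients f ->
  \forall t \ae mu, reip (f t) x = 0.
Proof.
move=> nf; pose h t := reip (f t) x.
pose D : set T := `[0%R, 1%R]%classic.
have mD : measurable D by exact: measurable_itv.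
have ih : mu.-integrable setT (EFin \o h) by exact: si_reip (L2_si f) (si_cst x).
have mh : measurable_fun setT (h : T -> R).
  by case/integrableP : ih => /measurable_EFinP.
have ihD : lambda.-integrable D (EFin \o h).
  apply/integrableP; split; first exact/measurable_EFinP/measurable_funTS.
  rewrite -integral_circle; first by case/integrableP : ih.
  by apply/measurable_EFinP; exact: measurableT_comp.
pose g : T -> R := h \_ D.
have ig : lambda.-integrable setT (EFin \o g).
  rewrite /g -restrict_EFin; apply/integrable_restrict => //.
  by rewrite setTI.
have gT (y : R) : lambda.-integrable `]-oo, y] (EFin \o g).
  by apply: integrableS ig.
have key (y : R) : (\int[lambda]_(t in `]-oo, y]) g t = 0)%R.
  pose m (t : T) : R := if t <= y then 1 else 0.
  have mm : measurable_fun setT ((fun t => (m t * h t)%:E) : T -> \bar R).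
    apply/measurable_EFinP; apply: measurable_funM => //.
    rewrite /m; apply: measurable_fun_ifT => //.
    exact: measurable_fun_ler.
  have e1 : (\int[lambda]_(t in `]-oo, y]) (g t)%:E = \int[mu]_t (m t * h t)%:E)%E.
    rewrite (integral_circle mm) integral_mkcond [RHS]integral_mkcond.
    apply: eq_integral => t _; rewrite !patchE /g /m.
    have [ty|ty] := leP t y.
      rewrite mem_set ?in_itv //= patchE.
      by case: ifPn; rewrite ?mul1r.
    rewrite memNset /=; last by rewrite in_itv /= => /(lt_le_trans ty); rewrite ltxx.
    by rewrite mul0r; case: ifPn.
  (* On [0, 1] the indicator of t <= y is almost everywhere 0 for y <= 0, 1 for y >= 1, and that of
     the open arc otherwise: the end points 0 and y form a null set. *)
  have [b Mb eb] : exists2 b, multiplier (E := E) b & \forall t \ae mu, m t = b t.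
    have [y0|y0] := leP y 0.
      exists (fun=> 0); first exact: multiplier_cst.
      have h01 : \forall t \ae mu, (0 : R) <= t <= 1 by exact: ae_circle.
      apply: filterS2 (ae_circle_neq 0) h01 => t t0 /andP[tp _].
      by rewrite /m leNgt (le_lt_trans y0) // lt_neqAle eq_sym t0.
    have [y1|y1] := leP 1 y.
      exists (fun=> 1); first exact: multiplier_cst.
      by apply: ae_circle => t /andP[_ t1]; rewrite /m (le_trans t1).
    exists (fun t => if 0 < cos (2 * pi * t - pi * y) - cos (pi * y) then 1 else 0).
      exact: multiplier_arc.
    have h01 : \forall t \ae mu, (0 : R) <= t <= 1 by exact: ae_circle.
    apply: filterS3 (ae_circle_neq 0) (ae_circle_neq y) h01 => t t0 ty t01.
    rewrite /m arcE ?y0 //; have /andP[tp _] := t01.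
    by rewrite lt_neqAle eq_sym t0 tp /= lt_neqAle ty.
  have := null_coefficients_Rintegral x (let: And3 _ _ h := Mb in h f nf).
  rewrite /Rintegral e1 => <-; congr fine; apply: ae_eq_integral => //.
  - by have /integrableP[h1 _] := si_reip (L2_si (rmul b f)) (si_cst x).
  - by apply: filterS2 eb (rmulE f Mb) => t -> -> _; rewrite reipZCl.
have lg : locally_integrable [set: R] g.
  by apply: open_integrable_locally => //; exact: openT.
have G0 : (fun y : R => \int[lambda]_(t in `]-oo, y]) g t)%R = cst 0.
  by apply/funext => y; exact: key.
have := FTC1Ny gT lg; rewrite /= G0 => /ae_lebesgue_circle g0.
have h01 : \forall t \ae mu, (0 : R) <= t <= 1 by exact: ae_circle.
apply: filterS2 g0 h01 => t [_]; rewrite derive1_cst /g patchE => + t01.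
by rewrite mem_set /D /= ?in_itv.
Qed.

(* Strongly measurable functions are essentially separably valued, so the null sets
   of the previous lemma can be united. *)
Theorem null_coefficients_eq0 f : null_coefficients f -> f = 0.
Proof.
move=> nf; have [[s ss sf] _] := L2_si f.
have h n : \forall t \ae mu, reip (f t) (s n t) = 0.
  have [fin _] := ss n.
  have : \forall t \ae mu, forall y, range (s n) y -> reip (f t) y = 0.
    have [r ->] := (finite_seqP _).1 fin.
    elim: r => [|y r ih]; first by apply: aeW => t y.
    apply: filterS2 ih (null_coefficients_reip y nf) => t h1 h2 z /=.
    by rewrite inE => /orP[/eqP->//|]; exact: h1.
  by apply: filterS => t; apply; exists t.
apply: L2P; apply: filterS2 (ae_foralln h) (L2_zeroE E) => t ht ->.
apply: hnorm_eq0; apply/eqP; rewrite -sqrf_eq0 hnorm_sqr; apply/eqP.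
have c := hcvg_reip (hcvg_cst (f t)) (sf t).
have c0 : (fun n => reip (f t) (s n t)) @ \oo --> (0 : R).
  by under eq_fun do rewrite ht; exact: cvg_cst.
by apply: (cvg_unique _ c c0); exact: Rhausdorff.
Qed.

End Uniqueness.

(** * Vector-valued Hardy spaces *)

Section Hardy.
Context {R : realType} {E : hilbertType R}.
Implicit Types (f : L2 E) (M : set E).

Lemma L2_in_closed M : closed_subspace M -> closed_subspace (L2_in M).
Proof.
move=> cM; have sM := closed_subspaceW cM; split.
- by apply: filterS (L2_zeroE E) => t /= ->; exact: subspace0.
- move=> a f g hf hg.
  apply: (aeS4 _ (L2DE (a *: f) g) (L2ZE a f) hf hg) => t -> -> ft gt.
  exact: sM.2.
- move=> f [u Mu uf]; have [k [_ hk]] := L2_ae_subseq uf.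
  apply: filterS2 (ae_foralln (fun n => Mu (k n))) hk => t Mt ht.
  by case: cM => _ _; apply; exists (fun n => (u (k n) : L2 E) t).
Qed.

Lemma L2_in_zmul M k f : subspace M -> L2_in M f -> L2_in M (zmul k f).
Proof.
by move=> sM hf; apply: filterS2 hf (zmulE k f) => t ft ->; exact: subspaceZ.
Qed.

Lemma L2_in_monomial M k x : subspace M -> M x -> L2_in M (monomial k x).
Proof. by move=> sM Mx; apply: filterS (monomialE k x) => t ->; exact: subspaceZ. Qed.

Lemma H2_inP M f : H2_in M f <-> L2_in M f /\
  forall (n : nat) x, (0 < n)%N -> inner f (monomial (- n%:Z) x) = 0.
Proof.
suff e (n : nat) x : circle_integral (fun t => zeta t ^+ n * inner (f t) x) =
    inner f (monomial (- n%:Z) x).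
  by split=> -[hf h]; split=> // n x n0; have := h n x n0; rewrite e.
rewrite -[f in RHS]L2of_L2 inner_L2of; [|exact: L2_si|exact/si_zetaX/si_cst].
congr circle_integral; apply/funext => t.
by rewrite innerZr zetaX_conj opprK.
Qed.

Lemma H2_in_closed M : closed_subspace M -> closed_subspace (H2_in M).
Proof.
move=> cM; have cL := L2_in_closed cM; have sL := closed_subspaceW cL; split.
- by apply/H2_inP; split=> [|n x _]; [exact: subspace0 | exact: inner0l].
- move=> a f g /H2_inP[hf nf] /H2_inP[hg ng]; apply/H2_inP; split; first exact: sL.2.
  by move=> n x n0; rewrite innerDl innerZl nf // ng // mulr0 addr0.
- move=> f [u Mu uf]; apply/H2_inP; split.
    by case: cL => _ _; apply; exists u => // n; case: (Mu n).
  move=> n x n0; rewrite -(inner0l (monomial (- n%:Z) x)).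
  apply: (hcvg_inner_eq uf (hcvg_cst _) (hcvg_cst 0) (hcvg_cst _)) => k.
  by rewrite inner0l; have /H2_inP[_] := Mu k; exact.
Qed.

Lemma H2_in_monomial M (n : nat) x : subspace M -> M x -> H2_in M (monomial n x).
Proof.
move=> sM Mx; apply/H2_inP; split; first exact: L2_in_monomial.
by move=> [|m] y // _; rewrite inner_monomial.
Qed.

(** The component of f orthogonal to the monomials has no Fourier coefficients: the negative ones
    vanish in H2, and for the others x splits into a part in M, met by a monomial of the span, and a
    part orthogonal to all values of the function. *)
Lemma H2_in_cspan M : closed_subspace M ->
  H2_in M `<=` cspan [set f | exists (n : nat) x, M x /\ f = monomial n x].
Proof.
move=> cM f Hf; have sM := closed_subspaceW cM; have cH := H2_in_closed cM.
set N := cspan _; have cN : closed_subspace N by exact: cspan_closed.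
have NH : N `<=` H2_in M.
  by apply: cspan_min => // _ [n [x [Mx ->]]]; exact: H2_in_monomial.
pose g := f - hproj N f.
have Hg : H2_in M g.
  by apply: subspaceB => //; [exact: closed_subspaceW | apply: NH; exact: hproj_in].
have /H2_inP[gM gn] := Hg.
suff g0 : g = 0 by rewrite -(subrK (hproj N f) f) -/g g0 add0r; exact: hproj_in.
apply: null_coefficients_eq0 => -[n|n] x; last by rewrite NegzE gn.
have -> : x = hproj M x + (x - hproj M x) by rewrite addrC subrK.
rewrite monomialD innerDr (hproj_orth f cN) ?add0r; last first.
  by apply: subset_cspan; exists n, (hproj M x); split => //; exact: hproj_in.
rewrite -(inner0l (monomial n (x - hproj M x))); apply: inner_L2_ae.
apply: filterS3 gM (monomialE n (x - hproj M x)) (L2_zeroE E) => t gt -> ->.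
by rewrite inner0l innerZr innerC (hproj_orth x cM) // rmorph0 mulr0.
Qed.

End Hardy.

(** * Defect operators, observability series and boundary values *)

Section Contractions.
Context {R : realType} {H : hilbertType R}.
Variable A : H -> H.
Hypotheses (lA : linear_on setT A) (cA : contraction A).

Local Notation As := (hadj setT A).

Let bA (z : H) : setT z -> hnorm (A z) <= 1 * hnorm z.
Proof. by rewrite mul1r. Qed.

Lemma adjr x y : inner x (As y) = inner (A x) y.
Proof. exact: (inner_hadjr (setT_closed H) lA bA). Qed.

Lemma adjl x y : inner (As x) y = inner x (A y).
Proof. exact: (inner_hadjl (setT_closed H) lA bA). Qed.

Lemma adj_linear : linear_on setT As.
Proof. exact: (hadj_linear (setT_closed H) lA bA). Qed.

Lemma adj_contraction : contraction As.
Proof.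
move=> x; have := hadj_norm (setT_closed H) lA bA x.
by rewrite normr1 mul1r.
Qed.

Lemma adjK : hadj setT As = A.
Proof.
apply/funext => y; apply: hadj_eq => // z _; exact: adjl.
Qed.

Let A0 (x : H) : H := x - As (A x).

Let A01 z : [set: H] z -> reip (A0 z) z <= reip z z.
Proof.
move=> _; rewrite /A0 reipBl /reip adjl -/(reip _ _) gerBl.
exact: reip_ge0.
Qed.

Let pA0 : positive_on [set: H] A0.
Proof.
split=> [a x y _ _|//|x _]; first by rewrite /A0 lA // adj_linear // opprD addrACA scalerBr.
rewrite /A0 innerBl adjl !inner_reip -rmorphB ler0c subr_ge0 -!hnorm_sqr.
by rewrite ler_pXn2r ?nnegrE ?hnorm_ge0.
Qed.

Lemma defect_positive : positive_on setT (defect A).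
Proof. by have [] := hsqrt_spec (setT_closed H) A01 pA0. Qed.

Lemma defect_linear : linear_on setT (defect A).
Proof. by case: defect_positive. Qed.

Lemma defect_sym x y : inner (defect A x) y = inner x (defect A y).
Proof. exact: (positive_sym (subspaceT H) defect_positive). Qed.

Lemma defectK x : defect A (defect A x) = x - As (A x).
Proof. by have [_ + _] := hsqrt_spec (setT_closed H) A01 pA0; exact. Qed.

Lemma defect_cvg x :
  hcvg (fun n => x - sqrt_iter (fun y => As (A y)) n x) (defect A x).
Proof.
have [_ _ /(_ x I)] := hsqrt_spec (setT_closed H) A01 pA0.
by under eq_fun do under [X in sqrt_iter X]eq_fun do rewrite /A0 subKr.
Qed.

Lemma inner_defect x y : inner (defect A x) (defect A y) = inner x y - inner (A x) (A y).
Proof. by rewrite defect_sym defectK innerBr adjr. Qed.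

Lemma hnorm_defect x : hnorm (defect A x) ^+ 2 = hnorm x ^+ 2 - hnorm (A x) ^+ 2.
Proof. by rewrite !hnorm_sqr /reip inner_defect; case: (inner x x) (inner (A x) (A x)) => [? ?]
  [? ?]. Qed.

Lemma defect_contraction : contraction (defect A).
Proof.
move=> x; rewrite -(@ler_pXn2r _ 2) ?nnegrE ?hnorm_ge0 // hnorm_defect.
by rewrite gerBl sqr_ge0.
Qed.

Lemma defect_space_closed : closed_subspace (defect_space A).
Proof.
apply: hclosure_subspace.
exact: (subspace_image (subspaceT H) defect_linear).
Qed.

Lemma defect_in x : defect_space A (defect A x).
Proof. by apply: subset_hclosure; exists x. Qed.

End Contractions.

(** From [A (As A) = (A As) A] the contraction intertwines the polynomial approximations of the two
    roots, hence their limits. *)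
Lemma defect_intertwine (R : realType) (H : hilbertType R) (A : H -> H) x :
  linear_on setT A -> contraction A ->
  A (defect A x) = defect (hadj setT A) (A x).
Proof.
move=> lA cA; have ls := adj_linear lA cA; have cs := adj_contraction lA cA.
have bA z : [set: H] z -> hnorm (A z) <= 1 * hnorm z by rewrite mul1r.
have h1 := bounded_hcvg (subspaceT H) lA bA (fun=> I) I (defect_cvg lA cA x).
have h2 := defect_cvg ls cs (A x); apply: (hcvg_unique h1).
move: h2; congr (hcvg _ _); apply/funext => n /=.
rewrite (linear_onB (subspaceT H) lA) //; congr (_ - _); apply/esym.
apply: (sqrt_iter_intertwine (M := setT)) => //.
  split=> // [a y z _ _|y _]; first by rewrite lA // ls.
  by rewrite (adjl lA cA) inner_ge0.
by move=> z _; rewrite (adjK lA cA).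
Qed.

Lemma hnormD_orth (R : realType) (V : innerType R) (x y : V) : reip x y = 0 ->
  hnorm (x + y) ^+ 2 = hnorm x ^+ 2 + hnorm y ^+ 2.
Proof. by move=> xy; rewrite !hnorm_sqr reipDl !reipDr (reipC y x) xy addr0 add0r. Qed.

(** * Orthogonal series and Abel summation *)

Section OrthogonalSeries.
Context {R : realType}.

Definition orthogonal_seq (V : innerType R) (v : nat -> V) : Prop :=
  forall m n, m <> n -> inner (v m) (v n) = 0.

Definition psum (V : innerType R) (v : nat -> V) (N : nat) : V := \sum_(n < N) v n.

Lemma psumS (V : innerType R) (v : nat -> V) N : psum v N.+1 = psum v N + v N.
Proof. by rewrite /psum big_ord_recr. Qed.

Lemma psum0 (V : innerType R) (v : nat -> V) : psum v 0 = 0.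
Proof. by rewrite /psum big_ord0. Qed.

Lemma inner_psum (V : innerType R) (v : nat -> V) N M : orthogonal_seq v ->
  (N <= M)%N -> inner (psum v N) (v M) = 0.
Proof.
move=> ov; elim: N => [|N ih] NM; first by rewrite psum0 inner0l.
rewrite psumS innerDl ih ?add0r ?ov //; last exact: ltnW.
by move=> e; move: NM; rewrite e ltnn.
Qed.

Lemma hnorm_psumB (V : innerType R) (v : nat -> V) N k : orthogonal_seq v ->
  hnorm (psum v (N + k) - psum v N) ^+ 2 = \sum_(n < k) hnorm (v (N + n)%N) ^+ 2.
Proof.
move=> ov; elim: k => [|k ih]; first by rewrite addn0 subrr hnorm0 big_ord0 expr0n.
rewrite addnS psumS [RHS]big_ord_recr /= -ih.
have o : reip (psum v (N + k) - psum v N) (v (N + k)%N) = 0.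
  by rewrite reipBl /reip !inner_psum ?subrr // leq_addr.
by rewrite -(hnormD_orth o) addrAC.
Qed.

Variable V : hilbertType R.
Implicit Types v w : nat -> V.

(** The tail estimate depends on v alone, hence is uniform over all w dominated by v; this
    uniformity is what Abel summation uses. *)
Lemma psum_cvg v w (C : R) : orthogonal_seq w ->
  (forall n, hnorm (w n) <= hnorm (v n)) ->
  (forall N, \sum_(n < N) hnorm (v n) ^+ 2 <= C) ->
  exists f, hcvg (psum w) f /\
    forall N, hnorm (f - psum w N) ^+ 2 <= C - \sum_(n < N) hnorm (v n) ^+ 2.
Proof.
move=> ow wv vC; pose s N := \sum_(n < N) hnorm (v n) ^+ 2.
have sD N k : s (N + k)%N = s N + \sum_(n < k) hnorm (v (N + n)%N) ^+ 2.
  by rewrite /s big_split_ord.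
have key N k : hnorm (psum w (N + k) - psum w N) ^+ 2 <= s (N + k)%N - s N.
  rewrite hnorm_psumB // sD addrAC subrr add0r; apply: ler_sum => n _.
  by rewrite ler_pXn2r ?nnegrE ?hnorm_ge0.
have nds : nondecreasing_seq s.
  move=> n m /subnKC <-; rewrite sD lerDl sumr_ge0 // => i _; exact: sqr_ge0.
have ubs : has_ubound (range s) by exists C => _ [n _ <-]; exact: vC.
have cs := nondecreasing_cvgn nds ubs.
have cb : hcauchy (psum w).
  move=> e e0; move/cvgrPdist_lt : cs => /(_ _ (exprn_gt0 2 e0)) [N _ hN].
  have h n k : (N <= n)%N -> hnorm (psum w (n + k) - psum w n) < e.
    move=> Nn; rewrite -(@ltr_pXn2r _ 2) ?nnegrE ?hnorm_ge0 ?ltW //.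
    apply: le_lt_trans (key _ _) _.
    have le : s (n + k)%N <= sup (range s) by apply: ub_le_sup => //; exists (n + k)%N.
    have := hN _ Nn => /=; rewrite ltr_norml => /andP[_]; lra.
  exists N => m n Nm Nn; have [/subnKC <-|/ltnW/subnKC <-] := leqP n m; first exact: h.
  by rewrite hnormB; exact: h.
have [f wf] := hilbert_complete _ cb; exists f; split => // N.
have h1 : (fun k => hnorm (psum w (N + k) - psum w N) ^+ 2) @ \oo -->
    hnorm (f - psum w N) ^+ 2.
  under eq_fun do rewrite expr2; rewrite expr2.
  have wf' : hcvg (fun k => psum w (N + k)) f.
    exact: (hcvg_sub (k := addn N) (leq_addl N) wf).
  have h := hcvg_norm (hcvgB wf' (hcvg_cst (psum w N))).
  exact: cvgM.
have c0 : (fun=> C - s N : R) k @[k --> \oo] --> C - s N by exact: cvg_cst.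
apply: (@ler_cvg_to _ _ _ _ _ _ _ _ h1 c0); apply: nearW => k.
by apply: le_trans (key _ _) _; rewrite lerB // vC.
Qed.

Lemma cvg_pow (r : R^nat) N : r @ \oo --> (1 : R) -> (fun k => r k ^+ N) @ \oo --> (1 : R).
Proof.
move=> r1; elim: N => [|N ih].
  by under eq_fun do rewrite expr0; exact: cvg_cst.
by under eq_fun do rewrite exprS; rewrite -(mulr1 (1 : R)); exact: cvgM.
Qed.

(** Tails beyond a common N are small uniformly in k, and the finitely many remaining terms converge
    one by one: three errors of e/3. *)
Lemma abel_sum v (C : R) (f : V) (r : R^nat) (g : nat -> V) : orthogonal_seq v ->
  (forall N, \sum_(n < N) hnorm (v n) ^+ 2 <= C) -> hcvg (psum v) f ->
  (forall k, 0 <= r k <= 1) -> r @ \oo --> (1 : R) ->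
  (forall k, hcvg (psum (fun n => (r k ^+ n)%:C *: v n)) (g k)) -> hcvg g f.
Proof.
move=> ov vC0 vf r01 r1 wg; pose s N := \sum_(n < N) hnorm (v n) ^+ 2.
have nds : nondecreasing_seq s.
  apply/nondecreasing_seqP => n; rewrite /s [leRHS]big_ord_recr /= lerDl; exact: sqr_ge0.
have ubs : has_ubound (range s) by exists C => _ [n _ <-]; exact: vC0.
have cs := nondecreasing_cvgn nds ubs; pose L := sup (range s).
(* The bound [C] is sharpened to the supremum L, so that the tail bound L - s N tends to 0. *)
have vC N : s N <= L by apply: ub_le_sup => //; exists N.
have rX k n : 0 <= r k ^+ n <= 1.
  by have /andP[h0 h1] := r01 k; rewrite exprn_ge0 //= exprn_ile1.
pose w k n := (r k ^+ n)%:C *: v n.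
apply/hcvgP => e e0; have e3 : 0 < e / 3 by rewrite divr_gt0.
move/cvgrPdist_lt : cs => /(_ _ (exprn_gt0 2 e3)) [N _ hN].
have tail : L - s N < (e / 3) ^+ 2.
  by have := hN _ (leqnn N); rewrite /= => /(le_lt_trans (ler_norm _)).
have close (u : nat -> V) f' : orthogonal_seq u -> (forall n, hnorm (u n) <= hnorm (v n)) ->
    hcvg (psum u) f' -> hnorm (f' - psum u N) < e / 3.
  move=> ou uv uf; have [f'' [uf'' h]] := psum_cvg ou uv vC.
  rewrite -(@ltr_pXn2r _ 2) ?nnegrE ?hnorm_ge0 ?ltW // (hcvg_unique uf uf'').
  exact: le_lt_trans (h N) tail.
have cN : hcvg (fun k => psum (w k) N) (psum v N).
  elim: {tail close hN} N => [|N ih].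
    by rewrite psum0; under eq_fun do rewrite psum0; exact: hcvg_cst.
  rewrite psumS; under eq_fun do rewrite psumS.
  apply: hcvgD => //; rewrite -[X in hcvg _ X]scale1r.
  have -> : (1 : R[i]) = (1 : R)%:C by [].
  by apply: hcvg_scale; [exact: cvg_pow | exact: hcvg_cst].
have /hcvgP /(_ _ e3) [k0 hk0] := cN; exists k0 => k kk0.
have h1 := hk0 k kk0.
have h2 : hnorm (g k - psum (w k) N) < e / 3.
  apply: close; last exact: wg.
    by move=> m n mn; rewrite innerZl innerZr ov // !mulr0.
  move=> n; rewrite hnormZC.
  by have /andP[p0 p1] := rX k n; rewrite ger0_norm // ler_piMl ?hnorm_ge0.
have h3 : hnorm (psum v N - f) < e / 3 by rewrite hnormB; exact: close.
have := hnorm_triangle (psum v N) (g k) f.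
have := hnorm_triangle (psum (w k) N) (g k) (psum v N).
move: h1 h2 h3; move: (hnorm _) (hnorm _) (hnorm _) (hnorm _) (hnorm _) => x1 x2 x3 x4 x5.
by lra.
Qed.

End OrthogonalSeries.

Section HardySeries.
Context {R : realType} {H : hilbertType R}.
Local Notation mu := (circle R).
Implicit Types a b : nat -> H.

Definition hardy_terms a (n : nat) : L2 H := monomial n (a n).

Lemma hardy_orthogonal a : orthogonal_seq (hardy_terms a).
Proof. by move=> m n mn; rewrite inner_monomial; case: eqP => // -[]. Qed.

Lemma hardy_sum_ae a N : \forall t \ae mu,
  (psum (hardy_terms a) N : L2 H) t = \sum_(n < N) zeta t ^+ n *: a n.
Proof.
elim: N => [|N ih].
  by rewrite psum0; apply: filterS (L2_zeroE H) => t h; rewrite big_ord0.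
rewrite psumS.
apply: filterS3 (L2DE (psum (hardy_terms a) N) (hardy_terms a N)) ih (monomialE N (a N)).
by move=> t -> -> ->; rewrite big_ord_recr.
Qed.

Lemma H2_in_hardy_sum M a N : closed_subspace M -> (forall n, M (a n)) ->
  H2_in M (psum (hardy_terms a) N).
Proof.
move=> cM Ma; have sH := closed_subspaceW (H2_in_closed cM).
elim: N => [|N ih]; first by rewrite psum0; exact: subspace0.
rewrite psumS; apply: (subspaceD sH) => //.
by apply: H2_in_monomial => //; exact: closed_subspaceW.
Qed.

End HardySeries.

(** * Neumann series inside the disk *)

Section Resolvent.
Context {R : realType} {H : hilbertType R}.
Variable A : H -> H.
Hypotheses (lA : linear_on setT A) (cA : contraction A).

Definition resolvent (z : R[i]) (x : H) : H := hinv (fun y => y - z *: A y) x.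

Variables (r t : R).
Hypothesis r01 : 0 <= r < 1.
Local Notation z := (r%:C * zeta t).

Let zX n (y : H) : hnorm (z ^+ n *: y) = r ^+ n * hnorm y.
Proof.
have /andP[r0 _] := r01.
rewrite exprMn -rmorphXn -scalerA hnormZC ger0_norm ?exprn_ge0 //.
by rewrite (exprnP (zeta t)) hnormZ_unit // zetaX_unit.
Qed.

Let iterA n x : hnorm (iter n A x) <= hnorm x.
Proof. by elim: n => //= n; apply: le_trans. Qed.

Lemma resolvent_eq x w : w - z *: A w = x -> resolvent z x = w.
Proof.
move=> wx; apply: xget_unique => // w' w'x.
have e : w' - w = z *: A (w' - w).
  rewrite (linear_onB (subspaceT H) lA) // scalerBr.
  have e0 : (w' - z *: A w') - (w - z *: A w) = 0 by rewrite w'x wx subrr.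
  by apply: subr0_eq; rewrite -e0 !opprB addrACA [in RHS]addrACA (addrC (- w)).
have /andP[r0 r1] := r01.
have h : hnorm (w' - w) <= r * hnorm (w' - w).
  by rewrite {1}e -[z]expr1 zX expr1 ler_wpM2l.
apply/eqP; rewrite -subr_eq0; apply/eqP/hnorm_eq0/eqP.
by rewrite eq_le hnorm_ge0 andbT; have := hnorm_ge0 (w' - w); move: h; nra.
Qed.

(** The terms decay like [r^n], so the series converges; its partial sums telescope to a solution of
    the resolvent equation, and [resolvent_eq] says that [hinv] selects it. *)
Lemma resolvent_cvg x : hcvg (psum (fun n => z ^+ n *: iter n A x)) (resolvent z x) /\
  resolvent z x - z *: A (resolvent z x) = x.
Proof.
pose u n := z ^+ n *: iter n A x.
have [|n|w [uw _]] := @geometric_limit _ H (psum u) (hnorm x) r.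
- exact: r01.
- by rewrite psumS addrC addKr zX mulrC ler_wpM2r // exprn_ge0 //; case/andP: r01.
suff e : w - z *: A w = x by rewrite (resolvent_eq e).
have bA y : [set: H] y -> hnorm (A y) <= 1 * hnorm y by rewrite mul1r.
have c1 := hcvgZ z (bounded_hcvg (subspaceT H) lA bA (fun=> I) I uw).
have c2 : hcvg (fun N => psum u N.+1) w by exact: (hcvg_sub (k := S) leqnSn uw).
apply: (hcvg_unique (hcvgB c2 c1)).
have E N : psum u N.+1 - z *: A (psum u N) = x.
  elim: N => [|N ih].
    by rewrite psumS !psum0 add0r (linear_on0 (subspaceT H) lA) scaler0 subr0 /u expr0 scale1r.
  have -> : psum u N.+2 = psum u N.+1 + u N.+1 by exact: psumS.
  have -> : A (psum u N.+1) = A (psum u N) + A (u N) by rewrite psumS (linear_onD lA).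
  rewrite scalerDr opprD addrACA ih.
  by rewrite /u (linear_onZ (subspaceT H) lA) // scalerA -exprS subrr addr0.
by under eq_fun do rewrite E; exact: hcvg_cst.
Qed.

Lemma resolventB x y : resolvent z (x - y) = resolvent z x - resolvent z y.
Proof.
have [_ ex] := resolvent_cvg x; have [_ ey] := resolvent_cvg y.
apply: resolvent_eq; rewrite (linear_onB (subspaceT H) lA) // scalerBr.
by rewrite -[in RHS]ex -[in RHS]ey !opprD !opprK addrACA.
Qed.

Lemma resolvent_comm x : resolvent z (A x) = A (resolvent z x).
Proof.
have [_ ex] := resolvent_cvg x; apply: resolvent_eq.
rewrite -(linear_onZ (subspaceT H) lA) // -(linear_onB (subspaceT H) lA) //.
by rewrite ex.
Qed.

End Resolvent.

Lemma hcvg_scale1 (R : realType) (V : innerType R) (r : R^nat) (u : nat -> V) x :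
  r @ \oo --> (1 : R) -> hcvg u x -> hcvg (fun k => (r k)%:C *: u k) x.
Proof.
move=> r1 ux; have -> : x = (1 : R)%:C *: x by rewrite scale1r.
exact: hcvg_scale.
Qed.

(* The observability map [h |-> \sum_n zeta^n D (A^n h)] of a contraction [A] whose
   defect is measured by [D]; for [A = T^*] and [D] the defect operator of [T^*] it is
   the first component of the embedding of H into the model. *)
Section Observability.
Context {R : realType} {H : hilbertType R}.
Local Notation mu := (circle R).
Variables (A D : H -> H).
Hypotheses (lA : linear_on setT A) (lD : linear_on setT D).
Hypothesis nD : forall x, hnorm (D x) ^+ 2 = hnorm x ^+ 2 - hnorm (A x) ^+ 2.

Let a (h : H) (n : nat) : H := D (iter n A h).
Local Notation v h := (hardy_terms (a h)).

(** The hypothesis [nD] at [iter n A h] makes the sum telescope; it bounds the series and, in the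
    limit, gives the exact norm in [obs_norm]. *)
Let sum_a h N : \sum_(n < N) hnorm (v h n) ^+ 2 = hnorm h ^+ 2 - hnorm (iter N A h) ^+ 2.
Proof.
elim: N => [|N ih]; first by rewrite big_ord0 subrr.
by rewrite big_ord_recr /= ih /hardy_terms hnorm_monomial nD addrA subrK.
Qed.

Let sum_le h N : \sum_(n < N) hnorm (v h n) ^+ 2 <= hnorm h ^+ 2.
Proof. by rewrite sum_a gerBl sqr_ge0. Qed.

Lemma iter_linear n : linear_on setT (iter n A).
Proof. by elim: n => [//|n ih] x y z _ _ /=; rewrite ih // lA. Qed.

Definition obs (h : H) : L2 H := xget 0 [set f | hcvg (psum (v h)) f].

Lemma obs_cvg h : hcvg (psum (v h)) (obs h).
Proof.
rewrite /obs; case: xgetP => [f _ //|].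
have [f [vf _]] := psum_cvg (hardy_orthogonal (a h)) (fun n => lexx _) (sum_le h).
by move=> /(_ f).
Qed.

Let v_linear x h h' n : v (x *: h + h') n = x *: v h n + v h' n.
Proof. by rewrite /hardy_terms /a iter_linear // lD // monomial_linear. Qed.

Lemma obs_linear : linear_on setT obs.
Proof.
move=> x h h' _ _; apply: (hcvg_unique (obs_cvg _)).
have -> : psum (v (x *: h + h')) = fun N => x *: psum (v h) N + psum (v h') N.
  apply/funext; elim=> [|N ih]; first by rewrite !psum0 scaler0 addr0.
  by rewrite !psumS ih v_linear scalerDr addrACA.
by apply: hcvgD; [apply: hcvgZ; exact: obs_cvg | exact: obs_cvg].
Qed.

Lemma obs_norm h (q : R) : (fun n => hnorm (iter n A h) ^+ 2) @ \oo --> q ->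
  hnorm (obs h) ^+ 2 = hnorm h ^+ 2 - q.
Proof.
move=> hq; have c1 := hcvg_norm (obs_cvg h).
have c2 : (fun N => hnorm (psum (v h) N) ^+ 2) @ \oo --> hnorm (obs h) ^+ 2.
  by under eq_fun do rewrite expr2; rewrite expr2; exact: cvgM.
have c3 : (fun N => hnorm (psum (v h) N) ^+ 2) @ \oo --> hnorm h ^+ 2 - q.
  have E N : hnorm (psum (v h) N) ^+ 2 = hnorm h ^+ 2 - hnorm (iter N A h) ^+ 2.
    have := hnorm_psumB 0 N (hardy_orthogonal (a h)).
    by rewrite psum0 subr0 add0n => ->; exact: sum_a.
  by under eq_fun do rewrite E; apply: cvgB => //; exact: cvg_cst.
by apply: (cvg_unique _ c2 c3); exact: Rhausdorff.
Qed.

Lemma obs_rec h : obs h = monomial 0 (D h) + zmul 1 (obs (A h)).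
Proof.
have c1 : hcvg (fun N => psum (v h) N.+1) (obs h).
  exact: (hcvg_sub (k := S) leqnSn (obs_cvg h)).
apply: (hcvg_unique c1).
have E N : psum (v h) N.+1 = monomial 0 (D h) + zmul 1 (psum (v (A h)) N).
  elim: N => [|N ih]; first by rewrite psumS !psum0 add0r (linear_on0 (subspaceT _)
    (zmul_linear_on 1)) addr0.
  rewrite psumS ih [psum _ N.+1]psumS zmulD addrA; congr (_ + _).
  rewrite /hardy_terms zmul_monomial /a iterSr.
  by congr (monomial _ _).
under eq_fun do rewrite E.
apply: hcvgD; first exact: hcvg_cst.
exact: (zmul_hcvg 1 (obs_cvg (A h))).
Qed.

Lemma H2_in_obs M h : closed_subspace M -> (forall x, M (D x)) -> H2_in M (obs h).
Proof.
move=> cM DM; case: (H2_in_closed cM) => _ _; apply.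
by exists (psum (v h)); [move=> N; apply: H2_in_hardy_sum => // n; exact: DM | exact: obs_cvg].
Qed.

(** The backward shift acts on [obs h] as A acts on h: the constant term in [obs_rec] is orthogonal
    to zeta f. *)
Lemma inner_zmul_obs M f h : H2_in M f -> inner (zmul 1 f) (obs h) = inner f (obs (A h)).
Proof.
move=> /H2_inP[_ /(_ 1%N (D h) isT) f1].
by rewrite {1}obs_rec innerDr inner_zmul_monomial sub0r f1 add0r inner_zmul.
Qed.

Section Radial.
Hypotheses (cA : contraction A) (cD : contraction D).

Lemma resolvent_D_cvg (r t : R) x (z := r%:C * zeta t) : (0 : R) <= r < 1 ->
  hcvg (fun N => \sum_(n < N) z ^+ n *: a x n) (D (resolvent A z x)).
Proof.
move=> r01; have bD y : [set: H] y -> hnorm (D y) <= 1 * hnorm y by rewrite mul1r.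
have [c _] := resolvent_cvg lA cA t r01 x.
have := bounded_hcvg (subspaceT H) lD bD (fun=> I) I c.
congr (hcvg _ _); apply/funext => N /=.
rewrite (linear_on_sum (subspaceT H) lD) //; apply: eq_bigr => n _.
by rewrite (linear_onZ (subspaceT H) lD).
Qed.

(** At radius r < 1 the series also converges pointwise, as a Neumann series; its L2 limit is
    therefore a resolvent expression, the form occurring in [char_fun]. *)
Lemma dilated_obs (r : R) x : (0 : R) <= r < 1 ->
  exists f : L2 H, hcvg (psum (fun n => (r ^+ n)%:C *: v x n)) f /\
    \forall t \ae mu, f t = D (resolvent A (r%:C * zeta t) x).
Proof.
move=> r01; have /andP[r0 r1] := r01.
pose b n := (r ^+ n)%:C *: a x n.
have E : psum (fun n => (r ^+ n)%:C *: v x n) = psum (hardy_terms b).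
  apply/funext => N; apply: eq_bigr => n _.
  by rewrite /hardy_terms monomialZ.
have nb n : hnorm (hardy_terms b n) <= hnorm (v x n).
  rewrite /hardy_terms !hnorm_monomial hnormZC ger0_norm ?exprn_ge0 //.
  by rewrite ler_piMl ?hnorm_ge0 // exprn_ile1 // ltW.
have [f [bf _]] := psum_cvg (hardy_orthogonal b) nb (sum_le x).
exists f; rewrite E; split => //.
have [k [kn hk]] := L2_ae_subseq bf.
apply: filterS2 hk (ae_foralln (hardy_sum_ae b)) => t c1 c2.
apply: (hcvg_unique c1).
have c3 := hcvg_sub kn (resolvent_D_cvg t x r01).
move: c3; congr (hcvg _ _); apply/funext => N /=.
rewrite c2; apply: eq_bigr => n _.
by rewrite /b scalerA exprMn rmorphXn mulrC.
Qed.

Lemma obs_radial (r : R^nat) x : (forall k, 0 <= r k < 1) -> r @ \oo --> (1 : R) ->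
  exists g : nat -> L2 H, hcvg g (obs x) /\
    forall k, \forall t \ae mu, g k t = D (resolvent A ((r k)%:C * zeta t) x).
Proof.
move=> r01 r1; have [g hg] := choice (fun k => dilated_obs x (r01 k)).
exists g; split=> [|k]; last by case: (hg k).
apply: (abel_sum (hardy_orthogonal (a x)) (sum_le x) (obs_cvg x)) (r1) _ => [k|k].
  by have /andP[-> /ltW] := r01 k.
by case: (hg k).
Qed.

End Radial.

End Observability.

(** * Boundary values of the characteristic function on the range of the defect operator *)

Section CharacteristicFunction.
Context {R : realType} {H : hilbertType R}.
Local Notation mu := (circle R).
Variable T : H -> H.
Hypotheses (lT : linear_on setT T) (cT : contraction T).
Local Notation Ts := (hadj setT T).
Local Notation D := (defect T).
Local Notation Ds := (defect (hadj setT T)).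

Let lTs : linear_on setT Ts := adj_linear lT cT.
Let cTs : contraction Ts := adj_contraction lT cT.
Let lDs : linear_on setT Ds := defect_linear lTs cTs.
Let cDs : contraction Ds := defect_contraction lTs cTs.
Let nDs x : hnorm (Ds x) ^+ 2 = hnorm x ^+ 2 - hnorm (Ts x) ^+ 2 :=
  hnorm_defect lTs cTs x.

(** Substitute [D^2 = 1 - Ts T] under the resolvent and [T D g = Ds (T g)]; writing T g through its
    resolvent equation cancels the terms containing [Ts]. *)
Lemma char_fun_defect (r t : R) g : (0 : R) <= r < 1 ->
  char_fun T (r%:C * zeta t) (D g) =
  (r%:C * zeta t) *: Ds (resolvent Ts (r%:C * zeta t) g) -
  Ds (resolvent Ts (r%:C * zeta t) (T g)).
Proof.
move=> r01; rewrite /char_fun -/(resolvent Ts _ _); set z := r%:C * zeta t.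
rewrite (defectK lT cT) (resolventB lTs cTs t r01) (resolvent_comm lTs cTs t r01).
have [_ e] := resolvent_cvg lTs cTs t r01 (T g); rewrite -/z in e.
rewrite defect_intertwine // -[in Ds (T g)]e.
rewrite !(linear_onB (subspaceT H) lDs) // (linear_onZ (subspaceT H) lDs) //.
by rewrite scalerBr opprB -/z [LHS]addrC addrA subrK.
Qed.

(** The radial limit exists by hypothesis, so only its value is at stake. By Abel summation the
    right-hand side is an L2 limit of the functions at radius r, and an almost everywhere convergent
    subsequence compares the two. *)
Lemma boundary_value (Theta : R -> H -> H) g :
  boundary_function (defect_space T) (defect_space Ts) (char_fun T) Theta ->
  \forall t \ae mu, Theta t (D g) = (zmul 1 (obs Ts Ds g) - obs Ts Ds (T g) : L2 H) t.
Proof.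
move=> [_ /(_ (D g) (defect_in T g)) bT _].
(* Any sequence in [0, 1) tending to 1 would do; sequences are needed to extract a subsequence
   converging almost everywhere. *)
pose r (k : nat) : R := 1 - k.+1%:R^-1.
have r01 k : 0 <= r k < 1.
  rewrite /r subr_ge0 invf_le1 ?ltr0n // ler1n /= gtrBl invr_gt0 ltr0n //.
have r1 : r @ \oo --> (1 : R).
  rewrite -[X in _ --> X]subr0; apply: cvgB; first exact: cvg_cst.
  exact: cvg_harmonic.
have [g1 [c1 e1]] := obs_radial lTs lDs nDs cTs cDs g r01 r1.
have [g2 [c2 e2]] := obs_radial lTs lDs nDs cTs cDs (T g) r01 r1.
have c : hcvg (fun k => (r k)%:C *: zmul 1 (g1 k) - g2 k)
    (zmul 1 (obs Ts Ds g) - obs Ts Ds (T g)).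
  exact: (hcvgB (hcvg_scale1 r1 (zmul_hcvg 1 c1)) c2).
have [k [kn hk]] := L2_ae_subseq c.
have hae n : \forall t \ae mu, ((r n)%:C *: zmul 1 (g1 n) - g2 n : L2 H) t =
    char_fun T ((r n)%:C * zeta t) (D g).
  have h1 := aeI (L2BE ((r n)%:C *: zmul 1 (g1 n)) (g2 n)) (L2ZE (r n)%:C (zmul 1 (g1 n))).
  apply: (aeS4 _ h1 (zmulE 1 (g1 n)) (e1 n) (e2 n)) => t [-> ->] -> -> ->.
  by rewrite char_fun_defect // scalerA expr1z.
apply: filterS3 bT hk (ae_foralln hae) => t bt ht et.
apply: (hcvg_unique _ ht).
have h1 : hcvg (fun n => char_fun T ((r n)%:C * zeta t) (D g)) (Theta t (D g)).
  apply/hcvgP => e e0.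
  move/cvgrPdist_lt : bt => /(_ e e0) [d /= d0 hd].
  move/cvgrPdist_lt : r1 => /(_ d d0) [N _ hN].
  exists N => n Nn; have := hd (r n) (hN n Nn).
  rewrite sub0r normrN => h; apply: le_lt_trans (ler_norm _) (h _).
  by have /andP[] := r01 n.
have := hcvg_sub kn h1; congr (hcvg _ _); apply/funext => n /=.
by rewrite et.
Qed.

End CharacteristicFunction.

(** * The minimal unitary dilation *)

Section BoundedMaps.
Context {R : realType}.
Variables (V W : innerType R) (M : set V).
Hypothesis cM : closed_subspace M.
Let sM := closed_subspaceW cM.

(** Density arguments take this form, or that of [preimage_closed]: an identity or membership
    checked on generators extends to their closed span. *)
Lemma equalizer_closed (A B : V -> W) (C : R) : linear_on M A -> linear_on M B ->
  (forall z, M z -> hnorm (A z) <= C * hnorm z) ->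
  (forall z, M z -> hnorm (B z) <= C * hnorm z) ->
  closed_subspace [set x | M x /\ A x = B x].
Proof.
move=> lA lB bA bB; split=> [|a x y [Mx ABx] [My ABy]|x [u Eu ux]] /=.
- by split; [exact: subspace0 | rewrite (linear_on0 sM lA) (linear_on0 sM lB)].
- by split; [exact: sM.2 | rewrite lA // lB // ABx ABy].
have Mu n : M (u n) by case: (Eu n).
have Mx : M x by case: cM => _ _; apply; exists u.
split=> //; apply: (hcvg_unique (bounded_hcvg sM lA bA Mu Mx ux)).
have -> : A \o u = B \o u by apply/funext => n; case: (Eu n).
exact: (bounded_hcvg sM lB bB Mu Mx ux).
Qed.

Lemma preimage_closed (N : set W) (A : V -> W) (C : R) : closed_subspace N ->
  linear_on M A -> (forall z, M z -> hnorm (A z) <= C * hnorm z) ->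
  closed_subspace [set x | M x /\ N (A x)].
Proof.
move=> cN lA bA; have sN := closed_subspaceW cN.
split=> [|a x y [Mx Ax] [My Ay]|x [u Eu ux]] /=.
- by split; [exact: subspace0 | rewrite (linear_on0 sM lA); exact: subspace0].
- by split; [exact: sM.2 | rewrite lA //; exact: sN.2].
have Mu n : M (u n) by case: (Eu n).
have Mx : M x by case: cM => _ _; apply; exists u.
split=> //; case: cN => _ _; apply; exists (A \o u) => [n|]; first by case: (Eu n).
exact: (bounded_hcvg sM lA bA Mu Mx ux).
Qed.

End BoundedMaps.

Lemma cspan_map (R : realType) (V W : innerType R) (S : set V) (N : set W) (A : V -> W) (C : R) :
  closed_subspace N -> linear_on setT A -> (forall z, setT z -> hnorm (A z) <= C * hnorm z) ->
  (forall x, S x -> N (A x)) -> forall x, cspan S x -> N (A x).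
Proof.
move=> cN lA bA SN x Sx.
have cP := preimage_closed (@setT_closed R V) cN lA bA.
by case: (cspan_min cP (fun y Sy => conj I (SN y Sy)) Sx).
Qed.

Lemma unitary_linear (R : realType) (V W : innerType R) M N (A : V -> W) :
  unitary_on M N A -> linear_on M A.
Proof. by case=> -[]. Qed.

Lemma unitary_norm (R : realType) (V W : innerType R) M N (A : V -> W) x :
  unitary_on M N A -> M x -> hnorm (A x) = hnorm x.
Proof. by case=> -[_ h] _; exact: h. Qed.

Lemma unitary_bound (R : realType) (V W : innerType R) M N (A : V -> W) :
  unitary_on M N A -> forall x, M x -> hnorm (A x) <= 1 * hnorm x.
Proof. by move=> uA x Mx; rewrite mul1r (unitary_norm uA). Qed.

Section UnitaryPowers.
Context {R : realType} {K : hilbertType R}.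
Variable U : K -> K.
Hypothesis uU : unitary_on setT setT U.
Local Notation Us := (hadj setT U).

Let lU := unitary_linear uU.

Lemma unitary_cancel x : Us (U x) = x. Proof. exact: (unitary_hadjK (subspaceT K) uU). Qed.
Lemma unitary_cancelr x : U (Us x) = x. Proof. exact: (unitary_Khadj (subspaceT K) uU). Qed.

Lemma unitary_adj_linear : linear_on setT Us.
Proof. exact: (hadj_linear (@setT_closed R K) lU (unitary_bound uU)). Qed.

Lemma unitary_adj_norm x : hnorm (Us x) = hnorm x.
Proof. by rewrite -[in RHS](unitary_cancelr x) (unitary_norm uU). Qed.

Lemma inner_unitaryl x y : inner (U x) y = inner x (Us y).
Proof. exact: (unitary_adj (subspaceT K) uU). Qed.

Lemma zpowerS n x : U (zpower U n x) = zpower U (n + 1) x.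
Proof.
case: n => [n|[|n]] /=.
- by rewrite addn1.
- by rewrite unitary_cancelr.
- by rewrite unitary_cancelr subn1.
Qed.

Lemma zpower_pred n x : Us (zpower U n x) = zpower U (n - 1) x.
Proof. by rewrite -[in LHS](subrK 1 n) -zpowerS unitary_cancel. Qed.

Lemma zpower_linear n : linear_on setT (zpower U n).
Proof.
case: n => n; first exact: iter_linear.
exact: (iter_linear unitary_adj_linear n.+1).
Qed.

Lemma zpower_norm n x : hnorm (zpower U n x) = hnorm x.
Proof.
case: n => n /=; last by rewrite unitary_adj_norm; elim: n => //= n; rewrite unitary_adj_norm.
by elim: n => //= n; rewrite (unitary_norm uU).
Qed.

Lemma zpower_bound n x : setT x -> hnorm (zpower U n x) <= 1 * hnorm x.
Proof. by rewrite mul1r zpower_norm. Qed.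

End UnitaryPowers.

(** Arbitrary g is intended, such as t |-> Delta t (f t). A unimodular factor does not affect
    whether g agrees almost everywhere with an L2 function, and if it does not, both sides are the
    default 0. *)
Lemma zmul_L2of (R : realType) (H : innerType R) k (g : R -> H) :
  L2of (fun t => zeta t ^ k *: g t) = zmul k (L2of g).
Proof.
have cancel j (h : R -> H) (f : L2 H) : (\forall t \ae circle R, zeta t ^ j *: h t = f t) ->
    \forall t \ae circle R, h t = (zmul (- j) f : L2 H) t.
  move=> hf; apply: filterS2 hf (zmulE (- j) f) => t e ->.
  by rewrite -e scalerA -expfzDr ?zeta_neq0 // addNr expr0z scale1r.
have [[f gf]|ng] := pselect (exists f : L2 H, \forall t \ae circle R, g t = f t).
  have -> : L2of g = f by apply: L2of_si_ae; apply: filterS gf => t ->.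
  by apply: L2of_si_ae; apply: filterS2 gf (zmulE k f) => t -> ->.
have z00 (h : R -> H) : ~ (exists f : L2 H, \forall t \ae circle R, h t = f t) -> L2of h = 0.
  move=> nh; rewrite /L2of; case: xgetP => [f _ fh|_].
    by case: nh; exists f; apply: filterS fh => t ->.
  apply: L2P; have /eqmodP/asboolP e := reprK (\pi_(L2 H)%qT (L2fun (si0 H))).
  by apply: filterS2 e (L2_zeroE H) => t et zt; exact: etrans et (esym zt).
rewrite (z00 g ng) (linear_on0 (subspaceT _) (zmul_linear_on k)).
apply: z00 => -[f gf]; apply: ng; exists (zmul (- k) f); exact: cancel gf.
Qed.

(** * The residual space and its identification with the Delta space *)

Section Dilation.
Context {R : realType} {H : hilbertType R}.
Variables T1 T2 : {linear H -> H}.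
Hypothesis contraction1 : contraction T1.
Hypothesis contraction2 : contraction T2.
Local Notation T := (T1 \o T2).
Local Notation Ts := (hadj setT T).
Local Notation DT := (defect_space T).

Lemma compT_linear : linear_on setT T.
Proof. by move=> a x y _ _ /=; rewrite !linearP. Qed.

Lemma compT_contraction : contraction T.
Proof. by move=> x /=; apply: le_trans (contraction1 _) (contraction2 _). Qed.

Let lT := compT_linear.
Let cT := compT_contraction.

Variable Theta : R -> H -> H.
Hypothesis ThetaE :
  boundary_function DT (defect_space Ts) (char_fun T) Theta.
Variables (C : canonical_unitaries T1 T2) (D : minimal_unitary_dilation T1 T2).
Variable I : identification Theta C D.

Local Notation K := (ud_K D).
Local Notation U := (@ud_U _ _ _ _ D).
Local Notation Us := (hadj setT U).
Local Notation emb := (@ud_emb _ _ _ _ D).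
Local Notation RD := (@ud_R R H T1 T2 D).
Local Notation LD := (@ud_L R H T1 T2 D).
Local Notation M := (ud_M LD).
Local Notation P := (hproj RD).
Local Notation omega := (id_omegaNF I).
Local Notation iota := (id_iota I).
Local Notation mDelta := (mult (Delta T1 T2 Theta)).
Local Notation DL2 := (DeltaL2 T1 T2 Theta).

Let uU := ud_U_unitary D.

Let ud_M_closed (L : set K) : closed_subspace (ud_M L).
Proof. exact: cspan_closed. Qed.

Lemma ud_M_zpower (L : set K) n x : L x -> ud_M L (zpower U n x).
Proof. by move=> Lx; apply: subset_cspan; exists n, x. Qed.

Lemma ud_M_U (L : set K) x : ud_M L x -> ud_M L (U x).
Proof.
apply: (cspan_map (ud_M_closed L) (unitary_linear uU) (unitary_bound uU)).
by move=> _ [n [y [Ly ->]]]; rewrite (zpowerS uU); exact: ud_M_zpower.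
Qed.

Let Us_bound x : [set: K] x -> hnorm (Us x) <= 1 * hnorm x.
Proof. by rewrite mul1r (unitary_adj_norm uU). Qed.

Lemma ud_M_Us (L : set K) x : ud_M L x -> ud_M L (Us x).
Proof.
apply: (cspan_map (ud_M_closed L) (unitary_adj_linear uU) Us_bound).
by move=> _ [n [y [Ly ->]]]; rewrite (zpower_pred uU); exact: ud_M_zpower.
Qed.

Lemma ud_R_closed : closed_subspace RD.
Proof. exact: orth_closed. Qed.

Lemma ud_proj_in x : RD (P x).
Proof. exact: (hproj_in x ud_R_closed). Qed.

Lemma ud_R_U x : RD x -> RD (U x).
Proof. by move=> Rx y My; rewrite (inner_unitaryl uU); apply: Rx; exact: ud_M_Us. Qed.

Lemma ud_R_Us x : RD x -> RD (Us x).
Proof.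
move=> Rx y My; rewrite innerC -(inner_unitaryl uU) -innerC.
by apply: Rx; exact: ud_M_U.
Qed.

Lemma ud_proj_U x : P (U x) = U (P x).
Proof.
have cR := ud_R_closed.
apply: hproj_eq; [exact: closed_subspaceW| exact/ud_R_U/ud_proj_in|].
move=> y Ry; rewrite -(linear_onB (subspaceT K) (unitary_linear uU)) // (inner_unitaryl uU).
by apply: hproj_orth => //; exact: ud_R_Us.
Qed.

Lemma ud_proj_Us x : P (Us x) = Us (P x).
Proof. by rewrite -[in RHS](unitary_cancelr uU x) ud_proj_U (unitary_cancel uU). Qed.

Lemma ud_proj_zpower n x : P (zpower U n x) = zpower U n (P x).
Proof.
case: n => n /=; last by rewrite ud_proj_Us; elim: n => //= n <-; rewrite ud_proj_Us.
by elim: n => //= n <-; rewrite ud_proj_U.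
Qed.

(** [emb h - U (emb (Ts h))] lies in the wandering space [ud_Ls], to which the residual space is
    orthogonal. *)
Lemma ud_proj_emb h : P (emb h) = U (P (emb (Ts h))).
Proof.
have cR := ud_R_closed; rewrite -ud_proj_U; apply/eqP; rewrite -subr_eq0.
rewrite -(linear_onB (subspaceT K) (hproj_linear cR)) //; apply/eqP.
have sR := closed_subspaceW cR.
apply: (hproj_eq sR); first exact: subspace0.
move=> y Ry; rewrite subr0 innerC Ry ?rmorph0 //.
by apply: (@ud_M_zpower _ 0); apply: subset_hclosure; exists h.
Qed.

Let w h : K := U (emb h) - emb (T h).

Let wM n h : M (zpower U n (w h)).
Proof. by apply: ud_M_zpower; apply: subset_hclosure; exists h. Qed.

Lemma ud_M_sub : M `<=` cspan [set y | exists n h, y = zpower U n (w h)].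
Proof.
set N := cspan _; have cN : closed_subspace N := cspan_closed _.
apply: (cspan_min cN) => _ [n [x [Lx ->]]].
have [_ _ cl] := preimage_closed (@setT_closed R K) cN (zpower_linear uU n) (zpower_bound uU n).
suff [] : [set x | setT x /\ N (zpower U n x)] x by [].
apply: cl; apply: hclosureS Lx => _ [h _ <-]; split => //.
by apply: subset_cspan; exists n, h.
Qed.

Lemma iota_U l : M l -> iota (U l) = zmul 1 (iota l).
Proof.
have uI := id_iota_unitary I; have sM := closed_subspaceW (ud_M_closed LD).
have lIU : linear_on M (fun l => iota (U l)).
  move=> a x y Mx My; rewrite (unitary_linear uU) // (unitary_linear uI) //; exact: ud_M_U.
have lzI : linear_on M (fun l => zmul 1 (iota l)).
  by move=> a x y Mx My; rewrite (unitary_linear uI) // zmul_linear.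
have bIU x : M x -> hnorm (iota (U x)) <= 1 * hnorm x.
  by move=> Mx; rewrite (unitary_norm uI) ?(unitary_norm uU) ?mul1r //; exact: ud_M_U.
have bzI x : M x -> hnorm (zmul 1 (iota x)) <= 1 * hnorm x.
  by move=> Mx; rewrite hnorm_zmul (unitary_norm uI) ?mul1r.
have cE := equalizer_closed (ud_M_closed _) lIU lzI bIU bzI.
move=> /ud_M_sub Ml; suff [] : [set x | M x /\ iota (U x) = zmul 1 (iota x)] l by [].
apply: (cspan_min cE) Ml => _ [n [h ->]]; split; first exact: wM.
rewrite (zpowerS uU) !id_iotaE -!/(monomial _ _) zmul_monomial addrC //.
Qed.

Let DT_closed : closed_subspace DT := defect_space_closed lT cT.

Lemma Delta_mult f : L2_in DT f -> mDelta (zmul 1 f) = zmul 1 (mDelta f).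
Proof.
move=> Df; rewrite /mult -zmul_L2of; apply: eq_L2of.
case: ThetaE => cTh _ _.
apply: filterS3 Df cTh (zmulE 1 f) => t Dft [lA AM A1] ->.
apply: hsqrtZ => // z Dz; rewrite reipBl gerBl.
have b1 y : DT y -> hnorm (Theta t y) <= 1 * hnorm y by rewrite mul1r; exact: A1.
by rewrite /reip (inner_hadjl DT_closed lA b1) // -/(reip _ _) reip_ge0.
Qed.

Let uW := id_omegaNF_unitary I.

(** For r = P l with l in M(L) it follows from the behaviour of [iota] and [Delta] under zeta. Such
    r are dense in the residual space because their images under the isometry [omega] are dense in
    [DL2]. *)
Lemma omega_U r : RD r -> omega (U r) = zmul 1 (omega r).
Proof.
have cR := ud_R_closed; have sR := closed_subspaceW cR.
have lWU : linear_on RD (fun l => omega (U l)).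
  by move=> a x y Mx My; rewrite (unitary_linear uU) // (unitary_linear uW) //; exact: ud_R_U.
have lzW : linear_on RD (fun l => zmul 1 (omega l)).
  by move=> a x y Mx My; rewrite (unitary_linear uW) // zmul_linear.
have bWU x : RD x -> hnorm (omega (U x)) <= 1 * hnorm x.
  by move=> Mx; rewrite (unitary_norm uW) ?(unitary_norm uU) ?mul1r //; exact: ud_R_U.
have bzW x : RD x -> hnorm (zmul 1 (omega x)) <= 1 * hnorm x.
  by move=> Mx; rewrite hnorm_zmul (unitary_norm uW) ?mul1r.
have [_ _ cl] := equalizer_closed cR lWU lzW bWU bzW.
move=> Rr; suff [] : [set x | RD x /\ omega (U x) = zmul 1 (omega x)] r by [].
apply: cl; have [u Du uw] := unitary_in uW Rr.
have hl n : exists l, M l /\ u n = omega (P l).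
  have [f Df <-] := Du n; have [_ im] := id_iota_unitary I.
  move: Df; rewrite -im => -[l Ml <-]; exists l.
  by rewrite id_omegaNFE.
have [l hl'] := choice hl; exists (P \o l) => [n|].
  have [Ml ue] := hl' n; split; first exact: hproj_in.
  rewrite /= -ud_proj_U (id_omegaNFE I (ud_M_U Ml)) iota_U // Delta_mult ?id_omegaNFE //.
  by have [_ <-] := id_iota_unitary I; exists (l n).
apply: (hcvg_isometry uw) => n; have [Ml ->] := hl' n.
have RP : RD (P (l n)) by exact: hproj_in.
by rewrite -(linear_onB sR (unitary_linear uW)) // (unitary_norm uW) //; exact: (subspaceB sR).
Qed.

(** [iota] maps onto L2(DT), so the identity [id_omegaNFE] exhibits [mDelta] as omega P composed
    with the inverse of [iota]; linearity is inherited without studying the roots Delta t or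
    measurability. [Delta_norm] follows likewise. *)
Lemma Delta_linear : linear_on (L2_in DT) mDelta.
Proof.
have uI := id_iota_unitary I; have sM := closed_subspaceW (ud_M_closed LD).
have cR := ud_R_closed.
move=> a f g; case: uI => -[lI _] <- [l Ml <-] [m Mm <-].
rewrite -lI // -!(id_omegaNFE I) //; last exact: sM.2.
rewrite (hproj_linear cR) // (unitary_linear uW) //; exact: hproj_in.
Qed.

Lemma Delta_norm f : L2_in DT f -> hnorm (mDelta f) <= 1 * hnorm f.
Proof.
have uI := id_iota_unitary I; have cR := ud_R_closed.
case: (uI) => _ <- [l Ml <-]; rewrite -(id_omegaNFE I) //.
rewrite (unitary_norm uW) ?(unitary_norm uI) ?mul1r //; first exact: hproj_norm.
exact: hproj_in.
Qed.

(** The left side is omega P applied to the generator [w h] of the wandering space [ud_L], which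
    [iota] sends to the constant function with value D h. *)
Lemma omega_proj_defect h :
  zmul 1 (omega (P (emb h))) - omega (P (emb (T h))) = mDelta (monomial 0 (defect T h)).
Proof.
have cR := ud_R_closed; have sR := closed_subspaceW cR.
have Mw : M (w h) by exact: (wM 0).
have Pin := ud_proj_in; rewrite -omega_U // -ud_proj_U.
rewrite -(linear_onB sR (unitary_linear uW)) //.
rewrite -(linear_onB (subspaceT K) (hproj_linear cR)) //.
have -> : monomial 0 (defect T h) = iota (w h) by exact: esym (id_iotaE I 0 h).
exact: (id_omegaNFE I Mw).
Qed.

(** Two unitaries leave the residual space; the other one, [id_omegaD], sends P (emb h) to the
    embedded vector Q h. *)
Lemma hnorm_omega_proj h : hnorm (omega (P (emb h))) = hnorm (cu_Q C h).
Proof.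
have cR := ud_R_closed; have RP : RD (P (emb h)) by exact: hproj_in.
rewrite (unitary_norm uW) // -(unitary_norm (id_omegaD_unitary I)) //.
rewrite (id_omegaDE I 0 h) /=; case: (cu_emb_isometry C) => _ -> //.
by apply: subset_hclosure; exists h.
Qed.

Lemma iter_Ts_cvg h : (fun n => hnorm (iter n Ts h) ^+ 2) @ \oo --> hnorm (cu_Q C h) ^+ 2.
Proof.
have lTs := adj_linear lT cT.
have e n x y : inner (iter n T x) y = inner x (iter n Ts y).
  by elim: n x y => // n ih x y; rewrite iterSr ih /= adjr.
have := hcvg_reip (cu_Q_lim C h) (hcvg_cst h).
have -> : reip (cu_Q C (cu_Q C h)) h = hnorm (cu_Q C h) ^+ 2.
  by rewrite hnorm_sqr /reip (positive_sym (subspaceT H) (cu_Q_pos C)).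
by under eq_fun do rewrite /reip e -/(reip _ _) -hnorm_sqr.
Qed.

Lemma DeltaL2_closed : closed_subspace DL2.
Proof.
apply: hclosure_subspace; apply: subspace_image; last exact: Delta_linear.
exact/closed_subspaceW/L2_in_closed.
Qed.

Lemma omega_zpower n r : RD r -> omega (zpower U n r) = zmul n (omega r).
Proof.
have RU k : RD r -> RD (zpower U k r).
  move=> Rr; case: k => k /=; last by apply: ud_R_Us; elim: k => //= k; exact: ud_R_Us.
  by elim: k => //= k; exact: ud_R_U.
move=> Rr.
have S k : omega (zpower U (k + 1) r) = zmul 1 (omega (zpower U k r)).
  by rewrite -(zpowerS uU) omega_U //; exact: RU.
elim/int_ind: n => [|n ih|n ih]; first by rewrite zmul0.
  by rewrite -addn1 PoszD S ih zmulA addrC.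
have e : - n.+1%:Z = - n%:Z - 1 by rewrite -addn1 PoszD opprD.
have := S (- n.+1%:Z); rewrite [X in zpower U (X + 1)]e subrK ih => e'.
by rewrite -[LHS](zmulK (-1)) opprK -e' zmulA e addrC.
Qed.

Lemma omega_proj_zpower n h :
  omega (P (zpower U n (emb h))) = zmul n (omega (P (emb h))).
Proof. by rewrite ud_proj_zpower omega_zpower //; exact: ud_proj_in. Qed.

Lemma omega_proj_rec h : omega (P (emb h)) = zmul 1 (omega (P (emb (Ts h)))).
Proof. by rewrite [in LHS]ud_proj_emb omega_U //; exact: ud_proj_in. Qed.

(** Pulled back by [omega], g becomes a residual vector orthogonal to every U^n (emb h), n any
    integer; these are total because the dilation is minimal. *)
Lemma omega_proj_total g : DL2 g -> (forall n h, inner g (zmul n (omega (P (emb h)))) = 0) -> g = 0.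
Proof.
have cR := ud_R_closed.
case: (uW) => _ <- [r Rr <-] rU.
suff -> : r = 0 by exact: (linear_on0 (closed_subspaceW cR) (unitary_linear uW)).
apply: inner_eq0r => y.
have : cspan [set y | exists n h, y = zpower U n (emb h)] y by rewrite ud_minimal.
have : orth [set y | exists n h, y = zpower U n (emb h)] r.
  move=> _ [n [h ->]]; rewrite -(inner_hprojr _ cR) //.
  by rewrite -(unitary_inner (closed_subspaceW cR) uW) ?omega_proj_zpower //; exact: ud_proj_in.
by move=> /orth_cspan; apply.
Qed.

End Dilation.

(** * Ando tuples and the fundamental equations *)

Section UnitaryMaps.
Context {R : realType}.
Implicit Types V W X : innerType R.

Lemma unitary_adjl V W (M : set V) (N : set W) (A : V -> W) x y :
  subspace M -> unitary_on M N A -> M x -> N y ->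
  inner (hadj M A y) x = inner y (A x).
Proof.
move=> sM uA Mx Ny.
by rewrite innerC -(unitary_adj sM uA) // -innerC.
Qed.

Lemma unitary_hadj V W (M : set V) (N : set W) (A : V -> W) :
  subspace M -> unitary_on M N A -> unitary_on N M (hadj M A).
Proof.
move=> sM uA; have [[lA nA] AM] := uA; split; [split|].
- move=> a x' y'; rewrite -AM => -[x Mx <-] [y My <-].
  by rewrite -lA // !(unitary_hadjK sM uA) //; exact: sM.2.
- by move=> y; rewrite -AM => -[x Mx <-]; rewrite (unitary_hadjK sM uA) // nA.
apply/seteqP; split=> [_ [y Ny <-]|x Mx]; first exact: (unitary_hadj_in sM uA Ny).
by exists (A x); [rewrite -AM; exists x | exact: (unitary_hadjK sM uA Mx)].
Qed.

Lemma unitary_comp V W X (M : set V) (N : set W) (L : set X) (A : V -> W) (B : W -> X) :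
  unitary_on M N A -> unitary_on N L B -> unitary_on M L (B \o A).
Proof.
move=> uA uB; have [[lA nA] AM] := uA; have [[lB nB] BN] := uB.
have AN x : M x -> N (A x) by move=> Mx; rewrite -AM; exists x.
split; [split|].
- by move=> a x y Mx My /=; rewrite lA // lB //; exact: AN.
- by move=> x Mx /=; rewrite nB ?nA //; exact: AN.
by rewrite -image_comp AM BN.
Qed.

End UnitaryMaps.

Section Fundamental.
Context {R : realType} {H : hilbertType R}.
Variables T1 T2 : {linear H -> H}.
Hypothesis contraction1 : contraction T1.
Hypothesis contraction2 : contraction T2.
Hypothesis commute : forall x, T1 (T2 x) = T2 (T1 x).
Local Notation T := (T1 \o T2).
Local Notation T1s := (hadj setT T1).
Local Notation T2s := (hadj setT T2).
Local Notation Ts := (hadj setT T).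
Local Notation Ds := (defect Ts).
Local Notation DTs := (defect_space Ts).

Let l1 : linear_on setT T1. Proof. by move=> a x y _ _; exact: linearP. Qed.
Let l2 : linear_on setT T2. Proof. by move=> a x y _ _; exact: linearP. Qed.
Let lT := compT_linear T1 T2.
Let cT := compT_contraction contraction1 contraction2.
Let l1s : linear_on setT T1s := adj_linear l1 contraction1.
Let l2s : linear_on setT T2s := adj_linear l2 contraction2.
Let lTs : linear_on setT Ts := adj_linear lT cT.
Let cTs : contraction Ts := adj_contraction lT cT.

Lemma adj_comp21 x : Ts x = T2s (T1s x).
Proof.
apply: hadj_eq; [exact: subspaceT | by [] | move=> z _].
by rewrite (adjr l2 contraction2) (adjr l1 contraction1).
Qed.

(** Commutativity of T1 and T2 enters here: with the other factorization it makes [T1s] and [T2s]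
    commute with [Ts], and it yields the mirror formula for the second operator G. *)
Lemma adj_comp12 x : Ts x = T1s (T2s x).
Proof.
apply: hadj_eq; [exact: subspaceT | by [] | move=> z _ /=].
by rewrite (adjr l1 contraction1) (adjr l2 contraction2) /= commute.
Qed.

Lemma inner_defects x y : inner (Ds x) (Ds y) = inner x y - inner (Ts x) (Ts y).
Proof. exact: (inner_defect lTs cTs). Qed.

Variable D : ando_dilation T1 T2.
Local Notation K := (ad_K D).
Local Notation V1 := (@ad_V1 _ _ _ _ D).
Local Notation V2 := (@ad_V2 _ _ _ _ D).
Local Notation emb := (@ad_emb _ _ _ _ D).
Local Notation delta := (@ad_delta _ _ _ _ D).
Local Notation delta1 := (@ad_delta1 _ _ _ _ D).
Local Notation delta2 := (@ad_delta2 _ _ _ _ D).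
Local Notation L := (@ad_L _ _ _ _ D).
Local Notation L12 := (@ad_L12 _ _ _ _ D).

Let iso_adj (V : {linear K -> K}) x y : isometry_on setT V ->
  inner (V x) y = inner x (hadj setT V y).
Proof.
case=> lV nV.
have bV z : [set: K] z -> hnorm (V z) <= 1 * hnorm z by move=> _; rewrite nV ?mul1r.
by rewrite (inner_hadjr (@setT_closed R K) lV bV).
Qed.

(** Since the adjoint of V extends [As], each cross term equals <As x, As y>, as does the product of
    the two subtracted vectors; one copy is left with a minus sign. *)
Let inner_delta_gen (V : {linear K -> K}) (As : H -> H) x y : isometry_on setT V ->
  (forall h, hadj setT V (emb h) = emb (As h)) ->
  inner (emb x - V (emb (As x))) (emb y - V (emb (As y))) = inner x y - inner (As x) (As y).
Proof.
move=> iV eV; have [lV nV] := iV; have [le ne] := ad_emb_isometry D.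
have ie a b : inner (emb a) (emb b) = inner a b.
  by apply: (isometry_inner (subspaceT H) le).
rewrite !innerBl !innerBr (iso_adj _ _ iV) eV (isometry_inner (subspaceT K) lV) //.
rewrite (innerC (emb x) (V _)) (iso_adj _ _ iV) eV !ie -innerC.
by rewrite subrr subr0.
Qed.

Lemma inner_delta1 x y :
  inner (delta1 x) (delta1 y) = inner x y - inner (T1s x) (T1s y).
Proof. exact: inner_delta_gen (ad_V1_isometry D) (ad_V1_extends D). Qed.

Lemma inner_delta2 x y :
  inner (delta2 x) (delta2 y) = inner x y - inner (T2s x) (T2s y).
Proof. exact: inner_delta_gen (ad_V2_isometry D) (ad_V2_extends D). Qed.

Let range_closed (d : H -> K) : linear_on setT d -> closed_subspace (hclosure (range d)).
Proof. by move=> ld; apply: hclosure_subspace; exact: subspace_image. Qed.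

Let delta_linear (V : K -> K) (As : H -> H) : linear_on setT V -> linear_on setT As ->
  linear_on setT (fun h => emb h - V (emb (As h))).
Proof.
move=> lV lA a x y _ _; rewrite lA // !linearP lV //.
by rewrite opprD addrACA scalerBr.
Qed.

Let L_closed : closed_subspace L.
Proof.
apply: range_closed; apply: (delta_linear (V := V1 \o V2)) => // a x y _ _ /=.
by rewrite !linearP.
Qed.

Let L12_closed : closed_subspace L12.
Proof.
have c1 : closed_subspace (@ad_L1 _ _ _ _ D).
  by apply: range_closed; apply: delta_linear => // a x y _ _; exact: linearP.
have c2 : closed_subspace (@ad_L2 _ _ _ _ D).
  by apply: range_closed; apply: delta_linear => // a x y _ _; exact: linearP.
have s1 := closed_subspaceW c1; have s2 := closed_subspaceW c2.
split=> [|a p q [p1 p2] [q1 q2]|[x y] [u Lu /hcvg_prod[ux uy]]].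
- by split; exact: subspace0.
- by split; [exact: s1.2 | exact: s2.2].
by split; [case: c1 | case: c2] => _ _; apply; [exists (fun n => (u n).1)|exists (fun n => (u
  n).2)] => // n; case: (Lu n).
Qed.

Variable A : ando_tuple D.
Local Notation F := (@ad_F _ _ _ _ D (@at_dom _ _ _ _ _ A) (at_ell2 A)).
Local Notation UF := (@at_U _ _ _ _ _ A).
Local Notation iota := (@at_iota _ _ _ _ _ A).
Local Notation iotas := (hadj L iota).
Local Notation LambdaF := (@at_LambdaF _ _ _ _ _ A).
Local Notation Lambdas := (hadj L LambdaF).
Local Notation G1 := (G_sharp1 A).
Local Notation G2 := (G_sharp2 A).

Let sL := closed_subspaceW L_closed.
Let uI := at_iota_unitary A.
Let uUF := at_U_unitary A.

(** The alternative in [ad_F] is an implication and is never decided: every vector used explicitly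
    has last component 0, which satisfies it in both cases. *)
Let F_subspace : subspace F.
Proof.
have s := closed_subspaceW L12_closed.
split=> [|a p q [p1 p2] [q1 q2]]; split=> //=; first exact: s.1.
  exact: s.2.
by move=> e; rewrite p2 // q2 // scaler0 addr0.
Qed.

Let delta_L h : L (delta h).
Proof. by apply: subset_hclosure; exists h. Qed.

Let Lambda_linear : linear_on L LambdaF.
Proof.
move=> a x y Lx Ly; case: (at_Lambda_isometry A) => lL _.
by rewrite /at_LambdaF lL //; congr (_, _); rewrite /= scaler0 addr0.
Qed.

Let prod_norm0 (V W : innerType R) (x : V) : hnorm ((x, 0) : V * W) = hnorm x.
Proof. by rewrite /hnorm prod_innerE /= inner0l addr0. Qed.

Let Lambda_bound x : L x -> hnorm (LambdaF x) <= 1 * hnorm x.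
Proof.
move=> Lx; rewrite mul1r /at_LambdaF prod_norm0.
by case: (at_Lambda_isometry A) => _ ->.
Qed.

Let Lambda_in x : L x -> F (LambdaF x).
Proof.
move=> Lx; split => //=; case: (at_Lambda_isometry A) => lL nL.
have bL z : L z -> hnorm (at_Lambda A z) <= 1 * hnorm z by move=> Lz; rewrite nL ?mul1r.
have [_ _ cl] := preimage_closed L_closed L12_closed lL bL.
suff [] : [set x | L x /\ L12 (at_Lambda A x)] x by [].
apply: cl; apply: hclosureS Lx => _ [h _ <-]; split; first exact: delta_L.
by rewrite at_LambdaE; split; apply: subset_hclosure; [exists (T2s h)|exists h].
Qed.

Let iotas_linear : linear_on setT iotas.
Proof. exact: hadj_linear L_closed (unitary_linear uI) (unitary_bound uI). Qed.
Let iotas_in x : L (iotas x).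
Proof. exact: hadj_in L_closed (unitary_linear uI) (unitary_bound uI) x. Qed.
Let iotas_norm x : hnorm (iotas x) <= hnorm x.
Proof.
have := hadj_norm L_closed (unitary_linear uI) (unitary_bound uI) x.
by rewrite normr1 mul1r.
Qed.
Let Lambdas_linear : linear_on setT Lambdas.
Proof. exact: hadj_linear L_closed Lambda_linear Lambda_bound. Qed.
Let Lambdas_in x : L (Lambdas x).
Proof. exact: hadj_in L_closed Lambda_linear Lambda_bound x. Qed.
Let Lambdas_norm x : hnorm (Lambdas x) <= hnorm x.
Proof.
have := hadj_norm L_closed Lambda_linear Lambda_bound x.
by rewrite normr1 mul1r.
Qed.

Let G_gen (E : K -> K * K * at_ell2 A) : linear_on L E ->
  (forall x, L x -> hnorm (E x) <= hnorm x) ->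
  linear_on setT (fun x => iota (Lambdas (E (iotas x)))) /\
  contraction (fun x => iota (Lambdas (E (iotas x)))).
Proof.
move=> lE nE; split=> [a x y _ _|x].
  by rewrite iotas_linear // lE // Lambdas_linear // (unitary_linear uI).
rewrite (unitary_norm uI) //; apply: le_trans (Lambdas_norm _) _.
by apply: le_trans (nE _ _) (iotas_norm x).
Qed.

Let F_P p : F p -> F (at_P p).
Proof.
have s1 := closed_subspaceW L12_closed.
case=> [[p1 p2] _]; split=> //; split=> //=; exact: (s1.1).2.
Qed.

Let P_norm (p : K * K * at_ell2 A) : hnorm (at_P p) <= hnorm p /\ hnorm (at_Pperp p) <= hnorm p.
Proof.
case: p => -[x y] z; rewrite /at_Pperp /at_P /=.
have i (V : innerType R) (a : V) : inner a a = (hnorm a ^+ 2)%:C by rewrite inner_reip hnorm_sqr.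
have n2 (V W : innerType R) (a : V) (b : W) : hnorm ((a, b) : V * W) ^+ 2 = hnorm a ^+ 2 +
  hnorm b ^+ 2.
  by rewrite !hnorm_sqr /reip prod_innerE ReD.
have -> : ((x, y, z) - (x, 0, 0) : K * K * at_ell2 A) = (0, y, z).
  by congr (_, _, _); rewrite /= ?subrr ?subr0.
rewrite -![hnorm _ <= _](@ler_pXn2r _ 2) ?nnegrE ?hnorm_ge0 // !n2 !hnorm0.
by rewrite expr0n /= !addr0 add0r; split; rewrite ?lerDl ?lerD2r ?lerDr ?sqr_ge0 // -addrA
  lerDl addr_ge0 ?sqr_ge0.
Qed.

Let P_linear a (p q : K * K * at_ell2 A) : at_P (a *: p + q) = a *: at_P p + at_P q.
Proof. by rewrite /at_P; congr (_, _, _); rewrite /= scaler0 addr0. Qed.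

Lemma G_sharp1_bounded : linear_on setT G1 /\ contraction G1.
Proof.
apply: (G_gen (E := fun x => at_Pperp (UF (LambdaF x)))) => [a x y Lx Ly|x Lx].
  rewrite Lambda_linear // (unitary_linear uUF) ?Lambda_in //; try exact: Lambda_in.
  by rewrite /at_Pperp P_linear scalerBr opprD addrACA.
apply: le_trans (P_norm _).2 _; rewrite (unitary_norm uUF); last exact: Lambda_in.
by have := Lambda_bound Lx; rewrite mul1r.
Qed.

Lemma G_sharp2_bounded : linear_on setT G2 /\ contraction G2.
Proof.
have uUs := unitary_hadj F_subspace uUF.
apply: (G_gen (E := fun x => hadj F UF (at_P (LambdaF x)))) => [a x y Lx Ly|x Lx].
  rewrite Lambda_linear // P_linear (unitary_linear uUs) //; exact/F_P/Lambda_in.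
rewrite (unitary_norm uUs); last exact/F_P/Lambda_in.
apply: le_trans (P_norm _).1 _.
by have := Lambda_bound Lx; rewrite mul1r.
Qed.

Let inner_G (q : K * K * at_ell2 A) y :
  inner (iota (Lambdas q)) (Ds y) = inner q (LambdaF (delta y)).
Proof.
rewrite -(at_iotaE A) (unitary_inner sL uI) //.
by rewrite (inner_hadjl L_closed Lambda_linear Lambda_bound).
Qed.

Let iotas_Ds x : iotas (Ds x) = delta x.
Proof. by rewrite -(at_iotaE A) (unitary_hadjK sL uI). Qed.

(** Only this prescribed part of the unitary enters the formulas for G, whatever extension [UF] was
    chosen. *)
Let U_Lambda x : UF (LambdaF (delta x)) = (delta1 x, delta2 (T1s x), 0).
Proof.
rewrite /at_LambdaF at_U_extends; last by apply: subset_hclosure; exists (delta x).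
by rewrite at_LambdaE at_U0E.
Qed.

(** Here P_perp keeps the component [delta2 (T1s x)], which is paired with [delta2 y]. For
    [inner_G_sharp2] the adjoint unitary is moved to the other side and P keeps the [delta1]
    components. *)
Lemma inner_G_sharp1 x y :
  inner (G1 (Ds x)) (Ds y) = inner (T1s x) y - inner (Ts x) (T2s y).
Proof.
rewrite /G_sharp1 inner_G iotas_Ds U_Lambda /at_Pperp /at_P /= /at_LambdaF at_LambdaE.
rewrite !prod_innerE /= subrr subr0 inner0l add0r inner0r addr0.
by rewrite inner_delta2 adj_comp21.
Qed.

Lemma inner_G_sharp2 x y :
  inner (G2 (Ds x)) (Ds y) = inner (T2s x) y - inner (Ts x) (T1s y).
Proof.
rewrite /G_sharp2 inner_G iotas_Ds (unitary_adjl F_subspace uUF); first last.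
- exact/F_P/Lambda_in.
- exact: Lambda_in.
rewrite U_Lambda /at_P /= at_LambdaE.
rewrite !prod_innerE /= inner0l addr0 inner0l addr0.
by rewrite inner_delta1 adj_comp12.
Qed.

(** The weak form of the fundamental equation [Ds Tas = Ga Ds + Gb^* Ds Ts]. On a = Ds y the
    formulas [ea] and [eb] contribute <Tbs y, Ts x> with opposite signs; what remains is <Ds y, Ds
    (Tas x)>, and closure covers all of DTs. *)
Let pencil_gen (Ga Gb : H -> H) (Tas Tbs : H -> H) :
  linear_on setT Ga -> contraction Ga -> linear_on setT Gb -> contraction Gb ->
  (forall x y, inner (Ga (Ds x)) (Ds y) = inner (Tas x) y - inner (Ts x) (Tbs y)) ->
  (forall x y, inner (Gb (Ds x)) (Ds y) = inner (Tbs x) y - inner (Ts x) (Tas y)) ->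
  (forall x, Tas (Ts x) = Ts (Tas x)) ->
  forall a x, DTs a ->
  inner (hadj DTs Ga a) (Ds x) + inner (Gb a) (Ds (Ts x)) = inner a (Ds (Tas x)).
Proof.
move=> la ca lb cb ea eb com a x Da.
have cD := defect_space_closed lTs cTs.
have ba z : DTs z -> hnorm (Ga z) <= 1 * hnorm z by rewrite mul1r.
have bb z : [set: H] z -> hnorm (Gb z) <= 1 * hnorm z by rewrite mul1r.
have la' : linear_on DTs Ga by move=> c y z _ _; exact: la.
rewrite (inner_hadjl cD la' ba); last exact: defect_in.
rewrite -(inner_hadjr (@setT_closed R H) lb bb) // -innerDr.
apply/eqP; rewrite -subr_eq0 -innerBr; apply/eqP.
set q := _ - _; suff : orth DTs q by move=> /(_ a Da); rewrite innerC => /eqP; rewrite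
  conjC_eq0 => /eqP.
apply: orth_hclosure => _ [y _ <-].
rewrite innerC; apply/eqP; rewrite conjC_eq0 /q innerBr innerDr.
rewrite (inner_hadjr (@setT_closed R H) lb bb) // innerC ea eb inner_defects com.
by rewrite rmorphB /= -!innerC subrKA subrr.
Qed.

Lemma pencil1 a x : DTs a ->
  inner (hadj DTs G1 a) (Ds x) + inner (G2 a) (Ds (Ts x)) = inner a (Ds (T1s x)).
Proof.
have [la ca] := G_sharp1_bounded; have [lb cb] := G_sharp2_bounded.
apply: pencil_gen => //; [exact: inner_G_sharp1|exact: inner_G_sharp2|move=> y].
by rewrite [Ts (T1s y)]adj_comp12 adj_comp21.
Qed.

Lemma pencil2 a x : DTs a ->
  inner (hadj DTs G2 a) (Ds x) + inner (G1 a) (Ds (Ts x)) = inner a (Ds (T2s x)).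
Proof.
have [la ca] := G_sharp1_bounded; have [lb cb] := G_sharp2_bounded.
apply: pencil_gen => //; [exact: inner_G_sharp2|exact: inner_G_sharp1|move=> y].
by rewrite [Ts (T2s y)]adj_comp21 adj_comp12.
Qed.

End Fundamental.

Lemma hcvg_inner_eq2 (R : realType) (V : innerType R) (a b c : V) (u v w : nat -> V) x y z :
  hcvg u x -> hcvg v y -> hcvg w z ->
  (forall n, inner a (u n) + inner b (v n) = inner c (w n)) ->
  inner a x + inner b y = inner c z.
Proof.
move=> ux vy wz e; have uv : hcvg (fun n => (u n, v n)) (x, y) by apply/hcvg_prod.
have := hcvg_inner_eq (hcvg_cst (a, b)) uv (hcvg_cst c) wz.
by rewrite prod_innerE; apply.
Qed.

(** * The linear pencil on the Hardy component *)

Section Pencil.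
Context {R : realType} {H : hilbertType R}.
Local Notation mu := (circle R).

Definition pointwise (A : H -> H) (f : L2 H) : L2 H := L2of (fun t => A (f t)).

Section Pointwise.
Variables (A : H -> H) (C : R).
Hypotheses (lA : linear_on setT A) (bA : forall x, setT x -> hnorm (A x) <= C * hnorm x).

Lemma pointwiseE f : \forall t \ae mu, pointwise A f t = A (f t).
Proof.
apply: L2ofE; have [sf _] := L2_si f.
apply: (@si_le _ _ _ _ (fun t => C%:C *: f t)).
- apply: (sm_comp _ sf) => u x ux; exact: (bounded_hcvg (subspaceT H) lA bA (fun=> Logic.I)
  Logic.I ux).
- exact: siZ (L2_si f).
apply: aeW => t; rewrite hnormZC; apply: le_trans (bA Logic.I) _.
by rewrite ler_wpM2r ?hnorm_ge0 // ler_norm.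
Qed.

Lemma inner_pointwise_monomial f k x :
  inner (pointwise A f) (monomial k x) = inner f (monomial k (hadj setT A x)).
Proof.
apply: inner_L2_ae.
apply: filterS3 (pointwiseE f) (monomialE k x) (monomialE k (hadj setT A x)) => t -> -> ->.
by rewrite !innerZr (inner_hadjr (@setT_closed R H) lA bA).
Qed.

Lemma H2_in_pointwise M f : H2_in M f -> H2_in setT (pointwise A f).
Proof.
move=> /H2_inP[_ f0]; apply/H2_inP; split; first exact: aeW.
by move=> n x n0; rewrite inner_pointwise_monomial f0.
Qed.

End Pointwise.

Variables (M : set H) (S D A B X : H -> H) (C : R).
Hypotheses (lS : linear_on setT S) (lD : linear_on setT D).
Hypothesis nD : forall x, hnorm (D x) ^+ 2 = hnorm x ^+ 2 - hnorm (S x) ^+ 2.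
Hypotheses (lA : linear_on setT A) (bA : forall x, setT x -> hnorm (A x) <= C * hnorm x).
Hypotheses (lB : linear_on setT B) (bB : forall x, setT x -> hnorm (B x) <= C * hnorm x).
Hypothesis XS : forall x, X (S x) = S (X x).
Hypothesis pencil : forall a x, M a -> inner (A a) (D x) + inner (B a) (D (S x)) = inner a (D
  (X x)).

(** The factor zeta is first moved onto the observability series, where it turns x into S x. The
    remaining multipliers are constant operators, so the series can be compared term by term. *)
Lemma inner_pencil_obs f x : H2_in M f ->
  inner (mult (fun t y => A y + zeta t *: B y) f) (obs S D x) = inner f (obs S D (X x)).
Proof.
move=> Hf; have /H2_inP[Mf _] := Hf.
have -> : mult (fun t y => A y + zeta t *: B y) f = pointwise A f + zmul 1 (pointwise B f).
  apply: L2of_si_ae.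
  apply: (aeS4 _ (pointwiseE lA bA f) (pointwiseE lB bB f) (zmulE 1 (pointwise B f)) (L2DE
    (pointwise A f) (zmul 1 (pointwise B f)))) => t e1 e2 e3 e4.
  by rewrite e4 e3 e1 e2 expr1z.
rewrite innerDl (inner_zmul_obs nD _ (H2_in_pointwise lB bB Hf)).
have c1 := obs_cvg nD x; have c2 := obs_cvg nD (S x); have c3 := obs_cvg nD (X x).
apply: (hcvg_inner_eq2 c1 c2 c3) => N.
have XSn n : X (iter n S x) = iter n S (X x) by elim: n => //= n ih; rewrite XS ih.
elim: N => [|N ih]; first by rewrite !psum0 !inner0r addr0.
rewrite !psumS !innerDr addrACA ih; congr (_ + _).
rewrite /hardy_terms (inner_pointwise_monomial lA bA) (inner_pointwise_monomial lB bB).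
rewrite -innerDr -monomialD; apply: inner_L2_ae.
apply: filterS3 Mf (monomialE N (hadj setT A (D (iter N S x)) + hadj setT B (D (iter N S (S
  x))))) (monomialE N (D (iter N S (X x)))) => t ft -> ->.
(* The equation [pencil] is applied at almost every point with a = f t, so the Fourier coefficients
   of f are never named. *)
rewrite !innerZr innerDr (inner_hadjr (@setT_closed R H) lA bA) // (inner_hadjr (@setT_closed R
  H) lB bB) //.
by rewrite -iterSr /= pencil // XSn.
Qed.

End Pencil.

(** * The commuting unitaries on the residual component *)

Section ResidualUnitary.
Context {R : realType} {H : hilbertType R}.
Variables T1 T2 : {linear H -> H}.
Variable Theta : R -> H -> H.
Variables (C : canonical_unitaries T1 T2) (D : minimal_unitary_dilation T1 T2).
Variable I : identification Theta C D.
Local Notation RD := (@ud_R R H T1 T2 D).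
Local Notation P := (hproj RD).
Local Notation emb := (@ud_emb _ _ _ _ D).
Local Notation DL2 := (DeltaL2 T1 T2 Theta).
Local Notation T1s := (hadj setT T1).
Local Notation T2s := (hadj setT T2).
Local Notation w h := (id_omegaNF I (P (emb h))).

Let sR := closed_subspaceW (ud_R_closed D).

Lemma id_u_unitary : unitary_on setT DL2 (id_u I).
Proof.
exact: unitary_comp (unitary_hadj sR (id_omegaD_unitary I)) (id_omegaNF_unitary I).
Qed.

Lemma id_u_emb h : id_u I (cu_emb C (cu_Q C h)) = w h.
Proof.
have <- : id_omegaD I (P (emb h)) = cu_emb C (cu_Q C h) := id_omegaDE I 0 h.
rewrite /id_u (unitary_hadjK sR (id_omegaD_unitary I)) //.
exact: ud_proj_in.
Qed.

(** Conjugation by [id_u] takes the pairing to the canonical space, where the adjoint of the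
    operator is [Ws]; on vectors Q h it acts through [As], as does each isometry X. *)
Let inner_W (Ws : cu_RD C -> cu_RD C) (As : H -> H) g h : unitary_on setT setT Ws ->
  (forall h, Ws (cu_emb C (cu_Q C h)) = cu_emb C (cu_Q C (As h))) -> DL2 g ->
  inner (id_u I (hadj setT Ws (hadj setT (id_u I) g))) (w h) = inner g (w (As h)).
Proof.
move=> uW eW Dg; have uu := id_u_unitary.
rewrite -!id_u_emb (unitary_inner (@subspaceT _ _) uu) //.
rewrite (unitary_adjl (@subspaceT _ _) uW) // eW.
by rewrite (unitary_adjl (@subspaceT _ _) uu).
Qed.

Let Qin h : cu_ranQ C (cu_Q C h).
Proof. by apply: subset_hclosure; exists h. Qed.

Lemma inner_W_sharp1 g h : DL2 g -> inner (W_sharp1 I g) (w h) = inner g (w (T1s h)).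
Proof.
apply: inner_W (cu_W1s_unitary C) _ => k.
by rewrite cu_W1s_extends // cu_X1sE.
Qed.

Lemma inner_W_sharp2 g h : DL2 g -> inner (W_sharp2 I g) (w h) = inner g (w (T2s h)).
Proof.
apply: inner_W (cu_W2s_unitary C) _ => k.
by rewrite cu_W2s_extends // cu_X2sE.
Qed.

End ResidualUnitary.

(** * The model space as the range of an isometry *)

Lemma subspace_prod (R : realType) (V W : innerType R) (M : set V) (N : set W) :
  subspace M -> subspace N -> subspace [set p : V * W | M p.1 /\ N p.2].
Proof.
move=> sM sN; split=> [|a p q [p1 p2] [q1 q2]]; first by split; exact: subspace0.
by split; [exact: sM.2 | exact: sN.2].
Qed.

Lemma subspaceI (R : realType) (V : innerType R) (M N : set V) :
  subspace M -> subspace N -> subspace (M `&` N).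
Proof.
move=> sM sN; split=> [|a x y [x1 x2] [y1 y2]]; first by split; exact: subspace0.
by split; [exact: sM.2 | exact: sN.2].
Qed.

Section IntertwinedCompressions.
Context {R : realType}.

Variables (H : hilbertType R) (W : innerType R) (N S : set W) (Pi : H -> W).
Hypotheses (sN : subspace N) (SN : S `<=` N) (uPi : unitary_on setT S Pi).
Variables (A : H -> H) (op : W -> W).
Hypotheses (lA : linear_on setT A) (cA : contraction A).
Hypothesis pairing : forall z h, N z -> inner (op z) (Pi h) = inner z (Pi (hadj setT A h)).

Let Pi_in h : S (Pi h). Proof. by case: uPi => _ <-; exists h. Qed.

(** [pairing] exhibits the adjoint of [op] at Pi h as Pi (A^* h), which determines the description
    [hadj] at that point directly from the pairing. The same pairing evaluates the compression in
    [hproj_pairing]. *)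
Lemma hadj_pairing p : S p -> S (hadj N op p).
Proof.
case: uPi => _ <- [h _ <-]; exists (hadj setT A h) => //.
by apply/esym/hadj_eq => // [|z Nz]; [exact/SN/Pi_in | exact: pairing].
Qed.

Lemma hproj_pairing h : subspace S -> Pi (A h) = hproj S (op (Pi h)).
Proof.
move=> sS; apply/esym/hproj_eq => //; case: (uPi) => _ <- _ [k _ <-].
rewrite innerBl pairing; last exact/SN/Pi_in.
by rewrite !(unitary_inner (subspaceT H) uPi) // (adjr lA cA) subrr.
Qed.

End IntertwinedCompressions.

Section HardyShift.
Context {R : realType} {H : hilbertType R}.
Local Notation mu := (circle R).

Lemma H2_in_zmul M (n : nat) (f : L2 H) : subspace M -> H2_in M f -> H2_in M (zmul n f).
Proof.
move=> sM /H2_inP[Mf f0]; apply/H2_inP; split; first exact: L2_in_zmul.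
move=> m x m0; rewrite inner_zmul_monomial -opprD -PoszD f0 //.
by rewrite addn_gt0 m0.
Qed.

Lemma le_hnorm_L2 (f g : L2 H) : (\forall t \ae mu, hnorm (f t) <= hnorm (g t)) ->
  hnorm f <= hnorm g.
Proof.
move=> fg; have [sf _] := L2_si f; have [sg _] := L2_si g.
have := le_sqint sf sg fg; rewrite !L2_sqint lee_fin.
by rewrite ler_pXn2r ?nnegrE ?hnorm_ge0.
Qed.

Lemma monomial_hclosure (n : int) (A : set H) (N : set (L2 H)) : closed_subspace N ->
  (forall x, A x -> N (monomial n x)) -> forall x, hclosure A x -> N (monomial n x).
Proof.
move=> cN AN x Ax.
have b (y : H) : setT y -> hnorm (monomial n y) <= 1 * hnorm y by rewrite hnorm_monomial mul1r.
have [_ _ cl] := preimage_closed (@setT_closed R H) cN (monomial_linear_on n) b.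
by case: (cl x (hclosureS (fun y Ay => conj Logic.I (AN y Ay)) Ax)).
Qed.

End HardyShift.

Section MultiplierLimits.
Context {R : realType} {H : hilbertType R}.
Local Notation mu := (circle R).
Variables (M N : set H) (Theta : R -> H -> H) (B : L2 H -> L2 H).
Hypotheses (cM : closed_subspace M).
Hypothesis cTheta : \forall t \ae mu, contraction_on M N (Theta t).
Hypotheses (lB : linear_on (L2_in M) B) (bB : forall f, L2_in M f -> hnorm (B f) <= 1 * hnorm f).

(** The L2 function g representing [Theta f] is carried along existentially, because its existence
    for general f is part of what closedness delivers: the representatives are Cauchy since [Theta]
    is contractive. *)
Lemma orth_graph_closed (p q : L2 H) : closed_subspace
  [set f | L2_in M f /\ exists2 g : L2 H, \forall t \ae mu, g t = Theta t (f t) &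
                              inner p g + inner q (B f) = 0].
Proof.
have cL := L2_in_closed cM; have sL := closed_subspaceW cL; have sM := closed_subspaceW cM.
split=> [|a f f' [Mf [g gE g0]] [Mf' [g' gE' g0']]|f [u Xu uf]] /=.
- split; first exact: subspace0; exists 0; last by rewrite (linear_on0 sL lB) !inner0r addr0.
  apply: filterS2 cTheta (L2_zeroE H) => t [lt _ _] h.
  by rewrite [X in Theta t X]h (linear_on0 sM lt).
- split; first exact: sL.2; exists (a *: g + g').
    apply: (aeS4 _ (aeI (L2DE (a *: g) g') (L2ZE a g)) (aeI (L2DE (a *: f) f') (L2ZE a f)) (aeI
      gE gE') (aeI (aeI Mf Mf') cTheta)).
    by move=> t [-> ->] [-> ->] [-> ->] [[mf mf']] [lt _ _]; rewrite lt.
  by rewrite lB // !innerDr !innerZr addrACA -mulrDr g0 g0' mulr0 addr0.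
have Mu n : L2_in M (u n) by case: (Xu n).
have Mf : L2_in M f by case: cL => _ _; apply; exists u.
have Xg n : exists g : L2 H, (\forall t \ae mu, g t = Theta t ((u n : L2 H) t)) /\
    inner p g + inner q (B (u n)) = 0 by case: (Xu n) => _ [g gE g0]; exists g.
have [g hg] := choice Xg.
have gB m n : hnorm (g m - g n) <= hnorm (u m - u n).
  apply: le_hnorm_L2.
  apply: (aeS4 _ (aeI (L2BE (g m) (g n)) (L2BE (u m) (u n))) (aeI (hg m).1 (hg n).1) (aeI (Mu
    m) (Mu n)) cTheta).
  move=> t [-> ->] [-> ->] [mm mn] [lt _ nt].
  rewrite -(linear_onB sM lt) //; apply: nt; exact: (subspaceB sM).
have [G gG] : exists G, hcvg g G.
  apply: L2_complete => e e0; have [n0 h] := hcvg_hcauchy uf e0.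
  by exists n0 => m n hm hn; apply: le_lt_trans (gB m n) (h _ _ hm hn).
split=> //; exists G.
  have [k [kn hk]] := L2_ae_subseq uf.
  (* A subsequence of the first subsequence, along which both u and g converge almost everywhere. *)
  have [k' [kn' hk']] := L2_ae_subseq (hcvg_sub kn gG).
  have hE : \forall t \ae mu, forall n, g n t = Theta t ((u n : L2 H) t) /\ M ((u n : L2 H) t).
    by apply: ae_foralln => n; exact: aeI (hg n).1 (Mu n).
  apply: (aeS4 _ (aeI hk hk') hE cTheta Mf) => t [ut gt] et [lt _ nt] mf.
  apply: (hcvg_unique gt).
  have b x : M x -> hnorm (Theta t x) <= 1 * hnorm x by rewrite mul1r; exact: nt.
  have := bounded_hcvg sM lt b (fun n => (et (k (k' n))).2) mf (hcvg_sub kn' ut).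
  by congr (hcvg _ _); apply/funext => n /=; rewrite (et _).1.
have Bu := bounded_hcvg sL lB bB Mu Mf uf.
rewrite (hcvg_inner_eq2 (c := 0) gG Bu (hcvg_cst 0)) => [|n]; first by rewrite inner0r.
by rewrite inner0r; exact: (hg n).2.
Qed.

End MultiplierLimits.

(* [O h] and [w h] are the two components of the image of [h] in the model space. *)
Section RangeOfModelMap.
Context {R : realType} {H : hilbertType R}.
Local Notation mu := (circle R).
Variables (T S d ds : H -> H) (Theta : R -> H -> H) (B : L2 H -> L2 H) (O w : H -> L2 H).
Local Notation DT := (hclosure (range d)).
Local Notation DTs := (hclosure (range ds)).
Hypotheses (cDT : closed_subspace DT) (cDTs : closed_subspace DTs).
Hypothesis cTheta : \forall t \ae mu, contraction_on DT DTs (Theta t).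
Hypotheses (lB : linear_on (L2_in DT) B)
  (bB : forall f, L2_in DT f -> hnorm (B f) <= 1 * hnorm f)
  (zB : forall f, L2_in DT f -> B (zmul 1 f) = zmul 1 (B f)).
Hypothesis TS : forall x y, inner (T x) y = inner x (S y).
Hypothesis inner_Ow : forall x y, inner (O x) (O y) + inner (w x) (w y) = inner x y.
Hypotheses (O_in : forall x, H2_in DTs (O x))
  (O_rec : forall x, O x = monomial 0 (ds x) + zmul 1 (O (S x)))
  (w_rec : forall x, w x = zmul 1 (w (S x))).
Hypothesis ThetaO : forall x, \forall t \ae mu, Theta t (d x) = (zmul 1 (O x) - O (T x) : L2 H) t.
Hypothesis Bw : forall x, B (monomial 0 (d x)) = zmul 1 (w x) - w (T x).

Let sDT := closed_subspaceW cDT.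
Let sDTs := closed_subspaceW cDTs.

Let d_in x : DT (d x). Proof. by apply: subset_hclosure; exists x. Qed.

Let inner_zmul_w g x : inner (zmul 1 g) (w x) = inner g (w (S x)).
Proof. by rewrite (w_rec x) inner_zmul. Qed.

Let inner_zmul_O f x : H2_in DTs f -> inner (zmul 1 f) (O x) = inner f (O (S x)).
Proof.
move=> /H2_inP[_ /(_ 1%N (ds x) isT) f1].
by rewrite (O_rec x) innerDr inner_zmul_monomial sub0r f1 add0r inner_zmul.
Qed.

Let zmulS (n : nat) (k : L2 H) : zmul n.+1 k = zmul 1 (zmul n k).
Proof. by rewrite zmulA -PoszD add1n. Qed.

Let dO g : L2 H := zmul 1 (O g) - O (T g).
Let dw g : L2 H := zmul 1 (w g) - w (T g).

Let B_monomial (n : nat) g : B (monomial n (d g)) = zmul n (dw g).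
Proof.
elim: n => [|n ih]; first by rewrite Bw zmul0.
have -> : monomial n.+1 (d g) = zmul 1 (monomial n (d g)).
  by rewrite zmul_monomial -PoszD add1n.
by rewrite zB ?ih -?zmulS //; apply: L2_in_monomial.
Qed.

Let Theta_monomial (n : nat) g : \forall t \ae mu,
  (zmul n (dO g) : L2 H) t = Theta t ((monomial n (d g) : L2 H) t).
Proof.
apply: (aeS4 _ (zmulE n (dO g)) (monomialE n (d g)) (ThetaO g) cTheta).
by move=> t -> -> <- [lt _ _]; rewrite (linear_onZ sDT lt).
Qed.

Let pairing_zmul (n : nat) f g h : H2_in DTs f ->
  inner (zmul n f) (O h) + inner (zmul n g) (w h) =
  inner f (O (iter n S h)) + inner g (w (iter n S h)).
Proof.
move=> Hf; elim: n h => [|n ih] h; first by rewrite !zmul0.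
rewrite (zmulS n f) (zmulS n g) inner_zmul_O ?inner_zmul_w; last exact: H2_in_zmul.
by rewrite ih -iterSr.
Qed.

(** The shift adjoint turns h into S h, and [inner_Ow] then reduces the sum to <g, S h> - <T g,
    h>. *)
Let dOw_orth g h : inner (dO g) (O h) + inner (dw g) (w h) = 0.
Proof.
rewrite /dO /dw !innerBl inner_zmul_O // inner_zmul_w.
by rewrite addrACA -opprD !inner_Ow TS subrr.
Qed.

Let dO_in g : H2_in DTs (dO g).
Proof.
have sH := closed_subspaceW (H2_in_closed cDTs).
by apply: (subspaceB sH) => //; exact: (H2_in_zmul 1).
Qed.

Lemma range_orth_graph f h : H2_in DT f ->
  inner (O h) (mult Theta f) + inner (w h) (B f) = 0.
Proof.
have cX := orth_graph_closed cDT cTheta lB bB (O h) (w h).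
move=> /(H2_in_cspan cDT) Hf; have /= := cspan_min cX _ Hf; case.
  (* It suffices to treat [zeta^n d g]; the power of zeta is absorbed by replacing h with
     [iter n S h], which leaves the case n = 0. *)
  move=> _ [n [x [Dx ->]]]; apply: monomial_hclosure cX _ x Dx => _ [g _ <-].
  split; first exact: L2_in_monomial.
  exists (zmul n (dO g)); first exact: Theta_monomial.
  rewrite B_monomial innerC [X in _ + X]innerC -rmorphD pairing_zmul //.
  by rewrite dOw_orth rmorph0.
by move=> _ [g gE]; rewrite /mult (L2of_si_ae gE).
Qed.

Variables p q : L2 H.
Hypothesis pq_graph : forall f, H2_in DT f -> inner p (mult Theta f) + inner q (B f) = 0.
Hypothesis pq_range : forall h, inner p (O h) + inner q (w h) = 0.

(** The vector with exponent n + 1 at h differs from the one with exponent n at T h by the graph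
    vector of [zeta^n d h], to which (p, q) is orthogonal. *)
Let orth_zmul (n : nat) h : inner p (zmul n (O h)) + inner q (zmul n (w h)) = 0.
Proof.
elim: n h => [|n ih] h; first by rewrite !zmul0.
have := pq_graph (H2_in_monomial n sDT (d_in h)).
have -> : mult Theta (monomial n (d h)) = zmul n (dO h).
  by apply: L2of_si_ae; apply: filterS (Theta_monomial n h) => t ->.
rewrite B_monomial /dO /dw !zmulB !zmulA -PoszD addn1.
have cancel (x y x' y' : R[i]) : x - y + (x' - y') = 0 -> y + y' = 0 -> x + x' = 0.
  by rewrite addrACA -opprD => + e; rewrite e subr0.
by move=> e; apply: cancel (ih (T h)); rewrite -[in LHS]innerBr -[X in _ + X]innerBr.
Qed.

Lemma orth_range_eq0 : H2_in DTs p -> p = 0.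
Proof.
move=> Hp.
have m0 (n : nat) h : inner p (monomial n (ds h)) = 0.
  have e1 := orth_zmul n h; have e2 := orth_zmul n.+1 (S h).
  have cancel (x y z : R[i]) : x + y + z = 0 -> y + z = 0 -> x = 0.
    by rewrite -addrA => + e; rewrite e addr0.
  move: e1; rewrite (O_rec h) (w_rec h) zmulD zmulA zmulA zmul_monomial addr0 -PoszD addn1.
  by rewrite innerDr => e1; exact: cancel e1 e2.
have co := orth_closed [set p].
apply: inner_eq0; have : orth [set p] p.
  apply: (cspan_min co _ (H2_in_cspan cDTs Hp)) => _ [n [x [Dx ->]]].
  apply: monomial_hclosure co _ x Dx => _ [g _ <-] _ ->.
  by rewrite innerC m0 rmorph0.
exact.
Qed.

Let w_iter (m : nat) h : w (iter m S h) = zmul (- m%:Z) (w h).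
Proof.
elim: m => [|m ih]; first by rewrite oppr0 zmul0.
have := w_rec (iter m S h); rewrite ih => e.
by rewrite /= -[LHS](zmulK (-1)) opprK -e zmulA -opprD -PoszD add1n.
Qed.

(** Negative exponents come from the range itself, since [zeta^-m w h = w (S^m h)]; nonnegative ones
    come from [orth_zmul]. *)
Lemma orth_range_residual (n : int) h : p = 0 -> inner q (zmul n (w h)) = 0.
Proof.
move=> p0; case: n => n; first by have := orth_zmul n h; rewrite p0 inner0l add0r.
by rewrite NegzE -w_iter; have := pq_range (iter n.+1 S h); rewrite p0 inner0l add0r.
Qed.

End RangeOfModelMap.

Lemma eq_inner_pair (R : realType) (V W : innerType R) (a a' c c' : V) (b b' d d' : W) :
  inner a c = inner a' c' -> inner b d = inner b' d' ->
  inner (a, b) (c, d) = inner (a', b') (c', d').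
Proof. by rewrite !prod_innerE /= => -> ->. Qed.

(** * The unitary onto the model space *)

Section Model.
Context {R : realType} {H : hilbertType R}.
Variables T1 T2 : {linear H -> H}.
Hypothesis contraction1 : contraction T1.
Hypothesis contraction2 : contraction T2.
Hypothesis commute : forall x, T1 (T2 x) = T2 (T1 x).
Variable c : characteristic_data T1 T2.

Local Notation mu := (circle R).
Local Notation T := (T1 \o T2).
Local Notation T1s := (hadj setT T1).
Local Notation T2s := (hadj setT T2).
Local Notation Ts := (hadj setT T).
Local Notation Ds := (defect Ts).
Local Notation DT := (defect_space T).
Local Notation DTs := (defect_space Ts).
Local Notation Theta := (cd_Theta c).
Local Notation I := (cd_identification c).
Local Notation mTheta := (mult Theta).
Local Notation mDelta := (mult (Delta T1 T2 Theta)).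
Local Notation DL2 := (DeltaL2 T1 T2 Theta).
Local Notation O := (obs Ts Ds).
Local Notation w h := (id_omegaNF I (hproj (@ud_R R H T1 T2 (cd_udilation c)) (ud_emb
  (cd_udilation c) h))).

Let ThetaE := cd_ThetaE c.
Let lT := compT_linear T1 T2.
Let cT := compT_contraction contraction1 contraction2.
Let lTs : linear_on setT Ts := adj_linear lT cT.
Let cTs : contraction Ts := adj_contraction lT cT.
Let lDs : linear_on setT Ds := defect_linear lTs cTs.
Let nDs x : hnorm (Ds x) ^+ 2 = hnorm x ^+ 2 - hnorm (Ts x) ^+ 2 :=
  hnorm_defect lTs cTs x.
Let cDT : closed_subspace DT := defect_space_closed lT cT.
Let cDTs : closed_subspace DTs := defect_space_closed lTs cTs.
Let sDTs := closed_subspaceW cDTs.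
Let sDT := closed_subspaceW cDT.

Definition model_map (h : H) : L2 H * L2 H := (O h, w h).
Local Notation Pi := model_map.

Let w_linear : linear_on setT (fun h => w h).
Proof.
move=> a x y _ _; rewrite linearP (hproj_linear (ud_R_closed _)) //.
by rewrite (unitary_linear (id_omegaNF_unitary I)) //; exact: ud_proj_in.
Qed.

Let O_linear : linear_on setT O := obs_linear lTs lDs nDs.

Lemma model_map_linear : linear_on setT Pi.
Proof.
by move=> a x y _ _; rewrite /Pi O_linear // w_linear.
Qed.

(** The Hardy component loses the limit of [|Ts^n h|^2], which is [|Q h|^2], and the residual
    component restores exactly this amount. *)
Lemma model_map_norm h : hnorm (Pi h) = hnorm h.
Proof.
apply/eqP; rewrite -(@eqrXn2 _ 2) ?hnorm_ge0 //; apply/eqP.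
have e : hnorm (Pi h) ^+ 2 = hnorm (O h) ^+ 2 + hnorm (w h) ^+ 2.
  by rewrite !hnorm_sqr /reip prod_innerE ReD.
rewrite e hnorm_omega_proj (obs_norm nDs (@iter_Ts_cvg _ _ _ _ contraction1 contraction2
  (cd_canonical c) h)).
by rewrite subrK.
Qed.

Let inner_Pi x y : inner (O x) (O y) + inner (w x) (w y) = inner x y.
Proof.
have := isometry_inner (subspaceT H) model_map_linear (fun z _ => model_map_norm z) (Logic.I :
  setT x) (Logic.I : setT y).
by rewrite prod_innerE.
Qed.

Let w_in h : DL2 (w h).
Proof. by apply: (unitary_in (id_omegaNF_unitary I)); exact: ud_proj_in. Qed.

Let O_in h : H2_in DTs (O h).
Proof. by apply: (H2_in_obs nDs) => // x; exact: defect_in. Qed.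

Lemma model_map_total h : model_total c (Pi h).
Proof. by split; [exact: O_in | exact: w_in]. Qed.

Let w_rec h : w h = zmul 1 (w (Ts h)).
Proof. exact: (omega_proj_rec contraction1 contraction2 ThetaE I). Qed.

Lemma model_total_subspace : subspace (model_total c).
Proof.
have sH := closed_subspaceW (H2_in_closed cDTs).
have sD := closed_subspaceW (DeltaL2_closed contraction1 contraction2 I).
exact: subspace_prod sH sD.
Qed.

Lemma model_op_pairing z h : model_total c z ->
  inner (model_op z) (Pi h) = inner z (Pi (Ts h)).
Proof.
case: z => f g [/= Hf _]; rewrite /model_op /direct_sum /= !zmul1E.
apply: eq_inner_pair; first exact: (inner_zmul_obs nDs _ Hf).
exact: etrans (congr1 (inner _) (w_rec h)) (inner_zmul 1 g (w (Ts h))).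
Qed.

Let G1b := G_sharp1_bounded contraction1 contraction2 (cd_tuple c).
Let G2b := G_sharp2_bounded contraction1 contraction2 (cd_tuple c).

Let bound (A : H -> H) : contraction A -> forall x, setT x -> hnorm (A x) <= 1 * hnorm x.
Proof. by move=> cA x _; rewrite mul1r. Qed.

Let hadj_DTs (A : H -> H) : linear_on setT A -> contraction A ->
  linear_on setT (hadj DTs A) /\ contraction (hadj DTs A).
Proof.
move=> lA cA; have lA' : linear_on DTs A by move=> a x y _ _; exact: lA.
have bA x : DTs x -> hnorm (A x) <= 1 * hnorm x by rewrite mul1r.
split; first exact: (hadj_linear cDTs lA' bA).
by move=> x; have := hadj_norm cDTs lA' bA x; rewrite normr1 mul1r.
Qed.

Lemma model_op1_pairing z h : model_total c z ->
  inner (model_op1 c z) (Pi h) = inner z (Pi (T1s h)).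
Proof.
case: z => f g [/= Hf Dg]; rewrite /model_op1 /direct_sum /=.
have [lA cA] := hadj_DTs G1b.1 G1b.2.
apply: eq_inner_pair; last exact: inner_W_sharp1.
apply: (inner_pencil_obs nDs lA (bound cA) G2b.1 (bound G2b.2) _ _ _ Hf).
  (* Commutation of [T1s] with [Ts], from the two factorizations of [Ts]. *)
  by move=> x; rewrite (adj_comp12 contraction1 contraction2 commute (T1s x)) (adj_comp21
    contraction1 contraction2).
by move=> a x; exact: pencil1.
Qed.

Lemma model_op2_pairing z h : model_total c z ->
  inner (model_op2 c z) (Pi h) = inner z (Pi (T2s h)).
Proof.
case: z => f g [/= Hf Dg]; rewrite /model_op2 /direct_sum /=.
have [lA cA] := hadj_DTs G2b.1 G2b.2.
apply: eq_inner_pair; last exact: inner_W_sharp2.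
apply: (inner_pencil_obs nDs lA (bound cA) G1b.1 (bound G1b.2) _ _ _ Hf).
  by move=> x; rewrite (adj_comp21 contraction1 contraction2 (T2s x)) (adj_comp12 contraction1
    contraction2 commute).
by move=> a x; exact: pencil2.
Qed.

Let cTh : \forall t \ae mu, contraction_on DT DTs (Theta t).
Proof. by case: ThetaE. Qed.

Let bDelta f : L2_in DT f -> hnorm (mDelta f) <= 1 * hnorm f.
Proof. exact: (Delta_norm I). Qed.

Let zDelta f : L2_in DT f -> mDelta (zmul 1 f) = zmul 1 (mDelta f).
Proof. by move=> Df; exact: (Delta_mult contraction1 contraction2 ThetaE Df). Qed.

Let TTs x y : inner (T x) y = inner x (Ts y).
Proof. by rewrite (adjr lT cT). Qed.

Let O_rec x : O x = monomial 0 (Ds x) + zmul 1 (O (Ts x)) := obs_rec nDs x.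

Let ThetaO x := boundary_value lT cT x ThetaE.

Let Deltaw x : mDelta (monomial 0 (defect T x)) = zmul 1 (w x) - w (T x).
Proof. exact/esym/(omega_proj_defect contraction1 contraction2 ThetaE I). Qed.

Lemma model_map_in h : model_space c (Pi h).
Proof.
split; first exact: model_map_total.
move=> _ [f Hf <-]; rewrite prod_innerE.
exact: (range_orth_graph cDT cDTs cTh (Delta_linear I) bDelta zDelta TTs inner_Pi O_in O_rec
  w_rec ThetaO Deltaw h Hf).
Qed.

Lemma model_space_subspace : subspace (model_space c).
Proof.
apply: subspaceI; first exact: model_total_subspace.
exact/closed_subspaceW/orth_closed.
Qed.

Lemma model_space_orth q : model_space c q -> (forall h, inner q (Pi h) = 0) -> q = 0.
Proof.
case: q => p q [[/= Hp Dq] pq] qP.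
have g f : H2_in DT f -> inner p (mTheta f) + inner q (mDelta f) = 0.
  by move=> Hf; have := pq _ (ex_intro2 _ _ f Hf erefl); rewrite prod_innerE.
have r h : inner p (O h) + inner q (w h) = 0 by have := qP h; rewrite prod_innerE.
have p0 := orth_range_eq0 cDT cDTs cTh zDelta O_rec w_rec ThetaO Deltaw g r Hp.
have q0 : q = 0.
  apply: (omega_proj_total contraction1 contraction2 ThetaE (I := I) Dq) => n h.
  exact: (orth_range_residual cDT cTh zDelta w_rec ThetaO Deltaw g r n h p0).
by rewrite p0 q0.
Qed.

Lemma model_map_unitary : unitary_on setT (model_space c) Pi.
Proof.
split; first by split; [exact: model_map_linear | move=> x _; exact: model_map_norm].
apply/seteqP; split=> [_ [h _ <-]|p Sp]; first exact: model_map_in.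
have b x : [set: H] x -> hnorm (Pi x) <= 1 * hnorm x by rewrite model_map_norm mul1r.
(* For surjectivity the preimage is the adjoint of Pi at p: the difference p - Pi (Pi^* p) lies in
   the model space and is orthogonal to the range. *)
exists (hadj setT Pi p) => //; apply/esym/eqP; rewrite -subr_eq0; apply/eqP.
apply: model_space_orth => [|h].
  by apply: (subspaceB model_space_subspace) => //; exact: model_map_in.
rewrite innerBl (isometry_inner (subspaceT H) model_map_linear) //.
  by rewrite (inner_hadjl (@setT_closed R H) model_map_linear b) // subrr.
by move=> z _; exact: model_map_norm.
Qed.

End Model.

Theorem theorem4p4 (R : realType) (H : hilbertType R) (T1 T2 : {linear H -> H})
    (contraction1 : contraction T1) (contraction2 : contraction T2)
    (commute : forall x, T1 (T2 x) = T2 (T1 x))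
    (T_cnu : cnu (T1 \o T2))
    (c : characteristic_data T1 T2) :
  [/\ coinvariant c (model_space c) (model_op1 c),
      coinvariant c (model_space c) (model_op2 c),
      coinvariant c (model_space c) model_op &
      exists Pi : H -> L2 H * L2 H,
        [/\ unitary_on setT (model_space c) Pi,
            forall h, Pi (T1 h) = compression (model_space c) (model_op1 c) (Pi h),
            forall h, Pi (T2 h) = compression (model_space c) (model_op2 c) (Pi h) &
            forall h, Pi (T1 (T2 h)) = compression (model_space c) model_op (Pi h)]].
Proof.
have l1 : linear_on setT T1 by move=> a x y _ _; exact: linearP.
have l2 : linear_on setT T2 by move=> a x y _ _; exact: linearP.
have lT := compT_linear T1 T2.
have cT := compT_contraction contraction1 contraction2.
have sN := model_total_subspace contraction1 contraction2 c.
have sS := model_space_subspace contraction1 contraction2 c.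
have SN : model_space c `<=` model_total c by move=> p [].
have uPi := model_map_unitary contraction1 contraction2 c.
have p1 := model_op1_pairing contraction1 contraction2 commute (c := c).
have p2 := model_op2_pairing contraction1 contraction2 commute (c := c).
have p3 := model_op_pairing contraction1 contraction2 (c := c).
split; [exact: hadj_pairing p1|exact: hadj_pairing p2|exact: hadj_pairing p3|].
exists (model_map c); split => // h; rewrite /compression.
- exact: (hproj_pairing SN uPi l1 contraction1 p1).
- exact: (hproj_pairing SN uPi l2 contraction2 p2).
- exact: (hproj_pairing SN uPi lT cT p3).
Qed.
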